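(* There is no lattice $\Lambda\subset\mathbb{R}^{16}$ such that both $\Lambda$ and $\Lambda^*$ are strongly perfect and $\min(\Lambda)\min(\Lambda^* )=9$.
   Context: $\Lambda^*$ is the dual lattice, $\min$ the minimal nonzero norm. A lattice is strongly perfect if its set of minimal vectors forms a spherical 4-design, equivalently $\sum_{x\in S}(x,\alpha)^4=\frac{3|S|}{n(n+2)}\min(\Lambda)^2(\alpha,\alpha)^2$ for all $\alpha$, where $\mathrm{Min}(\Lambda)=S\sqcup -S$. *)

(* Defs.v *)
From HB Require Import structures.
From mathcomp Require Import all_boot all_order all_algebra.
From mathcomp Require Import finmap.
From mathcomp Require Import all_classical all_reals all_analysis.
(* The notations of [mpoly] clash with those of analysis. *)
From mathcomp Require Import -(notations) mpoly.

Set Implicit Arguments.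
Unset Strict Implicit.
Unset Printing Implicit Defensive.

Import Order.TTheory GRing.Theory Num.Theory.
Import numFieldNormedType.Exports.

Local Open Scope classical_set_scope.
Local Open Scope ring_scope.

Definition dot (R : realType) (n : nat) (x y : 'rV[R]_n) : R :=
  (x *m y^T) 0 0.

(* Full-rank lattices: the integer row combinations of the rows of an
   invertible matrix. *)
Definition is_lattice (R : realType) (n : nat) (L : set 'rV[R]_n) : Prop :=
  exists2 B : 'M[R]_n, B \in unitmx &
    L = [set map_mx intr z *m B | z in [set: 'rV[int]_n]].

Definition dual_lattice (R : realType) (n : nat) (L : set 'rV[R]_n) :
    set 'rV[R]_n :=
  [set y | forall x, L x -> dot x y \is a Num.int].

(* The norm of a lattice vector [x] is [dot x x], without square root. *)
Definition lattice_min (R : realType) (n : nat) (L : set 'rV[R]_n) : R :=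
  inf [set dot x x | x in L `\ 0].

Definition min_vectors (R : realType) (n : nat) (L : set 'rV[R]_n) :
    set 'rV[R]_n :=
  [set x | [/\ L x, x != 0 & dot x x = lattice_min L]].

(* [m] is the squared radius. *)
Definition sphere (R : realType) (n : nat) (m : R) : set 'rV[R]_n :=
  [set x | dot x x = m].

(* R^n with its Borel sigma-algebra. *)
Definition borel_rV (R : realType) (n : nat) :=
  g_sigma_algebraType (@open 'rV[R]_n).

(* For [m > 0] and [n > 0] there is exactly one such measure, the normalized
   surface measure of the sphere. *)
Definition is_uniform_on_sphere (R : realType) (n : nat) (m : R)
    (sigma : probability (borel_rV R n) R) : Prop :=
  sigma (@sphere R n m) = 1%E /\
  forall Q : 'M[R]_n, Q *m Q^T = 1%:M ->
  forall A : set (borel_rV R n), measurable A ->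
    sigma [set x : 'rV[R]_n | A (x *m Q)] = sigma A.

Definition poly_eval (R : realType) (n : nat) (p : mpoly n R)
    (x : 'rV[R]_n) : R :=
  meval (fun i => x 0 i) p.

(* Spherical t-designs on the sphere of squared radius [m]: every polynomial of
   total degree at most [t] has the same average over the finite set [X] as
   over the sphere.  [mpoly.msize] is one more than the total degree. *)
Definition spherical_design (R : realType) (n t : nat) (m : R)
    (X : set 'rV[R]_n) : Prop :=
  [/\ finite_set X, X !=set0, X `<=` @sphere R n m &
    exists2 sigma : probability (borel_rV R n) R, is_uniform_on_sphere m sigma &
      forall p : mpoly n R, (mpoly.msize p <= t.+1)%N ->
        (\int[sigma]_x (poly_eval p x)%:E =
         (#|` fset_set X|%:R^-1 * \sum_(x \in X) poly_eval p x)%:E)%E].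

Definition strongly_perfect (R : realType) (n : nat) (L : set 'rV[R]_n) : Prop :=
  spherical_design 4 (lattice_min L) (min_vectors L).

(* Main.v *)
(* Put m = min L, m' = min L* and rescale L by 3/m and L* by 3/m'; as m m' = 9,
   the two lattices stay dual to each other and both now have minimum 3.  The
   4-design identities for Min L, taken at a minimal vector a of L*, give
   |Min L| = 256 k; the vectors of Min L whose inner product with a is 2 project
   to a spherical code in R^15 with cosines at most 1/10, and Delsarte's bound
   for this code gives k <= 19.  Taken at any vector of L* of rescaled norm c, the
   identities make c rational with k c (c - 2) an integer, so that the square of
   its denominator divides k, and c lies in Z/3 or in Z/4.  The roles of L and L*
   can be exchanged.

   On the other hand, Poisson summation gives theta_L(t) = K t^-8 theta_L*(1/t)
   with K >= 0.  Hence for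
     g(r) = sum_j c_j (exp (- pi t_j r) - t_j^-8 exp (- pi r / t_j))
   the sum of g over the norms of L is - K times its sum over the norms of L*.
   With suitable t_j and c_j, found by linear programming,
   g(0) + 256 * 19 * g(3) > 0 and g(r) >= 0 for all r > 3 in Z/3 or Z/4, so both
   sums are positive: a contradiction. *)

From HB Require Import structures.
Require Import Defs.
From mathcomp Require Import all_boot all_order all_algebra.
From mathcomp Require Import all_classical all_reals all_analysis.
From mathcomp Require Import finmap complex measurable_realfun ssrZ ring lra zify.
From mathcomp Require Import -(notations) mpoly.
From Stdlib Require ZArith.Znat.

Set Implicit Arguments.
Unset Strict Implicit.
Unset Printing Implicit Defensive.

Import Order.TTheory GRing.Theory Num.Theory.
Import numFieldNormedType.Exports.

Local Open Scope classical_set_scope.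
Local Open Scope ring_scope.

(** * The theta inversion formula in dimension one *)

(** Since the design identities make all norms rational, Poisson summation can be proved without
    Fourier analysis on [R^16]: a form with rational Gram matrix is [T diag(d) T^T] with [T]
    integral, so its theta sum splits, over classes modulo an integer, into products of
    one-dimensional theta sums, and the inversion formula in dimension one is a limit of identities
    between binomial coefficients. Only the sign of [K] enters, because [g] is antisymmetric under
    Poisson summation; the constant [kappa] of the inversion formula can thus stay an unspecified
    nonnegative number.

    A sum over a lattice is a limit of sums over finite boxes containing 0. As [g >= 0] beyond norm
    3, each box sum is already at least the minimum of [g(0)] and [g(0) + 4864 g(3)], so positivity
    survives in the limit, however the boxes grow.

    All norms that occur are multiples of 1/12, so the certificate only involves powers of one
    number for each rate: a stretch of norms is checked one by one, and a comparison of consecutive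
    terms covers all larger ones. *)

Lemma cos_binomial (R : realType) n (y p : R) :
  \sum_(i < n.+1) 'C(n, i)%:R * cos ((i%:R *+ 2 - n%:R) * y + p) =
  (cos y *+ 2) ^+ n * cos p.
Proof.
(* The phase [p] carries the induction: a further factor [2 cos y] turns [cos p] into
   [cos (p - y) + cos (p + y)]. *)
elim: n p => [|n IHn] p.
  by rewrite big_ord1 bin0 !mul1r mul0rn subr0 mul0r add0r.
have -> : (cos y *+ 2) ^+ n.+1 * cos p =
    (cos y *+ 2) ^+ n * cos (p - y) + (cos y *+ 2) ^+ n * cos (p + y).
  by rewrite exprS (cosD p y) (cosB p y); ring.
rewrite -!IHn big_ord_recl.
under eq_bigr => i _ do rewrite lift0 binS natrD mulrDl.
rewrite big_split /= addrA bin0; congr (_ + _); last first.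
  apply: eq_bigr => i _; congr (_ * cos _).
  rewrite -(@natr1 R i) -(@natr1 R n); ring.
rewrite [X in _ + X]big_ord_recr /= bin_small // mul0r addr0.
rewrite [RHS]big_ord_recl bin0; congr (_ + _).
  by congr (_ * cos _); rewrite -(@natr1 R n) /=; ring.
apply: eq_bigr => i _; congr (_ * cos _).
rewrite -(@natr1 R n) lift0 -(@natr1 R i); ring.
Qed.

Definition bisum (R : realType) (f : int -> R) (J : nat) : R :=
  \sum_(j < J.*2.+1) f (j%:Z - J%:Z).

Lemma bisum0 (R : realType) (f : int -> R) : bisum f 0 = f 0.
Proof. by rewrite /bisum big_ord1. Qed.

Lemma bisumS (R : realType) (f : int -> R) J :
  bisum f J.+1 = bisum f J + (f J.+1%:Z + f (- J.+1%:Z)).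
Proof.
rewrite /bisum doubleS big_ord_recr big_ord_recl /= [X in X + _]addrC -addrA.
rewrite [f _ + f _]addrC; congr (_ + _); last by congr (f _ + f _); lia.
by apply: eq_bigr => i _; congr f; rewrite /bump; lia.
Qed.

Lemma eq_bisum (R : realType) (f g : int -> R) J :
  (forall k : int, (`|k| <= J)%N -> f k = g k) -> bisum f J = bisum g J.
Proof. by move=> fg; apply: eq_bigr => i _; apply: fg; have := ltn_ord i; lia. Qed.

Lemma bisum_multiples (R : realType) (f : int -> R) M N : (0 < M)%N ->
  bisum (fun l => if (M %| `|l|)%N then f l else 0) N =
  bisum (fun k => f (k * M%:Z)) (N %/ M).
Proof.
move=> M0; elim: N => [|N IHN].
  by rewrite div0n !bisum0 dvdn0 mul0r.
rewrite bisumS IHN abszN absz_nat; case: ifPn => MN; last first.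
  rewrite !addr0; congr bisum; have := MN.
  by rewrite divnS// => /negbTE ->.
have E : (N.+1 %/ M = (N %/ M).+1)%N by rewrite divnS// MN add1n.
have F : (N.+1 = (N %/ M).+1 * M)%N by rewrite -E divnK.
by rewrite E bisumS; congr (_ + (f _ + f _)); lia.
Qed.

Lemma cosD2pin (R : realType) (x : R) (z : int) :
  cos (x + 2 * pi * z%:~R) = cos x.
Proof.
have H n (y : R) : cos (y + 2 * pi * n%:R) = cos y.
  rewrite -[RHS](periodicn (@cosD2pi R) n); congr cos; rewrite -mulr_natr; ring.
case: z => n; first exact: H.
rewrite -[LHS](H n.+1); congr cos; rewrite NegzE mulrNz; ring.
Qed.

Lemma sinD2pin (R : realType) (x : R) (z : int) :
  sin (x + 2 * pi * z%:~R) = sin x.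
Proof.
by rewrite -[LHS]opprK -cosDpihalf addrAC cosD2pin cosDpihalf opprK.
Qed.

Lemma sin_pi_neq0 (R : realType) (l : int) M : (0 < M)%N -> ~~ (M %| `|l|)%N ->
  sin (pi * l%:~R / M%:R) != 0 :> R.
Proof.
move=> M0 Ml; have M0' : M%:R != 0 :> R by rewrite pnatr_eq0; lia.
pose u := absz l.
have r0 : (0 < u %% M)%N by rewrite lt0n.
have rM : (u %% M < M)%N by rewrite ltn_mod.
have sr : sin (pi * (u %% M)%N%:R / M%:R) != 0 :> R.
  rewrite gt_eqF// sin_gt0_pi// divr_gt0 ?mulr_gt0 ?pi_gt0 ?ltr0n//=.
  by rewrite ltr_pdivrMr ?ltr0n// ltr_pM2l ?pi_gt0// ltr_nat.
have sl : sin (pi * u%:R / M%:R) != 0 :> R.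
  rewrite {1}(divn_eq u M) natrD natrM.
  have -> : pi * ((u %/ M)%N%:R * M%:R + (u %% M)%N%:R) / M%:R =
      pi * (u %% M)%N%:R / M%:R + pi *+ (u %/ M)%N :> R.
    by rewrite -[in RHS]mulr_natr; field.
  rewrite (alternatingn (@sinDpi R)) mulf_neq0//.
  by rewrite expf_neq0// oppr_eq0 oner_eq0.
have [l0|l0] := ger0P l; first by have := sl; rewrite /u natr_absz ger0_norm.
have -> : pi * l%:~R / M%:R = - (pi * u%:R / M%:R) :> R.
  by rewrite /u natr_absz ltr0_norm// mulrNz; field.
by rewrite sinN oppr_eq0.
Qed.

Lemma sum_cos_shift (R : realType) (xi : R) (l : int) m :
  let M := m.*2.+1 in
  bisum (fun j => cos (2 * pi * l%:~R * (xi + j%:~R) / M%:R)) m =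
  if (M %| `|l|)%N then M%:R * cos (2 * pi * l%:~R * xi / M%:R) else 0.
Proof.
move=> M; have M0 : M%:R != 0 :> R by rewrite pnatr_eq0.
case: ifPn => [/dvdnP [q qE]|Ml].
  have [z ->] : exists z, l = z * M%:Z by exists (sgz l * q%:Z); lia.
  rewrite (@eq_bisum _ _ (fun=> cos (2 * pi * (z * M%:Z)%:~R * xi / M%:R))); last first.
    move=> k _; rewrite -[RHS](cosD2pin _ (z * k)); congr cos.
    by rewrite !intrM; field.
  by rewrite /bisum sumr_const card_ord -[LHS]mulr_natl.
have s0 := @sin_pi_neq0 R l M isT Ml.
(* Multiplied by [sin (pi l / M)], the sum telescopes, and the arguments at its two ends differ by
   the multiple [2 pi l] of the period. *)
apply: (mulfI s0); rewrite mulr0 /bisum mulr_sumr.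
pose g (i : nat) : R :=
  sin (2 * pi * l%:~R * (xi + i%:R - m%:R - 2^-1) / M%:R) / 2.
rewrite (eq_bigr (fun i : 'I_M => g i.+1 - g i)).
  rewrite -(big_mkord xpredT (fun i => g i.+1 - g i)) telescope_sumr// /g.
  suff -> : 2 * pi * l%:~R * (xi + M%:R - m%:R - 2^-1) / M%:R =
     2 * pi * l%:~R * (xi + 0%:R - m%:R - 2^-1) / M%:R + 2 * pi * l%:~R :> R.
    by rewrite sinD2pin subrr.
  by field.
move=> i _; rewrite /g -mulrBl.
set a := 2 * pi * l%:~R * (xi + (i%:Z - m%:Z)%:~R) / M%:R.
set b := pi * l%:~R / M%:R.
have -> : 2 * pi * l%:~R * (xi + i.+1%:R - m%:R - 2^-1) / M%:R = a + b.
  by rewrite /a /b intrB -natr1; field.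
have -> : 2 * pi * l%:~R * (xi + i%:R - m%:R - 2^-1) / M%:R = a - b.
  by rewrite /a /b intrB; field.
by rewrite sinD sinB; field.
Qed.

(** Poisson summation for a trigonometric polynomial: [(2 cos y)^(2 N)] has coefficient
    ['C(2 N, N + l)] at [cos (2 l y)], and summing over [M] equally spaced points keeps the [l]
    divisible by [M]. *)
Lemma poisson_binomial (R : realType) (xi : R) N m :
  let M := m.*2.+1 in
  bisum (fun j => (cos (pi * (xi + j%:~R) / M%:R) ^+ 2) ^+ N) m * 4 ^+ N =
  M%:R * bisum (fun k => 'C(N.*2, absz (N%:Z + k * M%:Z))%:R
    * cos (2 * pi * k%:~R * xi)) (N %/ M).
Proof.
move=> M; have M0 : M%:R != 0 :> R by rewrite pnatr_eq0.
have E (y : R) : (cos y ^+ 2) ^+ N * 4 ^+ N =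
    bisum (fun l => 'C(N.*2, absz (N%:Z + l))%:R * cos (2 * l%:~R * y)) N.
  have := cos_binomial N.*2 y 0; rewrite cos0 mulr1 -muln2 mulnC exprM => E.
  transitivity (((cos y *+ 2) ^+ 2) ^+ N); first by rewrite -exprMn; congr (_ ^+ _); ring.
  rewrite -E /bisum mul2n; apply: eq_bigr => i _; rewrite addr0.
  have -> : absz (N%:Z + (i%:Z - N%:Z)) = i by lia.
  by congr (_ * cos (_ * _)); case: i => i ? /=; rewrite -mul2n natrM intrB; ring.
rewrite /bisum mulr_suml; under eq_bigr => j _ do rewrite E /bisum.
rewrite exchange_big /=.
pose f (l : int) : R := M%:R * ('C(N.*2, absz (N%:Z + l))%:R
   * cos (2 * pi * l%:~R * xi / M%:R)).
transitivity (bisum (fun l => if (M %| `|l|)%N then f l else 0) N).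
  apply: eq_bigr => i _; rewrite -mulr_sumr.
  have := @sum_cos_shift R xi (i%:Z - N%:Z) m; rewrite -/M /bisum => S.
  rewrite (eq_bigr (fun j : 'I_M => cos (2 * pi * (i%:Z - N%:Z)%:~R *
      (xi + (j%:Z - m%:Z)%:~R) / M%:R))); last by move=> j _; congr cos; ring.
  by rewrite S; case: ifP => _; rewrite /f; ring.
rewrite bisum_multiples// /bisum mulr_sumr; apply: eq_bigr => i _.
by rewrite /f; congr (_ * (_ * cos _)); rewrite intrM; field.
Qed.

(** The exact difference of powers on the right makes the induction on [J] close. *)
Lemma bisum_tail (R : realType) (f : int -> R) (C q : R) K J :
  0 <= q < 1 -> (K <= J)%N ->
  (forall k : int, (K < absz k)%N -> (absz k <= J)%N -> `|f k| <= C * q ^+ absz k) ->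
  `|bisum f J - bisum f K| <= 2 * C * (q ^+ K.+1 - q ^+ J.+1) / (1 - q).
Proof.
move=> /andP[q0 q1]; elim: J => [|J IHJ].
  by rewrite leqn0 => /eqP -> _; rewrite !subrr normr0 mulr0 mul0r.
rewrite leq_eqVlt => /orP[/eqP <- _|KJ fC].
  by rewrite !subrr normr0 mulr0 mul0r.
have {}IHJ := IHJ KJ (fun k h1 h2 => fC k h1 (leqW h2)).
have q1' : 1 - q != 0 by rewrite subr_eq0 eq_sym lt_eqF.
rewrite bisumS addrAC.
apply: (le_trans (ler_normD _ _)).
have -> : 2 * C * (q ^+ K.+1 - q ^+ J.+2) / (1 - q) =
   2 * C * (q ^+ K.+1 - q ^+ J.+1) / (1 - q) + (C * q ^+ J.+1 + C * q ^+ J.+1).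
  by rewrite (exprS _ J.+1); field.
apply: lerD => //; apply: (le_trans (ler_normD _ _)).
by apply: lerD; [have := fC J.+1%:Z | have := fC (- J.+1%:Z)];
  rewrite ?abszN absz_nat; apply; lia.
Qed.

Lemma bisum_tail_le (R : realType) (f : int -> R) (C q : R) K J :
  0 <= C -> 0 <= q < 1 -> (K <= J)%N ->
  (forall k : int, (K < absz k)%N -> (absz k <= J)%N -> `|f k| <= C * q ^+ absz k) ->
  `|bisum f J - bisum f K| <= 2 * C / (1 - q) * q ^+ K.
Proof.
move=> C0 q01 KJ fC; apply: (le_trans (bisum_tail q01 KJ fC)).
have /andP[q0 q1] := q01.
rewrite mulrAC ler_wpM2l//; last first.
  by apply: (@le_trans _ _ (q ^+ K.+1)); [rewrite gerBl exprn_ge0|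
     rewrite exprS ler_piMl ?exprn_ge0// ltW].
by rewrite divr_ge0 ?mulr_ge0// subr_ge0 ltW.
Qed.

Lemma bisumE (R : realType) (f : int -> R) J :
  bisum f J = f 0 + series (fun k => f k.+1%:Z + f (- k.+1%:Z)) J.
Proof.
elim: J => [|J IH]; first by rewrite bisum0 /series /= big_nil addr0.
by rewrite bisumS IH -addrA /series /= [in RHS]big_nat_recr.
Qed.

Lemma is_cvg_bisum (R : realType) (f : int -> R) (C q : R) :
  0 <= q < 1 -> (forall k : int, `|f k| <= C * q ^+ absz k) ->
  cvg (bisum f J @[J --> \oo]).
Proof.
move=> /andP[q0 q1] fC.
under eq_fun do rewrite bisumE.
apply: is_cvgD; first exact: is_cvg_cst.
apply: normed_cvg.
apply: (@series_le_cvg _ _ (geometric (2 * C) q)).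
- by move=> n /=; exact: normr_ge0.
- move=> n; rewrite /geometric /= mulr_ge0 ?exprn_ge0//.
  by have := fC 0; rewrite absz0 expr0 mulr1 => /(le_trans (normr_ge0 _)); lra.
- move=> n /=; apply: (le_trans (ler_normD _ _)).
  have C0 : 0 <= C by have := fC 0; rewrite absz0 expr0 mulr1; apply: le_trans.
  have qn : C * q ^+ n.+1 <= C * q ^+ n.
    by rewrite ler_wpM2l// exprS ler_piMl ?exprn_ge0// ltW.
  have := fC n.+1; have := fC (- n.+1%:Z); rewrite abszN !absz_nat; lra.
- by apply: is_cvg_geometric_series; rewrite ger0_norm.
Qed.

Lemma cvgn_sum (R : realType) (I : Type) (r : seq I) (P : pred I)
    (f : nat -> I -> R) (g : I -> R) :
  (forall i, P i -> f n i @[n --> \oo] --> g i) ->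
  \sum_(i <- r | P i) f n i @[n --> \oo] --> \sum_(i <- r | P i) g i.
Proof.
move=> fg; elim: r => [|i r IH].
  by under eq_fun do rewrite big_nil; rewrite big_nil; exact: cvg_cst.
under eq_fun do rewrite big_cons; rewrite big_cons.
by case: ifPn => // Pi; apply: cvgD => //; exact: fg.
Qed.

Lemma cvgn_prod (R : realType) (I : Type) (r : seq I) (P : pred I)
    (f : nat -> I -> R) (g : I -> R) :
  (forall i, P i -> f n i @[n --> \oo] --> g i) ->
  \prod_(i <- r | P i) f n i @[n --> \oo] --> \prod_(i <- r | P i) g i.
Proof.
move=> fg; elim: r => [|i r IH].
  by under eq_fun do rewrite big_nil; rewrite big_nil; exact: cvg_cst.
under eq_fun do rewrite big_cons; rewrite big_cons.
by case: ifPn => // Pi; apply: cvgM => //; exact: fg.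
Qed.

Lemma cvg_bisum (R : realType) (f : nat -> int -> R) (g : int -> R) K :
  (forall k, f n k @[n --> \oo] --> g k) ->
  bisum (f n) K @[n --> \oo] --> bisum g K.
Proof.
move=> fg; by apply: cvgn_sum => i _; exact: fg.
Qed.

(** Tannery's theorem, dominated convergence for sums whose range [J n] grows with [n]. The
    domination is asked inside the range only, and [g] inherits it in the limit; the error splits
    into two geometric tails and a finite part. *)
Lemma bisum_tannery (R : realType) (f : nat -> int -> R) (g : int -> R)
    (J : nat -> nat) (C q : R) :
  0 <= q < 1 ->
  (forall k, f n k @[n --> \oo] --> g k) ->
  (forall K, \forall n \near \oo, (K <= J n)%N) ->
  (\forall n \near \oo, forall k : int, (absz k <= J n)%N ->
     `|f n k| <= C * q ^+ absz k) ->
  exists S : R, bisum g K @[K --> \oo] --> S /\ bisum (f n) (J n) @[n --> \oo] --> S.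
Proof.
move=> q01 fg Jy fC; have /andP[q0 q1] := q01.
have gC (k : int) : `|g k| <= C * q ^+ absz k.
  have h : (`|f n k| : R) @[n --> \oo] --> (`|g k| : R) by apply: cvg_norm.
  apply: (cvgr_to_le h).
  near=> n; have : (absz k <= J n)%N by near: n; exact: Jy.
  have H : forall k : int, (absz k <= J n)%N -> `|f n k| <= C * q ^+ absz k.
    by near: n; exact: fC.
  exact: H.
have C0 : 0 <= C by have := gC 0; rewrite absz0 expr0 mulr1; apply: le_trans.
have cg := is_cvg_bisum q01 gC.
exists (lim (bisum g K @[K --> \oo])); split => //.
set S := lim _.
have tl K : `|S - bisum g K| <= 2 * C / (1 - q) * q ^+ K.
  have h : (`|bisum g J - bisum g K| : R) @[J --> \oo] --> (`|S - bisum g K| : R).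
    by apply: cvg_norm; apply: cvgB => //; exact: cvg_cst.
  apply: (cvgr_to_le h); near=> n.
  apply: bisum_tail_le => //; near: n; exact: nbhs_infty_ge.
have tl0 : (2 * C / (1 - q) * q ^+ K : R) @[K --> \oo] --> (0 : R).
  rewrite -[X in _ --> X](mulr0 (2 * C / (1 - q))); apply: cvgM; first exact: cvg_cst.
  by apply: cvg_expr; rewrite ger0_norm.
apply/cvgrPdist_le => e e0.
have e3 : 0 < e / 3 by rewrite divr_gt0.
move/cvgr0Pnorm_le : tl0 => /(_ _ e3) [K _ hK].
have {}hK : 2 * C / (1 - q) * q ^+ K <= e / 3.
  by apply: le_trans (hK K (leqnn K)); rewrite ler_norm.
have h2 := @cvg_bisum _ _ _ K fg.
near=> n.
have -> : S - bisum (f n) (J n) = (S - bisum g K) + (bisum g K - bisum (f n) K)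
    + (bisum (f n) K - bisum (f n) (J n)) by ring.
rewrite (_ : e = e / 3 + e / 3 + e / 3); last by field.
apply: (le_trans (ler_normD _ _)); apply: lerD.
  apply: (le_trans (ler_normD _ _)); apply: lerD; first exact: le_trans (tl K) hK.
  by near: n; move/cvgrPdist_le : h2; apply.
rewrite distrC; apply: le_trans hK; apply: bisum_tail_le => //.
  by near: n; exact: Jy.
move=> k _; have H : forall k : int, (absz k <= J n)%N -> `|f n k| <= C * q ^+ absz k.
  by near: n; exact: fC.
exact: H.
Unshelve. all: by end_near.
Qed.

(** * Taylor inequalities, obtained by integrating inequalities between derivatives *)

Lemma ge0_derive_ndecr (R : realType) (f f' : R -> R) :
  (forall x : R, is_derive x 1 f (f' x)) -> (forall x : R, 0 <= x -> 0 <= f' x) ->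
  forall x, 0 <= x -> f 0 <= f x.
Proof.
move=> fd f'0 x x0.
apply: (@ger0_derive1_ndecr R f 0 x) => //.
- by move=> y; rewrite in_itv/= => /andP[y0 _]; rewrite derive1E; have [_ ->] := fd y; exact/f'0/ltW.
- apply: continuous_subspaceT => y.
  apply: differentiable_continuous; apply/derivable1_diffP.
  by have [] := fd y.
Qed.

Lemma sin_le (R : realType) (x : R) : 0 <= x -> sin x <= x.
Proof.
move=> x0; rewrite -subr_ge0.
have d (y : R) : is_derive y 1 (fun x : R => x - sin x) (1 - cos y).
  by apply: trigger_derive.
have := ge0_derive_ndecr d _ x0; rewrite sin0 subrr; apply.
by move=> y _; rewrite subr_ge0 cos_le1.
Qed.

Lemma cos_ge (R : realType) (x : R) : 0 <= x -> 1 - x ^+ 2 / 2 <= cos x.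
Proof.
move=> x0; rewrite -subr_ge0.
have d (y : R) : is_derive y 1 (fun x : R => cos x - (1 - x ^+ 2 / 2)) (y - sin y).
  by apply: trigger_derive; rewrite /GRing.scale /=; field.
have := ge0_derive_ndecr d _ x0.
rewrite cos0 expr0n mul0r subr0 subrr; apply.
by move=> y y0; rewrite subr_ge0 sin_le.
Qed.

Lemma sin_ge (R : realType) (x : R) : 0 <= x -> x - x ^+ 3 / 6 <= sin x.
Proof.
move=> x0; rewrite -subr_ge0.
have d (y : R) : is_derive y 1 (fun x : R => sin x - (x - x ^+ 3 / 6))
    (cos y - (1 - y ^+ 2 / 2)).
  by apply: trigger_derive; rewrite /GRing.scale /=; field.
have := ge0_derive_ndecr d _ x0.
rewrite sin0 expr0n mul0r !subr0; apply.
by move=> y y0; rewrite subr_ge0 cos_ge.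
Qed.

(** Both sides are [1 + x <= expR x], at [x = - s] and at [x = s / (1 - s)], the latter because
    [1 / (1 - s) = 1 + s / (1 - s)]. *)
Lemma onemX_bounds (R : realType) (s : R) N : 0 <= s < 1 ->
  expR (- (N%:R * s / (1 - s))) <= (1 - s) ^+ N <= expR (- (N%:R * s)).
Proof.
move=> /andP[s0 s1]; have s1' : 0 < 1 - s by rewrite subr_gt0.
rewrite (_ : - _ = N%:R * - (s / (1 - s))); last by ring.
rewrite (_ : - (N%:R * s) = N%:R * - s); last by ring.
rewrite !expRM_natl.
apply/andP; split; last first.
  by apply: lerXn2r; rewrite ?nnegrE ?expR_ge0 ?(ltW s1')// expR_ge1Dx.
apply: lerXn2r; rewrite ?nnegrE ?expR_ge0 ?(ltW s1')//.
rewrite expRN invf_ple ?posrE ?expR_gt0//.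
apply: le_trans (expR_ge1Dx _); rewrite le_eqVlt; apply/orP; left; apply/eqP.
by field; rewrite gt_eqF.
Qed.

Lemma cvgn_natV (R : realType) : (m.*2.+1%:R^-1 : R) @[m --> \oo] --> (0 : R).
Proof.
apply: (@squeeze_cvgr _ _ _ _ (fun=> 0) (@harmonic R)).
- near=> n; rewrite invr_ge0 ler0n /= /harmonic /= lef_pV2 ?posrE ?ltr0n//.
  by rewrite ler_nat -addnn; lia.
- exact: cvg_cst.
- exact: cvg_harmonic.
Unshelve. all: by end_near.
Qed.

(** * Asymptotics of binomial coefficients near the centre *)

Lemma central_binS n :
  (n.+1 * 'C(n.+1.*2, n.+1) = 2 * (n.*2.+1) * 'C(n.*2, n))%N.
Proof.
have := mul_bin_diag n.+1.*2 n; rewrite doubleS /= => <-.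
have := mul_bin_down n.*2.+1 n; rewrite /=.
have -> : (n.*2.+1 - n = n.+1)%N by rewrite -addnn; lia.
move=> E; have -> : (n.*2.+2 = 2 * n.+1)%N by rewrite -addnn; lia.
by rewrite -mulnA -E mulnA.
Qed.

(** By Wallis' product the limit is [sqrt pi]; below, monotonicity provides a limit [b], which goes
    into the constant [kappa]. *)
Definition wallis (R : realType) (N : nat) : R :=
  4 ^+ N / (Num.sqrt N%:R * 'C(N.*2, N)%:R).

Lemma wallis_ge0 (R : realType) N : 0 <= wallis R N.
Proof. by rewrite divr_ge0 ?exprn_ge0// mulr_ge0 ?sqrtr_ge0. Qed.

Lemma central_bin_gt0 (R : realType) N : 0 < 'C(N.*2, N)%:R :> R.
Proof. by rewrite ltr0n bin_gt0 -addnn leq_addr. Qed.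

Lemma wallisS (R : realType) N : (0 < N)%N -> wallis R N.+1 <= wallis R N.
Proof.
move=> N0; rewrite /wallis.
have B0 := central_bin_gt0 R N; have B1 := central_bin_gt0 R N.+1.
have s0 : 0 < Num.sqrt N%:R :> R by rewrite sqrtr_gt0 ltr0n.
have s1 : 0 < Num.sqrt N.+1%:R :> R by rewrite sqrtr_gt0 ltr0n.
have E := congr1 (fun n => n%:R : R) (central_binS N); rewrite !natrM in E.
rewrite ler_pdivrMr ?mulr_gt0// mulrAC ler_pdivlMr ?mulr_gt0//.
rewrite exprSr -!mulrA ler_wpM2l ?exprn_ge0//.
rewrite -(ler_pM2l (ltr0Sn R N)).
have -> : N.+1%:R * (Num.sqrt N.+1%:R * 'C(N.+1.*2, N.+1)%:R) =
  Num.sqrt N.+1%:R * (2 * N.*2.+1%:R) * 'C(N.*2, N)%:R :> R.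
  by rewrite mulrCA E; ring.
rewrite !mulrA ler_pM2r//.
suff H : 2 * (Num.sqrt N.+1%:R * Num.sqrt N%:R) <= N.*2.+1%:R :> R.
  have := ler_wpM2l (ltW s1) H.
  have : N.+1%:R = Num.sqrt N.+1%:R * Num.sqrt N.+1%:R :> R.
    by rewrite -expr2 sqr_sqrtr.
  nra.
rewrite -(ler_sqr (x := _ * _)) ?nnegrE ?mulr_ge0 ?sqrtr_ge0//.
rewrite !exprMn !sqr_sqrtr//.
rewrite -natr1 -[N.*2.+1%:R]natr1 -mul2n natrM.
nra.
Qed.

Lemma wallis_cvg (R : realType) :
  exists2 b : R, 0 <= b & wallis R N @[N --> \oo] --> b.
Proof.
(* The shift matters: [wallis R 0] is 0, being a division by zero, so the sequence decreases only
   from rank 1 on. *)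
have c : cvgn (fun n => wallis R n.+1).
  apply: nonincreasing_is_cvgn.
    by apply/nonincreasing_seqP => n; exact: wallisS.
  by exists 0 => _ [n _ <-]; exact: wallis_ge0.
exists (limn (fun n => wallis R n.+1)); last by rewrite -(cvg_shiftS (wallis R)).
by apply: limr_ge => //; apply: nearW => n; exact: wallis_ge0.
Qed.

Definition binratio (R : realType) (N l : nat) : R :=
  'C(N.*2, N + l)%:R / 'C(N.*2, N)%:R.

Lemma binratio0 (R : realType) N : binratio R N 0 = 1.
Proof. by rewrite /binratio addn0 divff// gt_eqF ?central_bin_gt0. Qed.

Lemma binratioS (R : realType) N l : (l <= N)%N ->
  binratio R N l.+1 = binratio R N l * ((N%:R - l%:R) / (N + l).+1%:R).
Proof.
move=> lN; rewrite /binratio.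
have E : ((N + l).+1 * 'C(N.*2, (N + l).+1) = (N - l) * 'C(N.*2, N + l))%N.
  by rewrite mul_bin_left; congr (_ * _)%N; rewrite -addnn; lia.
have {E} := congr1 (fun n => n%:R : R) E; rewrite !natrM natrB// addnS => E.
have n0 : (N + l).+1%:R != 0 :> R by rewrite pnatr_eq0.
have := central_bin_gt0 R N => /gt_eqF/negbT C0.
move: n0 E C0; move: ((N + l).+1%:R) ('C(N.*2, N)%:R) => p C n0 E C0.
by apply: (mulfI n0); rewrite mulrA E; field; rewrite C0 n0.
Qed.

Lemma binratio_ge0 (R : realType) N l : 0 <= binratio R N l.
Proof. by rewrite divr_ge0. Qed.

(** A local de Moivre-Laplace estimate: passing from [l] to [l + 1] multiplies by
    [1 - (2 l + 1) / (N + l + 1)], at most [expR (- (2 l + 1) / (N + L))], and the odd numbers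
    [2 l + 1] add up to a square. The lower bound [binratio_ge] treats the inverse factor
    [1 + (2 l + 1) / (N - l)] in the same way. *)
Lemma binratio_le (R : realType) N l L : (0 < N)%N -> (l <= L)%N -> (L <= N)%N ->
  binratio R N l <= expR (- (l%:R ^+ 2 / (N%:R + L%:R))).
Proof.
move=> N0 + LN; elim: l => [|l IH] lL.
  by rewrite binratio0 expr0n mul0r oppr0 expR0.
rewrite binratioS; last by lia.
have NL : 0 < N%:R + L%:R :> R by rewrite -natrD ltr0n; lia.
have -> : - (l.+1%:R ^+ 2 / (N%:R + L%:R)) =
   - (l%:R ^+ 2 / (N%:R + L%:R)) + - ((2 * l%:R + 1) / (N%:R + L%:R)) :> R.
  by rewrite -natr1; field; rewrite gt_eqF.
have lN : l%:R <= N%:R :> R by rewrite ler_nat; lia.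
rewrite expRD; apply: ler_pM; rewrite ?binratio_ge0 ?divr_ge0 ?subr_ge0//.
  by apply: IH; lia.
have n0 : 0 < (N + l).+1%:R :> R by rewrite ltr0n.
have -> : (N%:R - l%:R) / (N + l).+1%:R = 1 + - ((2 * l%:R + 1) / (N + l).+1%:R) :> R.
  have : (N + l).+1%:R = N%:R + l%:R + 1 :> R by rewrite -natr1 natrD.
  move: ((N + l).+1%:R) n0 => p p0 pE.
  have -> : N%:R - l%:R = p - (2 * l%:R + 1) by rewrite pE; ring.
  by field; rewrite gt_eqF.
apply: (le_trans (expR_ge1Dx _)); rewrite ler_expR lerN2.
rewrite ler_wpM2l ?addr_ge0 ?mulr_ge0// lef_pV2 ?posrE//.
by rewrite -natrD ler_nat; lia.
Qed.

Lemma binratio_ge (R : realType) N l L : (l <= L)%N -> (L <= N)%N ->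
  expR (- (l%:R ^+ 2 / (N%:R + 1 - L%:R))) <= binratio R N l.
Proof.
move=> + LN; elim: l => [|l IH] lL.
  by rewrite binratio0 expr0n mul0r oppr0 expR0.
rewrite binratioS; last by lia.
have NL : 0 < N%:R + 1 - L%:R :> R by rewrite natr1 subr_gt0 ltr_nat.
have -> : - (l.+1%:R ^+ 2 / (N%:R + 1 - L%:R)) =
   - (l%:R ^+ 2 / (N%:R + 1 - L%:R)) + - ((2 * l%:R + 1) / (N%:R + 1 - L%:R)) :> R.
  by rewrite -natr1; field; rewrite gt_eqF.
have lN : 0 < N%:R - l%:R :> R by rewrite subr_gt0 ltr_nat; lia.
rewrite expRD; apply: ler_pM; rewrite ?expR_ge0//; first by apply: IH; lia.
rewrite expRN invf_ple ?posrE ?expR_gt0 ?divr_gt0//.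
apply: le_trans (expR_ge1Dx _).
have -> : ((N%:R - l%:R) / (N + l).+1%:R)^-1 = 1 + (2 * l%:R + 1) / (N%:R - l%:R) :> R.
  have : (N + l).+1%:R = N%:R + l%:R + 1 :> R by rewrite -natr1 natrD.
  have : 0 < (N + l).+1%:R :> R by rewrite ltr0n.
  move: ((N + l).+1%:R) => p p0 pE; rewrite invf_div.
  have -> : p = (N%:R - l%:R) + (2 * l%:R + 1) by rewrite pE; ring.
  by field; rewrite gt_eqF.
rewrite lerD2l ler_wpM2l ?addr_ge0 ?mulr_ge0// lef_pV2 ?posrE//.
have : l%:R + 1 <= L%:R :> R by rewrite natr1 ler_nat.
lra.
Qed.

(** With [M = 2 m + 1] and [N] close to [M^2 / (pi a)], both Gaussians of the inversion formula
    appear at once: [cos (pi y / M) ^ (2 N)] tends to [exp (- pi y^2 / a)], and the ratio of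
    ['C(2 N, N + k M)] to ['C(2 N, N)] tends to [exp (- pi a k^2)]. *)
Definition trials (R : realType) (a : R) (m : nat) : nat :=
  Num.truncn ((m.*2.+1)%:R ^+ 2 / (pi * a)).

Lemma cvgn_oddy (R : realType) (A : R) : \forall m \near \oo, A <= (m.*2.+1)%:R.
Proof.
near=> m; apply: (@le_trans _ _ m%:R); last by rewrite ler_nat -addnn; lia.
by near: m; exact: nbhs_infty_ger.
Unshelve. all: by end_near.
Qed.

Lemma trials_itv (R : realType) (a : R) m : 0 < a ->
  (trials a m)%:R <= (m.*2.+1)%:R ^+ 2 / (pi * a) < (trials a m)%:R + 1.
Proof.
move=> a0; have pia : 0 < pi * a by rewrite mulr_gt0 ?pi_gt0.
by rewrite natr1; apply: truncn_itv; rewrite divr_ge0 ?sqr_ge0 ?ltW.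
Qed.

Lemma cvg_trials (R : realType) (a : R)  : 0 < a ->
  (trials a m)%:R / (m.*2.+1)%:R ^+ 2 @[m --> \oo] --> (pi * a)^-1.
Proof.
move=> a0; have pia : 0 < pi * a by rewrite mulr_gt0 ?pi_gt0.
have M0 m : 0 < (m.*2.+1)%:R :> R by rewrite ltr0n.
have V2 : ((m.*2.+1)%:R^-1 ^+ 2 : R) @[m --> \oo] --> (0 : R).
  rewrite (_ : (fun _ => _) = (fun m => (m.*2.+1)%:R^-1 * (m.*2.+1)%:R^-1));
    last by apply/funext => m; rewrite expr2.
  have := cvgM (@cvgn_natV R) (@cvgn_natV R); rewrite mulr0; apply.
apply: (@squeeze_cvgr _ _ _ _ (fun m => (pi * a)^-1 - (m.*2.+1)%:R^-1 ^+ 2)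
  (fun=> (pi * a)^-1)).
- near=> m; have /andP[h1 h2] := trials_itv m a0.
  have M2 : 0 < (m.*2.+1)%:R ^+ 2 :> R by rewrite exprn_gt0.
  rewrite ler_pdivrMr// [_^-1 * _]mulrC h1 andbT.
  rewrite ler_pdivlMr// mulrBl exprVn mulVf ?gt_eqF// [_^-1 * _]mulrC; lra.
- by rewrite -[X in _ --> X]subr0; apply: cvgB => //; exact: cvg_cst.
- exact: cvg_cst.
Unshelve. all: by end_near.
Qed.

Lemma trials_divy (R : realType) (a : R) K : 0 < a ->
  \forall m \near \oo, (K <= trials a m %/ m.*2.+1)%N.
Proof.
move=> a0; have pia : 0 < pi * a by rewrite mulr_gt0 ?pi_gt0.
have M0 m : 0 < (m.*2.+1)%:R :> R by rewrite ltr0n.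
near=> m; rewrite leq_divRL//; have /andP[_ h2] := trials_itv m a0.
suff : (K * m.*2.+1)%:R < (trials a m)%:R + 1 :> R by rewrite natr1 ltr_nat; lia.
apply: le_lt_trans h2; rewrite ler_pdivlMr// natrM expr2 mulrAC ler_pM2r//.
by near: m; exact: cvgn_oddy.
Unshelve. all: by end_near.
Qed.

Lemma trialsy (R : realType) (a : R) K : 0 < a ->
  \forall m \near \oo, (K <= trials a m)%N.
Proof.
move=> a0; have pia : 0 < pi * a by rewrite mulr_gt0 ?pi_gt0.
have M0 m : 0 < (m.*2.+1)%:R :> R by rewrite ltr0n.
near=> m; apply: (@leq_trans (trials a m %/ m.*2.+1)); last exact: leq_div.
by near: m; exact: trials_divy.
Unshelve. all: by end_near.
Qed.

Lemma cvg_binratio_trials (R : realType) (a : R) k : 0 < a ->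
   binratio R (trials a m) (k * m.*2.+1) @[m --> \oo] --> expR (- (pi * a * k%:R ^+ 2)).
Proof.
move=> a0; have pia : 0 < pi * a by rewrite mulr_gt0 ?pi_gt0.
have M0 m : 0 < (m.*2.+1)%:R :> R by rewrite ltr0n.
have c1 : (k%:R / (m.*2.+1)%:R : R) @[m --> \oo] --> (0 : R).
  by have := cvgM (cvg_cst (k%:R : R)) (@cvgn_natV R); rewrite mulr0; apply.
have c2 : ((m.*2.+1)%:R^-1 ^+ 2 : R) @[m --> \oo] --> (0 : R).
  rewrite (_ : (fun _ => _) = (fun m => (m.*2.+1)%:R^-1 * (m.*2.+1)%:R^-1));
    last by apply/funext => m; rewrite expr2.
  by have := cvgM (@cvgn_natV R) (@cvgn_natV R); rewrite mulr0; apply.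
have V : (pi * a)^-1 != 0 by rewrite gt_eqF// invr_gt0.
have lo : expR (- (k%:R ^+ 2 / ((trials a m)%:R / (m.*2.+1)%:R ^+ 2 + (m.*2.+1)%:R^-1 ^+ 2
    - k%:R / (m.*2.+1)%:R))) @[m --> \oo] --> expR (- (pi * a * k%:R ^+ 2)).
  apply: continuous_cvg; first exact: continuous_expR.
  apply: cvgN; rewrite [X in _ --> X](_ : _ = k%:R ^+ 2 / ((pi * a)^-1 + 0 - 0)).
    apply: cvgM; first exact: cvg_cst.
    apply: cvgV; first by rewrite addr0 subr0.
    by apply: cvgB => //; apply: cvgD => //; exact: cvg_trials.
  by rewrite addr0 subr0 invrK mulrC.
have hi : expR (- (k%:R ^+ 2 / ((trials a m)%:R / (m.*2.+1)%:R ^+ 2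
    + k%:R / (m.*2.+1)%:R))) @[m --> \oo] --> expR (- (pi * a * k%:R ^+ 2)).
  apply: continuous_cvg; first exact: continuous_expR.
  apply: cvgN; rewrite [X in _ --> X](_ : _ = k%:R ^+ 2 / ((pi * a)^-1 + 0)).
    apply: cvgM; first exact: cvg_cst.
    apply: cvgV; first by rewrite addr0.
    by apply: cvgD => //; exact: cvg_trials.
  by rewrite addr0 invrK mulrC.
apply: (squeeze_cvgr _ lo hi); near=> m.
have kN : (k * m.*2.+1 <= trials a m)%N.
  by rewrite -leq_divRL//; near: m; exact: trials_divy.
have N0 : (0 < trials a m)%N by near: m; exact: trialsy.
have M1 := M0 m; have /andP[hN1 hN2] := trials_itv m a0.
have NM : 0 < (trials a m)%:R + 1 - (k * m.*2.+1)%:R :> R.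
  by rewrite natr1 subr_gt0 ltr_nat.
have Np : 0 < (trials a m)%:R + (k * m.*2.+1)%:R :> R.
  by rewrite -natrD ltr0n addn_gt0 N0.
have e1 (n c u : R) : 0 < u -> 0 < n + 1 - c * u ->
    c ^+ 2 / (n / u ^+ 2 + u^-1 ^+ 2 - c / u) = (c * u) ^+ 2 / (n + 1 - c * u).
  move=> u0 h; have -> : n / u ^+ 2 + u^-1 ^+ 2 - c / u = (n + 1 - c * u) / u ^+ 2.
    by field; rewrite gt_eqF.
  by field; rewrite !gt_eqF.
have e2 (n c u : R) : 0 < u -> 0 < n + c * u ->
    c ^+ 2 / (n / u ^+ 2 + c / u) = (c * u) ^+ 2 / (n + c * u).
  move=> u0 h; have -> : n / u ^+ 2 + c / u = (n + c * u) / u ^+ 2.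
    by field; rewrite gt_eqF.
  by field; rewrite !gt_eqF.
rewrite natrM in NM Np.
rewrite e1// e2// -natrM; apply/andP; split; first exact: binratio_ge.
exact: binratio_le.
Unshelve. all: by end_near.
Qed.

(** As [k M <= N], the denominator [N + k M] in [binratio_le] is at most [2 N], and
    [N <= M^2 / (pi a)] gives [k^2 M^2 / (2 N) >= k pi a / 2]. *)
Lemma binratio_trials_le (R : realType) (a : R) k m : 0 < a -> (0 < trials a m)%N ->
  (k * m.*2.+1 <= trials a m)%N ->
  binratio R (trials a m) (k * m.*2.+1) <= expR (- (pi * a / 2)) ^+ k.
Proof.
move=> a0 N0 kN; have pia : 0 < pi * a by rewrite mulr_gt0 ?pi_gt0.
have /andP[h _] := trials_itv m a0.
apply: (le_trans (binratio_le R N0 kN (leqnn _))).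
case: k kN => [|k] kN; first by rewrite mul0n expr0n mul0r oppr0 expR0 expr0.
apply: (@le_trans _ _ (expR (- ((k.+1 * m.*2.+1)%:R ^+ 2 / (2 * (trials a m)%:R))))).
  rewrite ler_expR lerN2 ler_wpM2l ?sqr_ge0// lef_pV2 ?posrE ?mulr_gt0 ?ltr0n//.
    by rewrite -natrD -natrM ler_nat; lia.
  by rewrite -natrD ltr0n; lia.
rewrite -expRM_natl ler_expR mulrN lerN2 natrM exprMn.
have n0 : 0 < (trials a m)%:R :> R by rewrite ltr0n.
rewrite ler_pdivlMr ?mulr_gt0//.
rewrite ler_pdivlMr// in h.
have k1 : 1 <= k.+1%:R :> R by rewrite ler1n.
have M0 : 0 <= (m.*2.+1)%:R ^+ 2 :> R by rewrite sqr_ge0.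
move: h n0 k1 M0; move: (_%:R) (_ ^+ 2) (k.+1%:R) => n w c h n0 k1 M0.
apply: (@le_trans _ _ (c * w)); last by rewrite ler_wpM2r// expr2 ler_peMl; lra.
rewrite [X in X <= _](_ : _ = c * (n * (pi * a))); last by field.
by rewrite ler_wpM2l; lra.
Qed.

Lemma cvg_sin_scaled (R : realType) (y : R) :
  (m.*2.+1)%:R * sin (y / (m.*2.+1)%:R) @[m --> \oo] --> y.
Proof.
have sb (x : R) : `|sin x - x| <= `|x| ^+ 3.
  wlog x0 : x / 0 <= x.
    move=> H; have [/H//|x0] := lerP 0 x.
    by have := H (- x); rewrite oppr_ge0 (ltW x0) sinN opprK normrN addrC distrC; apply.
  rewrite (ger0_norm x0) ler_norml.
  have := sin_ge x0; have := sin_le x0; have := exprn_ge0 3 x0; lra.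
have c2 : `|y| ^+ 3 * (m.*2.+1)%:R^-1 @[m --> \oo] --> (0 : R).
  by have := cvgM (cvg_cst (`|y| ^+ 3 : R)) (@cvgn_natV R); rewrite mulr0; apply.
apply/cvgrPdist_le => e e0.
move/cvgr0Pnorm_le : c2 => /(_ _ e0) c2.
near=> m.
have M0 : 0 < (m.*2.+1)%:R :> R by rewrite ltr0n.
have M1 : 1 <= (m.*2.+1)%:R :> R by rewrite ler1n.
have -> : y - (m.*2.+1)%:R * sin (y / (m.*2.+1)%:R) =
   - ((m.*2.+1)%:R * (sin (y / (m.*2.+1)%:R) - y / (m.*2.+1)%:R)) by field; rewrite gt_eqF.
rewrite normrN normrM gtr0_norm//.
apply: (@le_trans _ _ (`| `|y| ^+ 3 * (m.*2.+1)%:R^-1|)); last by near: m; exact: c2.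
rewrite [X in _ <= X]ger0_norm ?mulr_ge0 ?exprn_ge0 ?invr_ge0 ?(ltW M0)//.
apply: (le_trans (ler_wpM2l (ltW M0) (sb _))).
rewrite normrM normfV (gtr0_norm M0) exprMn mulrCA ler_wpM2l ?exprn_ge0//.
rewrite [X in X <= _](_ : _ = (m.*2.+1)%:R^-1 ^+ 2); last by field; rewrite gt_eqF.
by rewrite expr2 ler_piMl ?invr_ge0 ?(ltW M0)// invf_le1.
Unshelve. all: by end_near.
Qed.

Lemma cvg_cosX_trials (R : realType) (a y : R) : 0 < a ->
  (cos (pi * y / (m.*2.+1)%:R) ^+ 2) ^+ trials a m @[m --> \oo] -->
    expR (- (pi * y ^+ 2 / a)).
Proof.
move=> a0; have pia : 0 < pi * a by rewrite mulr_gt0 ?pi_gt0.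
have p0 := pi_gt0 R.
pose s m : R := sin (pi * y / (m.*2.+1)%:R) ^+ 2.
have cM : (m.*2.+1)%:R * sin (pi * y / (m.*2.+1)%:R) @[m --> \oo] --> pi * y.
  exact: cvg_sin_scaled.
have cs : s m @[m --> \oo] --> (0 : R).
  have := cvgM (cvgM cM cM) (cvgM (@cvgn_natV R) (@cvgn_natV R)).
  rewrite !mulr0 => H; apply: cvg_trans (H _ _ _); apply: near_eq_cvg.
  apply: nearW => m /=; rewrite /s; field.
  by rewrite gt_eqF// ltr0n.
have cNs : (trials a m)%:R * s m @[m --> \oo] --> pi * y ^+ 2 / a.
  have := cvgM (cvg_trials a0) (cvgM cM cM).
  rewrite (_ : (pi * a)^-1 * _ = pi * y ^+ 2 / a); last first.
    have e (q : R) : 0 < q -> (q * a)^-1 * (q * y * (q * y)) = q * y ^+ 2 / a.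
      by move=> q0; field; rewrite !gt_eqF.
    exact: e.
  move=> H; apply: cvg_trans (H _ _); apply: near_eq_cvg.
  apply: nearW => m /=; rewrite /s; field.
  by rewrite gt_eqF// ltr0n.
have lo : expR (- ((trials a m)%:R * s m / (1 - s m))) @[m --> \oo] -->
    expR (- (pi * y ^+ 2 / a)).
  apply: continuous_cvg; first exact: continuous_expR.
  apply: cvgN; rewrite [X in _ --> X](_ : _ = pi * y ^+ 2 / a / (1 - 0));
    last by rewrite subr0 divr1.
  apply: cvgM => //; apply: cvgV; first by rewrite subr0 oner_neq0.
  by apply: cvgB => //; exact: cvg_cst.
have hi : expR (- ((trials a m)%:R * s m)) @[m --> \oo] -->
    expR (- (pi * y ^+ 2 / a)).
  by apply: continuous_cvg; [exact: continuous_expR|exact: cvgN].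
apply: (squeeze_cvgr _ lo hi); near=> m.
rewrite cos2sin2 -/(s m); apply: onemX_bounds; rewrite sqr_ge0 /=.
near: m; have := cvgr_lt 0 cs; exact.
Unshelve. all: by end_near.
Qed.

Lemma cosX_trials_le (R : realType) (a y : R) m : 0 < a -> (9 < m)%N ->
  `|y| <= m%:R + 1 ->
  (cos (pi * y / (m.*2.+1)%:R) ^+ 2) ^+ trials a m <=
  expR (- ((trials a m)%:R / (m.*2.+1)%:R ^+ 2 * (pi * y) ^+ 2 / 16)).
Proof.
move=> a0 m9; wlog y0 : y / 0 <= y.
  move=> H yM; have [/H|y0] := lerP 0 y; first exact.
  have := H (- y); rewrite oppr_ge0 (ltW y0) normrN mulrN mulNr cosN sqrrN.
  exact.
rewrite ger0_norm// => yM.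
have M0 : 0 < (m.*2.+1)%:R :> R by rewrite ltr0n.
pose x := pi * y / (m.*2.+1)%:R.
have p0 := pi_gt0 R; have p4 : pi < 4 :> R by have := pihalf_lt2 R; lra.
have x0 : 0 <= x by rewrite divr_ge0 ?mulr_ge0// ltW.
(* From [pi < 4] and [m >= 10], since [4 (m + 1) / (2 m + 1) <= 44 / 21]. On this range, which goes
   beyond [pi / 2], still [1 - x^2 / 6 >= 1 / 4], whence [sin x >= x / 4]. *)
have x2 : x <= 21 / 10.
  rewrite /x ler_pdivrMr// -[X in _ <= _ * X]natr1 -addnn natrD.
  have : 10 <= m%:R :> R by rewrite (ler_nat R 10).
  move: yM y0; move: m%:R => u yM y0 u10.
  by apply: (@le_trans _ _ (4 * y)); [rewrite ler_wpM2r//|]; lra.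
have sx : x / 4 <= sin x.
  apply: le_trans (sin_ge x0); rewrite exprS.
  have : x ^+ 2 <= 441 / 100.
    rewrite (_ : 441 / 100 = (21 / 10) ^+ 2); last by field.
    by apply: lerXn2r; rewrite ?nnegrE//; lra.
  move: (x ^+ 2) => z hz; have := ler_wpM2l x0 hz; lra.
rewrite cos2sin2 -/x.
have /andP[s0 s1] : 0 <= sin x ^+ 2 <= 1 by rewrite sqr_ge0 sin2cos2 gerBl sqr_ge0.
apply: (@le_trans _ _ (expR (- (sin x ^+ 2)) ^+ trials a m)).
  apply: lerXn2r; [by rewrite nnegrE subr_ge0|by rewrite nnegrE expR_ge0|].
  exact: expR_ge1Dx.
rewrite -expRM_natl ler_expR mulrN lerN2.
have -> : (trials a m)%:R / (m.*2.+1)%:R ^+ 2 * (pi * y) ^+ 2 / 16 =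
   (trials a m)%:R * (x / 4) ^+ 2 by rewrite /x; field; rewrite gt_eqF.
have x4 : 0 <= x / 4 by rewrite divr_ge0.
by rewrite ler_wpM2l//; apply: lerXn2r => //; rewrite nnegrE// (le_trans x4).
Qed.

(** Trades the square for a bound linear in the absolute value of [j], so that Gaussian terms are
    dominated by a geometric sequence. *)
Lemma shift_sqr_ge (R : realType) (xi : R) (j : int) : `|xi| <= 1 ->
  (absz j)%:R - 1 <= (xi + j%:~R) ^+ 2.
Proof.
move=> xi1; have j0 : `|j%:~R| = (absz j)%:R :> R by rewrite -intr_norm natr_absz.
have h : (absz j)%:R - 1 <= `|xi + j%:~R|.
  have := ler_normB (xi + j%:~R) xi; rewrite addrAC subrr add0r j0; lra.
rewrite -[_ ^+ 2]ger0_norm ?sqr_ge0// normrX.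
case: (absz j) h => [|n] h; first by rewrite sub0r (le_trans _ (sqr_ge0 _))// lerN10.
have n0 : 0 <= n.+1%:R - 1 :> R by rewrite -natr1 addrK.
apply: (@le_trans _ _ ((n.+1%:R - 1) ^+ 2)).
  rewrite -natr1 addrK; case: (n) => [|k]; first by rewrite expr0n.
  by rewrite expr2 ler_peMr// ler1n.
by apply: lerXn2r; rewrite ?nnegrE.
Qed.

(* Expand [(2 cos y) ^ (2 N)] by the binomial theorem and average over the points
   [y = pi (xi + j) / (2 m + 1)], [-m <= j <= m]; with [N ~ (2 m + 1)^2 / (pi a)],
   both sides converge termwise, under a geometric dominating sequence. *)
Lemma theta_inversion1 (R : realType) : exists2 kappa : R, 0 <= kappa &
  forall a xi : R, 0 < a -> `|xi| <= 1 -> exists S : R,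
    bisum (fun j => expR (- (pi * (xi + j%:~R) ^+ 2 / a))) J @[J --> \oo] --> S /\
    bisum (fun k => expR (- (pi * a * k%:~R ^+ 2)) * cos (2 * pi * k%:~R * xi)) J
      @[J --> \oo] --> kappa / Num.sqrt a * S.
Proof.
have p0 := pi_gt0 R.
have [b b0 cb] := wallis_cvg R; exists (b / Num.sqrt pi).
  by rewrite divr_ge0// sqrtr_ge0.
move=> a xi a0 xi1; have pia : 0 < pi * a by rewrite mulr_gt0.
pose f m (j : int) : R := (cos (pi * (xi + j%:~R) / (m.*2.+1)%:R) ^+ 2) ^+ trials a m.
(* For large [m], [N / M^2] exceeds half its limit, [1 / (2 pi a)]; times [pi^2 / 16], from
   [cosX_trials_le], this is [c]. The factor [expR c] below pays for the [- 1] in [shift_sqr_ge]. *)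
pose c := pi / (32 * a).
have c0 : 0 < c by rewrite divr_gt0 ?mulr_gt0.
have [||||S [cS1 cS2]] := @bisum_tannery R f
  (fun j => expR (- (pi * (xi + j%:~R) ^+ 2 / a))) id (expR c) (expR (- c)).
- by rewrite expR_ge0 expR_lt1 oppr_lt0.
- by move=> j; exact: cvg_cosX_trials.
- by move=> K; exact: nbhs_infty_ge.
- near=> m => j jm.
  have m9 : (9 < m)%N by near: m; exact: nbhs_infty_gt.
  rewrite ger0_norm; last by apply: exprn_ge0; exact: sqr_ge0.
  apply: (le_trans (cosX_trials_le a0 m9 _)).
    apply: (le_trans (ler_normD _ _)); rewrite addrC lerD//.
    by rewrite -intr_norm -natr_absz ler_nat.
  rewrite -expRM_natl -expRD ler_expR.
  have nu : (2 * (pi * a))^-1 <= (trials a m)%:R / (m.*2.+1)%:R ^+ 2.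
    near: m; apply: (cvgr_ge _ (cvg_trials a0)).
    by rewrite ltf_pV2 ?posrE ?mulr_gt0//; lra.
  have sq := shift_sqr_ge j xi1.
  rewrite mulrN lerNl opprD opprK.
  apply: (@le_trans _ _ ((2 * (pi * a))^-1 * (pi * (xi + j%:~R)) ^+ 2 / 16)).
    rewrite exprMn (_ : (2 * (pi * a))^-1 * _ / 16 = c * (xi + j%:~R) ^+ 2).
      by rewrite addrC mulrC -{2}[c]mulr1 -mulrBr ler_wpM2l// ltW.
    rewrite /c; move: (xi + _) => z.
    have e (q : R) : 0 < q -> (2 * (q * a))^-1 * (q ^+ 2 * z ^+ 2) / 16 =
        q / (32 * a) * z ^+ 2 by move=> q0; field; rewrite !gt_eqF.
    exact: e.
  by rewrite ler_wpM2r// ler_wpM2r// sqr_ge0.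
exists S; split => //.
pose g m (k : int) : R := binratio R (trials a m) (absz k * m.*2.+1) *
  cos (2 * pi * k%:~R * xi).
have [||||T [cT1 cT2]] := @bisum_tannery R g
  (fun k => expR (- (pi * a * k%:~R ^+ 2)) * cos (2 * pi * k%:~R * xi))
  (fun m => (trials a m %/ m.*2.+1)%N) 1 (expR (- (pi * a / 2))).
- by rewrite expR_ge0 expR_lt1 oppr_lt0 divr_gt0.
- move=> k; apply: cvgM; last exact: cvg_cst.
  have -> : k%:~R ^+ 2 = (absz k)%:R ^+ 2 :> R.
    by rewrite natr_absz intr_norm real_normK// num_real.
  exact: cvg_binratio_trials.
- by move=> K; exact: trials_divy.
- near=> m => k km; have N0 : (0 < trials a m)%N by near: m; exact: trialsy.
  rewrite mul1r /g normrM ger0_norm ?binratio_ge0//.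
  apply: (@le_trans _ _ (binratio R (trials a m) (absz k * m.*2.+1))).
    by rewrite ler_piMr ?binratio_ge0// cos_max.
  by apply: binratio_trials_le => //; rewrite -leq_divRL.
(* The two sides of [poisson_binomial] are related by the factor [4^N / (M 'C(2 N, N))], which is
   [wallis N * sqrt (N / M^2)] and tends to [b / sqrt (pi a)]. *)
have -> : b / Num.sqrt pi / Num.sqrt a * S = T; last exact: cT1.
have cN : trials a m @[m --> \oo] --> \oo.
  by apply/cvgnyPge => K; exact: trialsy.
have cw : wallis R (trials a m) @[m --> \oo] --> b.
  exact: (cvg_comp _ _ cN cb).
have csq : Num.sqrt ((trials a m)%:R / (m.*2.+1)%:R ^+ 2) @[m --> \oo] -->
    Num.sqrt (pi * a)^-1.
  by apply: continuous_cvg; [exact: sqrt_continuous|exact: cvg_trials].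
have := cvgM (cvgM cw csq) cS2.
have -> : b * Num.sqrt (pi * a)^-1 * S = b / Num.sqrt pi / Num.sqrt a * S.
  by rewrite sqrtrV ?(ltW pia)// sqrtrM ?(ltW p0)// invfM; ring.
move=> H; apply/esym/(cvg_unique _ cT2) => //; apply: cvg_trans (H _ _).
apply: near_eq_cvg; near=> m; rewrite /=.
have N0 : (0 < trials a m)%N by near: m; exact: trialsy.
have M0 : 0 < (m.*2.+1)%:R :> R by rewrite ltr0n.
have B0 := central_bin_gt0 R (trials a m).
have := @poisson_binomial R xi (trials a m) m; rewrite -/(f m) => P.
have {}P : bisum (f m) m * 4 ^+ trials a m =
   (m.*2.+1)%:R * 'C((trials a m).*2, trials a m)%:R * bisum (g m) (trials a m %/ m.*2.+1).
  rewrite P -mulrA; congr (_ * _); rewrite [RHS]mulr_sumr.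
  rewrite -/(bisum (fun k => 'C((trials a m).*2, trials a m)%:R * g m k) _).
  apply: eq_bisum => k kN.
  rewrite /g /binratio mulrA; congr (_ * _).
  rewrite [RHS]mulrC -mulrA mulVf ?gt_eqF// mulr1; congr _%:R.
  have kMN : (absz k * m.*2.+1 <= trials a m)%N by rewrite -leq_divRL.
  have [k0|k0] := leP 0 k; first by congr 'C(_, _); lia.
  rewrite -[RHS]bin_sub; last by rewrite -addnn; lia.
  by congr 'C(_, _); rewrite -addnn; lia.
have s0 : 0 < Num.sqrt (trials a m)%:R :> R by rewrite sqrtr_gt0 ltr0n.
rewrite sqrtrM// sqrtrV ?sqr_ge0// sqrtr_sqr (gtr0_norm M0) /wallis.
apply: (@mulfI _ ((m.*2.+1)%:R * 'C((trials a m).*2, trials a m)%:R)).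
  by rewrite mulf_neq0 ?gt_eqF.
rewrite -P; field.
by rewrite !gt_eqF.
Unshelve. all: by end_near.
Qed.

(** * Poisson summation over lattices with rational Gram matrix *)

Local Open Scope complex_scope.

(** The additive character [exp (2 pi i x / p)]; [(Zp_trunc p).+2] is the cardinal of ['Z_p], equal
    to [p] when [p > 1]. *)
Definition zchar (R : realType) p (x : 'Z_p) : R[i] :=
  (cos (2 * pi * x%:R / (Zp_trunc p).+2%:R)) +i* (sin (2 * pi * x%:R / (Zp_trunc p).+2%:R)).

Lemma zchar0 (R : realType) p : zchar R (0 : 'Z_p) = 1.
Proof. by rewrite /zchar mulr0 mul0r cos0 sin0. Qed.

Lemma zchar_nat (R : realType) p (k : nat) :
  zchar R (inZp k : 'Z_p) = (cos (2 * pi * k%:R / (Zp_trunc p).+2%:R)) +i*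
    (sin (2 * pi * k%:R / (Zp_trunc p).+2%:R)).
Proof.
rewrite /zchar /=; set P := (Zp_trunc p).+2.
have P0 : P%:R != 0 :> R by rewrite pnatr_eq0.
have -> : 2 * pi * k%:R / P%:R = 2 * pi * (k %% P)%N%:R / P%:R + 2 * pi * (k %/ P)%N%:Z%:~R :> R.
  by rewrite {1}(divn_eq k P) natrD natrM; field.
by rewrite cosD2pin sinD2pin.
Qed.

Lemma zcharD (R : realType) p (x y : 'Z_p) : zchar R (x + y) = zchar R x * zchar R y.
Proof.
have -> : x + y = inZp (x + y)%N by apply: val_inj.
rewrite zchar_nat natrD mulrDr mulrDl cosD sinD /zchar.
by apply/eqP; rewrite eq_complex /=; apply/andP; split; apply/eqP; ring.
Qed.

Lemma zchar_sum (R : realType) p (I : Type) (r : seq I) (F : I -> 'Z_p) :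
  zchar R (\sum_(i <- r) F i) = \prod_(i <- r) zchar R (F i).
Proof.
elim: r => [|i r IH]; first by rewrite !big_nil zchar0.
by rewrite !big_cons zcharD IH.
Qed.

Lemma zchar_neq1 (R : realType) p (x : 'Z_p) : x != 0 -> zchar R x != 1.
Proof.
move=> x0; apply/eqP => -[+ _]; set P := (Zp_trunc p).+2.
have P0 : 0 < P%:R :> R by rewrite ltr0n.
have -> : 2 * pi * x%:R / P%:R = (pi * x%:R / P%:R) *+ 2 :> R.
  by rewrite -[RHS]mulr_natl; field; rewrite gt_eqF.
rewrite cos_mulr2n => E.
have : sin (pi * x%:R / P%:R) ^+ 2 == 0 :> R by rewrite sin2cos2; apply/eqP; lra.
rewrite sqrf_eq0 gt_eqF// sin_gt0_pi//.
have xn : (0 < x)%N by rewrite lt0n; apply: contra x0 => /eqP x0; apply/eqP/val_inj.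
rewrite divr_gt0 ?mulr_gt0 ?pi_gt0 ?ltr0n//= ltr_pdivrMr//.
by rewrite ltr_pM2l ?pi_gt0// ltr_nat ltn_ord.
Qed.

Section finite_poisson.
Variables (R : realType) (p n : nat) (W T : 'I_n -> 'I_n -> 'Z_p).

Definition annihilates (r : {ffun 'I_n -> 'Z_p}) (W : 'I_n -> 'I_n -> 'Z_p) :=
  [forall j, \sum_i r i * W j i == 0].

Hypothesis WT : forall j k, \sum_i W j i * T k i = 0.
Hypothesis dualWT : forall r h, annihilates r W -> annihilates h T ->
  \sum_i r i * h i = 0.

(** Let [H] be the annihilator of [T]. The rows of [W] lie in [H] and the annihilator of [W] is
    orthogonal to [H], so it is exactly the orthogonal of [H]. For [r] outside it, translating [h]
    by a row of [W] multiplies the sum by a character value other than 1. *)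
Lemma sum_zchar_annihilator (r : {ffun 'I_n -> 'Z_p}) :
  \sum_(h : {ffun 'I_n -> 'Z_p} | annihilates h T) zchar R (\sum_i r i * h i) =
  if annihilates r W then #|[pred h | annihilates h T]|%:R else 0.
Proof.
case: ifPn => rW.
  rewrite (eq_bigr (fun=> 1)) ?sumr_const//.
  by move=> h hT; rewrite dualWT// zchar0.
have [j rj] : exists j, \sum_i r i * W j i != 0.
  by move: rW; rewrite negb_forall => /existsP.
pose w : {ffun 'I_n -> 'Z_p} := [ffun i => W j i].
set S := LHS.
have : S = zchar R (\sum_i r i * W j i) * S.
  rewrite {1}/S (reindex_inj (addIr w)) mulr_sumr.
  apply: eq_big => h; last first.
    move=> _; rewrite -zcharD -big_split; congr zchar; apply: eq_bigr => i _.
    by rewrite !ffunE mulrDr addrC.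
  apply: eq_forallb => k; congr (_ == _).
  transitivity (\sum_i (h i * T k i + W j i * T k i)); last first.
    by rewrite big_split /= WT addr0.
  by apply: eq_bigr => i _; rewrite !ffunE mulrDl.
move/eqP; rewrite -subr_eq0 -[X in X - _]mul1r -mulrBl mulf_eq0 subr_eq0 eq_sym.
by rewrite (negPf (zchar_neq1 _ rj)) => /eqP.
Qed.

(** The MacWilliams identity for a pair of dual codes and a product weight: [D i] is the finite
    Fourier transform of [C i]. *)
Lemma finite_poisson (C D : 'I_n -> 'Z_p -> R) :
  (forall i h, \sum_r (C i r)%:C * zchar R (r * h) = (D i h)%:C) ->
  \sum_(h | annihilates h T) \prod_i D i (h i) =
  #|[pred h | annihilates h T]|%:R * \sum_(r | annihilates r W) \prod_i C i (r i).
Proof.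
move=> CD; apply: (@complexI R); rewrite rmorphM rmorph_nat !rmorph_sum /=.
transitivity (\sum_(h | annihilates h T) \sum_(r : {ffun 'I_n -> 'Z_p})
   (\prod_i (C i (r i))%:C) * zchar R (\sum_i r i * h i)).
  apply: eq_bigr => h _; rewrite rmorph_prod /=.
  under eq_bigr => i _ do rewrite -CD.
  rewrite bigA_distr_bigA /=; apply: eq_bigr => r _.
  by rewrite big_split zchar_sum.
rewrite exchange_big /= mulr_sumr [RHS]big_mkcond /=; apply: eq_bigr => r _.
rewrite -mulr_sumr sum_zchar_annihilator; case: ifP => _; last by rewrite mulr0.
by rewrite rmorph_prod mulrC.
Qed.

End finite_poisson.

(** With [Q = q.+2], the numbers [Q j + r] for [j] from [- J] to [J] fill the interval from [- Q J]
    to [Q J + Q - 1], and the last [Q - 1] overhang the symmetric range. *)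
Lemma bisum_residues (R : realType) (F : int -> R) q J :
  \sum_(r < q.+2) bisum (fun j => F (q.+2%:Z * j + r%:Z)) J =
  bisum F (q.+2 * J) + \sum_(i < q.+1) F ((q.+2 * J)%N%:Z + i.+1%:Z).
Proof.
pose G (i : nat) := F (i%:Z - (q.+2 * J)%N%:Z).
have H A : \sum_(r < q.+2) \sum_(j < A) G (q.+2 * j + r)%N = \sum_(0 <= i < A * q.+2) G i.
  elim: A => [|A IH].
    by rewrite mul0n big_geq// big1// => r _; rewrite big_ord0.
  under eq_bigr => r _ do rewrite big_ord_recr /=.
  rewrite big_split /= IH.
  rewrite [RHS](@big_cat_nat _ _ _ (A * q.+2)) //=; last by nia.
  congr (_ + _); rewrite -{1}[(A * q.+2)%N]add0n big_addn -mulnBl subSnn mul1n big_mkord.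
  by apply: eq_bigr => r _; rewrite addnC mulnC.
transitivity (\sum_(r < q.+2) \sum_(j < J.*2.+1) G (q.+2 * j + r)%N).
  by apply: eq_bigr => r _; apply: eq_bigr => j _; rewrite /G; congr F; lia.
rewrite H (@big_cat_nat _ _ _ (q.+2 * J).*2.+1)//=; last by rewrite -!mul2n; nia.
rewrite big_mkord; congr (_ + _).
rewrite -{1}[(q.+2 * J).*2.+1]add0n big_addn.
have -> : (J.*2.+1 * q.+2 - (q.+2 * J).*2.+1 = q.+1)%N by rewrite -!mul2n; nia.
by rewrite big_mkord; apply: eq_bigr => i _; rewrite /G; congr F; rewrite -!mul2n; lia.
Qed.

Lemma residue_abs_ge q (j : int) (r : 'I_q.+2) :
  (absz j <= absz (q.+2%:Z * j + r%:Z)%R)%N.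
Proof. by have := ltn_ord r; nia. Qed.

Lemma is_cvg_residue (R : realType) (F : int -> R) (C b : R) q (r : 'I_q.+2) :
  0 <= b < 1 -> (forall k : int, `|F k| <= C * b ^+ absz k) ->
  cvg (bisum (fun j => F (q.+2%:Z * j + r%:Z)) J @[J --> \oo]).
Proof.
move=> b01 FC; apply: (is_cvg_bisum (C := C) b01) => j.
have /andP[b0 b1] := b01.
have C0 : 0 <= C by have := FC 0; rewrite absz0 expr0 mulr1; apply: le_trans.
apply: (le_trans (FC _)); rewrite ler_wpM2l//.
by apply: ler_wiXn2l; rewrite ?(ltW b1)// residue_abs_ge.
Qed.

Definition residue_sum (R : realType) (F : int -> R) q (r : 'I_q.+2) : R :=
  lim (bisum (fun j => F (q.+2%:Z * j + r%:Z)) J @[J --> \oo]).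

Lemma sum_residue_cvg (R : realType) (F : int -> R) (C b : R) q :
  0 <= b < 1 -> (forall k : int, `|F k| <= C * b ^+ absz k) ->
  bisum F (q.+2 * J) @[J --> \oo] --> \sum_(r < q.+2) residue_sum F r.
Proof.
move=> b01 FC; have /andP[b0 b1] := b01.
have C0 : 0 <= C by have := FC 0; rewrite absz0 expr0 mulr1; apply: le_trans.
have c1 : \sum_(r < q.+2) bisum (fun j => F (q.+2%:Z * j + r%:Z)) J @[J --> \oo]
    --> \sum_(r < q.+2) residue_sum F r.
  by apply: cvgn_sum => r _; exact: (is_cvg_residue b01 FC).
have c2 : \sum_(i < q.+1) F ((q.+2 * J)%N%:Z + i.+1%:Z) @[J --> \oo] --> (0 : R).
  rewrite [X in _ --> X](_ : _ = \sum_(i < q.+1) 0); last by rewrite big1.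
  apply: cvgn_sum => i _.
  apply: (@squeeze_cvgr _ _ _ _ (fun J => - (C * b ^+ J)) (fun J => C * b ^+ J)).
  - near=> J; rewrite -ler_norml; apply: (le_trans (FC _)); rewrite ler_wpM2l//.
    by apply: ler_wiXn2l; rewrite ?(ltW b1)//; nia.
  - rewrite -[X in _ --> X]oppr0; apply: cvgN; rewrite -(mulr0 C).
    by apply: cvgM; [exact: cvg_cst|apply: cvg_expr; rewrite ger0_norm].
  - rewrite -(mulr0 C).
    by apply: cvgM; [exact: cvg_cst|apply: cvg_expr; rewrite ger0_norm].
rewrite -[X in _ --> X]subr0.
rewrite (_ : (fun J => bisum F (q.+2 * J)) = (fun J =>
  \sum_(r < q.+2) bisum (fun j => F (q.+2%:Z * j + r%:Z)) J -
  \sum_(i < q.+1) F ((q.+2 * J)%N%:Z + i.+1%:Z))); first exact: cvgB.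
by apply/funext => J; rewrite bisum_residues addrK.
Unshelve. all: by end_near.
Qed.

(** Grouping a Fourier series at the point [h / Q] by classes modulo [Q] gives the finite Fourier
    transform of the class sums; the sine part vanishes because [F] is even. *)
Lemma residue_sum_zchar (R : realType) (F : int -> R) (C b : R) q (h : 'Z_q.+2) (D : R) :
  0 <= b < 1 -> (forall k : int, `|F k| <= C * b ^+ absz k) ->
  (forall k, F (- k) = F k) ->
  bisum (fun k => F k * cos (2 * pi * k%:~R * (h%:R / q.+2%:R))) J @[J --> \oo] --> D ->
  \sum_(r : 'Z_q.+2) (residue_sum F r)%:C * zchar R (r * h) = D%:C.
Proof.
move=> b01 FC Fe cD.
have C0 : 0 <= C by have := FC 0; rewrite absz0 expr0 mulr1; apply: le_trans.
have FM (u : int -> R) : (forall k, `|u k| <= 1) ->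
    forall k, `|F k * u k| <= C * b ^+ absz k.
  move=> u1 k; rewrite normrM; apply: le_trans (FC k).
  by rewrite ler_piMr.
have Q0 : q.+2%:R != 0 :> R by rewrite pnatr_eq0.
have cy : (q.+2 * J)%N @[J --> \oo] --> \oo.
  apply/cvgnyPge => K; near=> J; apply: (@leq_trans J); last by rewrite leq_pmull.
  by near: J; exact: nbhs_infty_ge.
have per (r : 'I_q.+2) (j : int) :
    2 * pi * (q.+2%:Z * j + r%:Z)%:~R * (h%:R / q.+2%:R) =
    2 * pi * (r * h)%N%:R / q.+2%:R + 2 * pi * (h%:Z * j)%:~R :> R.
  by rewrite intrD !intrM natrM; field.
have rs (u : R -> R) (r : 'I_q.+2) : (forall x (z : int), u (x + 2 * pi * z%:~R) = u x) ->
    residue_sum (fun k => F k * u (2 * pi * k%:~R * (h%:R / q.+2%:R))) r =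
    residue_sum F r * u (2 * pi * (r * h)%N%:R / q.+2%:R).
  move=> up; rewrite /residue_sum; set U := u _.
  rewrite (_ : (fun J => bisum _ J) = (fun J =>
    bisum (fun j => F (q.+2%:Z * j + r%:Z)) J * U)); last first.
    apply/funext => J; rewrite /bisum mulr_suml; apply: eq_bigr => j _.
    by rewrite per up.
  apply: cvg_lim => //; apply: cvgM; last exact: cvg_cst.
  exact: (is_cvg_residue b01 FC).
have Ec : \sum_(r < q.+2) residue_sum F r * cos (2 * pi * (r * h)%N%:R / q.+2%:R) = D.
  have c := sum_residue_cvg (q := q) b01 (FM (fun k => cos (2 * pi * k%:~R * (h%:R / q.+2%:R)))
    (fun k => cos_max _)).
  have c' := cvg_comp _ _ cy cD.
  rewrite -(cvg_unique _ c c') //.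
  by apply: eq_bigr => r _; rewrite rs//; exact: cosD2pin.
have Es : \sum_(r < q.+2) residue_sum F r * sin (2 * pi * (r * h)%N%:R / q.+2%:R) = 0.
  have c := sum_residue_cvg (q := q) b01 (FM (fun k => sin (2 * pi * k%:~R * (h%:R / q.+2%:R)))
    (fun k => sin_max _)).
  rewrite (_ : (fun J => bisum _ _) = fun=> 0) in c; last first.
    apply/funext => J; elim: (q.+2 * J)%N => [|m IH].
      by rewrite bisum0 mulr0z mulr0 mul0r sin0 mulr0.
    rewrite bisumS IH add0r Fe -mulrDr mulrNz mulrN mulNr sinN.
    by rewrite -[X in X + _]opprK -opprD addNr oppr0 mulr0.
  apply: etrans _ (cvg_unique _ c (cvg_cst (0 : R))) => //.
  by apply: eq_bigr => r _; rewrite rs//; exact: sinD2pin.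
rewrite (eq_bigr (fun r => (residue_sum F r * cos (2 * pi * (r * h)%N%:R / q.+2%:R))
  +i* (residue_sum F r * sin (2 * pi * (r * h)%N%:R / q.+2%:R)))); last first.
  move=> r _; have -> : zchar R (r * h) = _ := @zchar_nat R q.+2 (r * h)%N.
  by apply/eqP; rewrite eq_complex /= !mul0r subr0 addr0 !eqxx.
transitivity ((\sum_(r < q.+2) residue_sum F r * cos (2 * pi * (r * h)%N%:R / q.+2%:R))
  +i* (\sum_(r < q.+2) residue_sum F r * sin (2 * pi * (r * h)%N%:R / q.+2%:R))).
  by elim/big_rec3: _ => // r x y z _ ->; apply/eqP; rewrite eq_complex /= !eqxx.
by rewrite Ec Es.
Unshelve. all: by end_near.
Qed.

Definition gauss (R : realType) (a : R) (k : int) : R :=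
  expR (- (pi * a * k%:~R ^+ 2)).

Lemma gaussN (R : realType) (a : R) k : gauss a (- k) = gauss a k.
Proof. by rewrite /gauss mulrNz sqrrN. Qed.

Lemma gauss_bound (R : realType) (a : R) k : 0 < a ->
  `|gauss a k| <= 1 * expR (- (pi * a)) ^+ absz k.
Proof.
move=> a0; rewrite ger0_norm ?expR_ge0// mul1r -expRM_natl ler_expR mulrN lerN2.
rewrite mulrC ler_wpM2l ?mulr_ge0 ?pi_ge0 ?(ltW a0)//.
rewrite -rmorphXn /= natr_absz ler_int; nia.
Qed.

Lemma gauss_itv (R : realType) (a : R) : 0 < a -> 0 <= expR (- (pi * a)) < 1.
Proof. by move=> a0; rewrite expR_ge0 expR_lt1 oppr_lt0 mulr_gt0 ?pi_gt0. Qed.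

(** Inversion at [xi = h / Q]: since [(h / Q + j)^2 / a = (Q j + h)^2 / (Q^2 a)], the dual side is
    again a Gaussian summed over a residue class. This is the pair [C], [D] fed to
    [finite_poisson]. *)
Lemma theta_residues (R : realType) : exists2 kappa : R, 0 <= kappa &
  forall (a : R) q (h : 'Z_q.+2), 0 < a ->
  \sum_(r : 'Z_q.+2) (residue_sum (gauss a) r)%:C * zchar R (r * h) =
  (kappa / Num.sqrt a * residue_sum (gauss (q.+2%:R ^+ 2 * a)^-1) h)%:C.
Proof.
have [kappa k0 H] := theta_inversion1 R; exists kappa => // a q h a0.
have Q0 : q.+2%:R != 0 :> R by rewrite pnatr_eq0.
have h1 : `|h%:R / q.+2%:R| <= 1 :> R.
  rewrite ger0_norm ?divr_ge0// ler_pdivrMr ?ltr0n// mul1r ler_nat ltnW//.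
have [S [cS cD]] := H a _ a0 h1.
apply: (residue_sum_zchar (gauss_itv a0) (fun k => gauss_bound k a0) (gaussN a)).
rewrite (_ : residue_sum _ h = S) //.
apply: cvg_lim => //; rewrite (_ : (fun J => bisum _ J) = (fun J =>
  bisum (fun j => expR (- (pi * (h%:R / q.+2%:R + j%:~R) ^+ 2 / a))) J)) //.
apply/funext => J; apply: eq_bigr => j _; rewrite /gauss; congr (expR (- _)).
have a0' : a != 0 by rewrite gt_eqF.
move: (j%:Z - J%:Z) => z; rewrite intrD intrM /=.
have e (p Q : R) : Q != 0 -> p * (Q ^+ 2 * a)^-1 * (Q * z%:~R + h%:R) ^+ 2 =
    p * (h%:R / Q + z%:~R) ^+ 2 / a by move=> Q1; field; rewrite a0' Q1.
exact: e.
Qed.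

Section boxes.
Variables (q n : nat).
Implicit Types (U V : 'M[int]_n).

(** Transposed, so that [annihilates r (zmod_mx U)] means [r U = 0] modulo [q.+2]. *)
Definition zmod_mx U (j i : 'I_n) : 'Z_q.+2 := (U i j)%:~R.

Definition box_lift J (x : {ffun 'I_n -> 'Z_q.+2} * {ffun 'I_n -> 'I_J.*2.+1}) :
    'rV[int]_n :=
  \row_i (q.+2%:Z * ((x.2 i)%:Z - J%:Z) + (x.1 i)%:Z).

(** Write [Q = q.+2] and let [U V = Q]. An integral [w] is of the form [z V] with [z] integral iff
    [w U] vanishes modulo [Q], and then [z = w U / Q]: the box consists of the [z] such that [z V]
    has all coordinates between [- Q J] and [Q J + Q - 1]. *)
Definition box U J : seq 'rV[int]_n :=
  [seq map_mx (divz^~ q.+2%:Z) (box_lift x *m U) |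
     x <- enum [pred x : {ffun 'I_n -> 'Z_q.+2} * {ffun 'I_n -> 'I_J.*2.+1} |
       annihilates x.1 (zmod_mx U)]].

Lemma intr_Zp_eq0 (k : int) : (k%:~R == 0 :> 'Z_q.+2) = (q.+2%:Z %| k)%Z.
Proof.
have H (u : nat) : (u%:R == 0 :> 'Z_q.+2) = (q.+2 %| u)%N.
  by rewrite Zp_nat -val_eqE /= /dvdn.
rewrite dvdzE /=; case: k => u; first exact: H.
by rewrite NegzE mulrNz oppr_eq0 abszN; exact: H.
Qed.

Lemma box_lift_mod J x i : ((@box_lift J x 0 i)%:~R : 'Z_q.+2) = x.1 i.
Proof.
rewrite mxE intrD intrM.
have -> : (q.+2%:Z)%:~R = 0 :> 'Z_q.+2 by apply/eqP; rewrite intr_Zp_eq0.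
by rewrite mul0r add0r -[LHS]/((x.1 i)%:R) natr_Zp.
Qed.

Lemma mulmx_box_lift U J x : annihilates x.1 (zmod_mx U) ->
  q.+2%:Z *: map_mx (divz^~ q.+2%:Z) (@box_lift J x *m U) = box_lift x *m U.
Proof.
move=> /forallP xU; apply/rowP => j; rewrite !mxE mulrC divzK//.
rewrite -intr_Zp_eq0 -(eqP (xU j)) rmorph_sum /=; apply/eqP/eq_bigr => i _.
by rewrite rmorphM /= box_lift_mod.
Qed.

Lemma boxK U V J x : U *m V = (q.+2%:Z)%:M -> annihilates x.1 (zmod_mx U) ->
  map_mx (divz^~ q.+2%:Z) (@box_lift J x *m U) *m V = box_lift x.
Proof.
move=> UV xU; apply: (@scalemx_inj _ _ _ q.+2%:Z) => //.
by rewrite scalemxAl mulmx_box_lift// -mulmxA UV mul_mx_scalar.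
Qed.

Lemma box_lift_inj J : injective (@box_lift J).
Proof.
move=> [r j] [r' j'] /rowP E.
have rE : r = r'.
  apply/ffunP => i; rewrite -[LHS](box_lift_mod (r, j)) -[RHS](box_lift_mod (r', j')).
  by rewrite E.
congr pair => //; apply/ffunP => i; apply: val_inj.
by have := E i; rewrite !mxE rE /= => /addIr /mulfI - /(_ isT) /addIr [->].
Qed.

Lemma uniq_box U V J : U *m V = (q.+2%:Z)%:M -> uniq (box U J).
Proof.
move=> UV; rewrite map_inj_in_uniq ?enum_uniq// => x y.
rewrite !mem_enum !inE => xU yU E; apply: (@box_lift_inj J).
by rewrite -(boxK UV xU) -(boxK UV yU) E.
Qed.

Lemma box0 U J : 0 \in box U J.
Proof.
have JJ : (J < J.*2.+1)%N by rewrite -addnn; lia.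
apply/mapP; exists ([ffun=> 0], [ffun=> Ordinal JJ]).
  rewrite mem_enum inE; apply/forallP => j /=.
  by rewrite big1// => i _; rewrite ffunE mul0r.
rewrite (_ : box_lift _ = 0) ?mul0mx.
  by apply/rowP => i; rewrite !mxE div0z.
by apply/rowP => i; rewrite !mxE !ffunE /= subrr mulr0 addr0.
Qed.

Lemma sum_box (R : realType) U V J (f : 'I_n -> int -> R) :
  U *m V = (q.+2%:Z)%:M ->
  \sum_(z <- box U J) \prod_i f i ((z *m V) 0 i) =
  \sum_(r : {ffun 'I_n -> 'Z_q.+2} | annihilates r (zmod_mx U))
    \prod_i bisum (fun j => f i (q.+2%:Z * j + (r i)%:Z)) J.
Proof.
move=> UV; rewrite big_map big_enum /=.
rewrite (eq_bigr (fun x => \prod_i f i (box_lift x 0 i))); last first.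
  by move=> x xU; apply: eq_bigr => i _; rewrite boxK.
under [RHS]eq_bigr => r _ do rewrite /bisum bigA_distr_bigA.
rewrite pair_big_dep /=; apply: eq_big => [x|x _]; first by rewrite andbT.
by apply: eq_bigr => i _; rewrite mxE.
Qed.

End boxes.

(** Free of square roots, unlike Cholesky's decomposition, hence available over the rationals. The
    induction passes to the Schur complement [C'] of the first diagonal entry. *)
Lemma ldl_decomposition (F : realFieldType) n (A : 'M[F]_n) :
  A^T = A -> (forall z : 'rV_n, z != 0 -> 0 < (z *m A *m z^T) 0 0) ->
  exists U : 'M[F]_n, exists2 d : 'rV[F]_n, (forall i, 0 < d 0 i) &
    A = U *m diag_mx d *m U^T.
Proof.
elim: n A => [|n IH] A.
  by move=> _ _; exists 1%:M; exists 0; [case|apply/matrixP; case].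
rewrite -[n.+1]/(1 + n)%N in A * => Asym Apos.
pose a := A 0 0; pose b : 'rV[F]_n := ursubmx A; pose C : 'M[F]_n := drsubmx A.
have Aul : ulsubmx A = a%:M.
  by apply/matrixP => i j; rewrite !ord1 !mxE eqxx; congr (A _ _); apply: val_inj.
have Adl : dlsubmx A = b^T by rewrite /b trmx_ursub Asym.
have Csym : C^T = C by rewrite /C trmx_drsub Asym.
have AE : A = block_mx a%:M b b^T C by rewrite -[LHS]submxK Aul Adl.
have qE (s : F) (z : 'rV_n) : (row_mx s%:M z *m A *m (row_mx s%:M z)^T) 0 0 =
   a * s ^+ 2 + 2 * s * (z *m b^T) 0 0 + (z *m C *m z^T) 0 0.
  have D (X Y : 'M[F]_1) : (X + Y) 0 0 = X 0 0 + Y 0 0 by rewrite mxE.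
  have S c (X : 'M[F]_1) : (c *: X) 0 0 = c * X 0 0 by rewrite mxE.
  have T0 (X : 'M[F]_1) : X^T 0 0 = X 0 0 by rewrite mxE.
  have bz : (b *m z^T) 0 0 = (z *m b^T) 0 0 by rewrite -[RHS]T0 trmx_mul trmxK.
  rewrite AE mul_row_block tr_row_mx mul_row_col !mulmxDl !D tr_scalar_mx.
  rewrite !mul_scalar_mx !mul_mx_scalar -!scalemxAl !S bz.
  by rewrite [a%:M 0 0]mxE eqxx mulr1n; ring.
have a0 : 0 < a.
  have := Apos (row_mx 1%:M 0); rewrite qE mul0mx !mul0mx !mxE.
  rewrite expr1n !mulr1 mulr0 !addr0; apply.
  apply/eqP => /rowP /(_ 0); rewrite !mxE; case: splitP => // j _.
  by rewrite !mxE !ord1 eqxx => /eqP; rewrite oner_eq0.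
pose C' := C - a^-1 *: (b^T *m b).
have [U' [d' d'0 UE]] : exists U : 'M[F]_n, exists2 d : 'rV[F]_n, (forall i, 0 < d 0 i) &
    C' = U *m diag_mx d *m U^T.
  apply: IH.
    by rewrite /C' linearB linearZ /= trmx_mul trmxK Csym.
  (* This [s] minimizes the form at [(s, z)] for fixed [z], and the minimum is the value of the
     Schur complement at [z]. *)
  move=> z z0; pose s := - (a^-1 * (z *m b^T) 0 0).
  have := Apos (row_mx s%:M z); rewrite qE.
  have -> : a * s ^+ 2 + 2 * s * (z *m b^T) 0 0 + (z *m C *m z^T) 0 0 =
     (z *m C' *m z^T) 0 0.
    have D (X Y : 'M[F]_1) : (X - Y) 0 0 = X 0 0 - Y 0 0 by rewrite !mxE.
    have S c (X : 'M[F]_1) : (c *: X) 0 0 = c * X 0 0 by rewrite mxE.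
    rewrite /C' mulmxBr mulmxBl D -scalemxAr -scalemxAl S.
    rewrite (_ : z *m (b^T *m b) *m z^T = z *m b^T *m (b *m z^T)); last by rewrite !mulmxA.
    have -> : (z *m b^T *m (b *m z^T)) 0 0 = (z *m b^T) 0 0 ^+ 2.
      rewrite mxE big_ord1; have -> : (b *m z^T) 0 0 = (z *m b^T) 0 0.
        have T0 (X : 'M[F]_1) : X^T 0 0 = X 0 0 by rewrite mxE.
        by rewrite -[RHS]T0 trmx_mul trmxK.
      by rewrite expr2.
    by rewrite /s; field; rewrite gt_eqF.
  apply; apply: contra z0 => /eqP /rowP E; apply/eqP/rowP => j.
  by have := E (rshift 1 j); rewrite row_mxEr !mxE.
exists (block_mx 1%:M 0 (a^-1 *: b^T) U'), (row_mx a%:M d').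
  move=> i; rewrite mxE; case: splitP => j _; last exact: d'0.
  by rewrite !ord1 mxE eqxx.
rewrite diag_mx_row tr_block_mx !mulmx_block !mul1mx !mul0mx !mulmx0 !addr0 !add0r.
rewrite trmx0 trmx1 !mulmx0 !mulmx1 linearZ /= trmxK !addr0.
have -> : diag_mx (a%:M : 'rV[F]_1) = (a%:M : 'M[F]_1).
  by apply/matrixP => i j; rewrite !ord1 !mxE !eqxx.
have a1 : a != 0 by rewrite gt_eqF.
rewrite -UE AE; congr block_mx.
- by rewrite mul_scalar_mx scalerA divff// scale1r mul0mx addr0.
- by rewrite mul_mx_scalar scalerA divff// scale1r.
- rewrite mul_mx_scalar scalerA divff// scale1r -scalemxAr /C'.
  by rewrite addrC subrK.
Qed.

Lemma common_denominator n (U : 'M[rat]_n) :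
  exists2 N : int, N != 0 & exists T : 'M[int]_n, N%:~R *: U = map_mx intr T.
Proof.
exists (\prod_i \prod_j denq (U i j)).
  by rewrite !prodf_seq_neq0; apply/allP => i _ /=; rewrite prodf_seq_neq0;
     apply/allP => j _ /=; rewrite denq_neq0.
pose N := \prod_i \prod_j denq (U i j).
have dv i j : exists c : int, N = c * denq (U i j).
  exists ((\prod_(k | k != j) denq (U i k)) * \prod_(k | k != i) \prod_j denq (U k j)).
  by rewrite /N (bigD1 i) //= (bigD1 j) //=; ring.
have /choice [g Hg] : forall p : 'I_n * 'I_n, exists c : int, N = c * denq (U p.1 p.2).
  by move=> p; exact: dv.
exists (\matrix_(i, j) (g (i, j) * numq (U i j))).
apply/matrixP => i j; rewrite !mxE -/N (Hg (i, j)) !intrM /= -mulrA; congr (_ * _).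
by rewrite -{2}[U i j]divq_num_den mulrC divfK// intr_eq0 denq_neq0.
Qed.

Definition qform (R : realType) n (A : 'M[R]_n) (z : 'rV[int]_n) : R :=
  (map_mx intr z *m A *m (map_mx intr z)^T) 0 0.

(** Here the rationality of [A] is used: the denominators of the factor move into [d], so [z T] runs
    over a sublattice of [Z^n] on which the form is diagonal. *)
Lemma ldl_integral (R : realType) n (A : 'M[R]_n) (A0 : 'M[rat]_n) :
  A = map_mx ratr A0 -> A^T = A ->
  (forall z : 'rV[R]_n, z != 0 -> 0 < (z *m A *m z^T) 0 0) ->
  exists T : 'M[int]_n, exists2 d : 'rV[R]_n, (forall i, 0 < d 0 i) &
    A = map_mx intr T *m diag_mx d *m (map_mx intr T)^T.
Proof.
move=> AE Asym Apos.
have [||U [d d0 UE]] := @ldl_decomposition _ n A0.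
- by apply: (@map_mx_inj _ _ (@ratr R)); rewrite -map_trmx -AE.
- move=> z z0; have z0' : map_mx (ratr : rat -> R) z != 0.
    by apply: contra z0 => /eqP E; apply/eqP/(@map_mx_inj _ _ (@ratr R)); rewrite E map_mx0.
  by have := Apos _ z0'; rewrite AE map_trmx -!map_mxM mxE ltr0q.
have [N N0 [T TE]] := common_denominator U.
have N0' : (N%:~R : R) != 0 by rewrite intr_eq0.
exists T, (N%:~R ^- 2 *: map_mx ratr d).
  by move=> i; rewrite !mxE mulr_gt0// ?ltr0q// invr_gt0 exprn_even_gt0.
have UR : map_mx ratr U = N%:~R^-1 *: map_mx intr T :> 'M[R]_n.
  apply: (scalemx_inj N0'); rewrite scalerA divff// scale1r.
  apply/matrixP => i j; have /matrixP/(_ i j) := TE; rewrite !mxE => /(congr1 (@ratr R)).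
  by rewrite rmorphM /= !ratr_int.
rewrite AE UE !map_mxM /= -map_trmx UR map_diag_mx.
rewrite !linearZ /= -!scalemxAl scalerA.
by congr (_ *: _); rewrite -invfM expr2.
Qed.

Lemma mulmx_adj_pos n (T : 'M[int]_n) : \det T != 0 ->
  exists q, exists2 U : 'M[int]_n, T *m U = (q.+2%:Z)%:M & U *m T = (q.+2%:Z)%:M.
Proof.
(* The factor 2 keeps the modulus at least 2, even for a determinant equal to 1 or -1. *)
move=> T0; exists (2 * absz (\det T)).-2%N.
have -> : (2 * absz (\det T)).-2.+2%:Z = (2 * sgz (\det T)) * \det T by lia.
exists ((2 * sgz (\det T)) *: \adj T).
  by rewrite -scalemxAr mul_mx_adj scale_scalar_mx.
by rewrite -scalemxAl mul_adj_mx scale_scalar_mx.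
Qed.

Lemma diag_form (R : comNzRingType) n (d y : 'rV[R]_n) :
  (y *m diag_mx d *m y^T) 0 0 = \sum_i d 0 i * y 0 i ^+ 2.
Proof.
by rewrite mxE; apply: eq_bigr => i _; rewrite mul_mx_diag !mxE; ring.
Qed.

(* With [A = T diag(d) T^T] and [w = z T], the sum over [z] becomes a sum over a
   sublattice that is a union of classes mod [q]; on each class it is a product
   of one-dimensional sums, whose finite Fourier transform is given by
   [theta_residues]. *)
Lemma poisson_lattice (R : realType) n (A Ai : 'M[R]_n) (A0 : 'M[rat]_n) :
  A = map_mx ratr A0 -> A^T = A ->
  (forall z : 'rV[R]_n, z != 0 -> 0 < (z *m A *m z^T) 0 0) -> A *m Ai = 1%:M ->
  exists2 K : R, 0 <= K & exists F G : nat -> seq 'rV[int]_n,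
  (forall J, [/\ uniq (F J), 0 \in F J, uniq (G J) & 0 \in G J]) /\
  forall t : R, 0 < t -> exists S : R,
    \sum_(z <- F J) expR (- (pi * t * qform A z)) @[J --> \oo] -->
      K / Num.sqrt t ^+ n * S /\
    \sum_(z <- G J) expR (- (pi * t^-1 * qform Ai z)) @[J --> \oo] --> S.
Proof.
move=> AE Asym Apos AAi.
have [T [d d0 TE]] := ldl_integral AE Asym Apos.
have Aunit : A \in unitmx by case: (mulmx1_unit AAi).
have detT : \det T != 0.
  apply: contraL Aunit => /eqP detT.
  by rewrite TE unitmxE !det_mulmx det_map_mx detT rmorph0 !mul0r unitr0.
have [q [U TU UT]] := mulmx_adj_pos detT.
have [kappa k0 TR] := theta_residues R.
have Q0 : (q.+2%:R : R) != 0 by rewrite pnatr_eq0.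
have TUt : T^T *m U^T = (q.+2%:Z)%:M by rewrite -trmx_mul UT tr_scalar_mx.
have Qz : (q.+2%:Z)%:~R = 0 :> 'Z_q.+2 by apply/eqP; rewrite intr_Zp_eq0.
have WT j k : \sum_i (zmod_mx q U j i) * zmod_mx q T^T k i = 0.
  have /matrixP/(_ k j) := TU; rewrite !mxE => /(congr1 (fun z => z%:~R : 'Z_q.+2)).
  rewrite rmorphMn /= Qz mul0rn rmorph_sum /= => E.
  by rewrite -[RHS]E; apply: eq_bigr => i _; rewrite /zmod_mx mxE rmorphM mulrC.
have lift0 (r : {ffun 'I_n -> 'Z_q.+2}) i :
    (@box_lift q n 0 (r, [ffun=> ord0])) 0 i = (r i)%:Z.
  by rewrite mxE ffunE /= mulr0 add0r.
(* The lifts of [r] and [h] are [z T] and [w U^T] with [z], [w] integral, and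
   [z T U w^T = Q z w^T]. *)
have WTd (r h : {ffun 'I_n -> 'Z_q.+2}) : annihilates r (zmod_mx q U) ->
    annihilates h (zmod_mx q T^T) -> \sum_i r i * h i = 0.
  move=> rU hT; pose o : {ffun 'I_n -> 'I_0.*2.+1} := [ffun=> ord0].
  pose x := (r, o); pose y := (h, o).
  have := boxK (J := 0) (x := x) UT rU; set z := map_mx _ _ => zE.
  have := boxK (J := 0) (x := y) TUt hT; set w := map_mx _ _ => wE.
  have : box_lift x *m (box_lift y)^T = (q.+2%:Z) *: (z *m w^T).
    by rewrite -zE -wE trmx_mul trmxK mulmxA -(mulmxA z) TU mul_mx_scalar -scalemxAl.
  move/matrixP/(_ 0 0); rewrite !mxE => /(congr1 (fun z => z%:~R : 'Z_q.+2)).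
  rewrite rmorphM /= Qz mul0r rmorph_sum /= => E; rewrite -[RHS]E.
  apply: eq_bigr => i _; rewrite [_^T _ _]mxE rmorphM /= /x /y !lift0.
  by rewrite -!pmulrn !natr_Zp.
pose Hs : pred {ffun 'I_n -> 'Z_q.+2} := [pred h | annihilates h (zmod_mx q T^T)].
pose K := (#|Hs|%:R : R)^-1 * \prod_(i < n) (kappa / Num.sqrt (d 0 i)).
exists K.
  rewrite mulr_ge0 ?invr_ge0// prodr_ge0// => i _.
  by rewrite divr_ge0// sqrtr_ge0.
exists (box q U), (box q T^T); split.
  by move=> J; rewrite (uniq_box J UT) (uniq_box J TUt) !box0.
move=> t t0.
pose S := \sum_(h | annihilates h (zmod_mx q T^T)) \prod_i
  residue_sum (gauss (q.+2%:R ^+ 2 * (t * d 0 i))^-1) (h i).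
exists S.
have td i : 0 < t * d 0 i by rewrite mulr_gt0.
have qA z : expR (- (pi * t * qform A z)) = \prod_i gauss (t * d 0 i) ((z *m T) 0 i).
  rewrite /gauss -expR_sum; congr expR; rewrite sumrN; congr (- _).
  rewrite /qform TE !mulmxA -map_mxM -!mulmxA -trmx_mul -map_mxM mulmxA diag_form.
  by rewrite mulr_sumr; apply: eq_bigr => i _; rewrite !mxE; ring.
have AiE : Ai = (q.+2%:R ^- 2) *: ((map_mx intr U)^T *m
    diag_mx (\row_i (d 0 i)^-1) *m map_mx intr U).
  apply: (can_inj (mulKmx Aunit)); rewrite AAi TE -scalemxAr.
  have DD : diag_mx d *m diag_mx (\row_i (d 0 i)^-1) = 1%:M.
    rewrite mulmx_diag; apply/matrixP => i j; rewrite !mxE; case: eqP => // _.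
    by rewrite divff// gt_eqF.
  have TtU : (map_mx intr T)^T *m (map_mx intr U)^T = (q.+2%:R)%:M :> 'M[R]_n.
    by rewrite -trmx_mul -map_mxM UT map_scalar_mx tr_scalar_mx.
  rewrite -!mulmxA (mulmxA _^T _^T) TtU mul_scalar_mx -!scalemxAr.
  rewrite (mulmxA (diag_mx d)) DD mul1mx -map_mxM TU map_scalar_mx scalerA.
  by rewrite scale_scalar_mx; congr _%:M; field.
have qAi z : expR (- (pi * t^-1 * qform Ai z)) =
    \prod_i gauss (q.+2%:R ^+ 2 * (t * d 0 i))^-1 ((z *m U^T) 0 i).
  rewrite /gauss -expR_sum; congr expR; rewrite sumrN; congr (- _).
  rewrite /qform AiE -scalemxAr -scalemxAl !mulmxA mxE !map_trmx -map_mxM.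
  rewrite -!mulmxA (_ : map_mx intr U *m _ = (map_mx intr (z *m U^T))^T); last first.
    by rewrite map_trmx trmx_mul trmxK map_mxM.
  rewrite mulmxA diag_form !mulr_sumr; apply: eq_bigr => i _.
  rewrite [(\row__ _) 0 i]mxE.
  have -> : (map_mx intr (z *m U^T)) 0 i = ((z *m U^T) 0 i)%:~R :> R by rewrite mxE.
  have di : d 0 i != 0 by rewrite gt_eqF.
  have t1 : t != 0 by rewrite gt_eqF.
  move: (((z *m U^T) 0 i)%:~R) => y.
  have e (p Q : R) : Q != 0 -> p * t^-1 * (Q ^- 2 * ((d 0 i)^-1 * y ^+ 2)) =
    p * (Q ^+ 2 * (t * d 0 i))^-1 * y ^+ 2 by move=> Q1; field; rewrite di t1 Q1.
  exact: e.
split.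
  rewrite (_ : _ * S = \sum_(r | annihilates r (zmod_mx q U)) \prod_i
    residue_sum (gauss (t * d 0 i)) (r i)).
    rewrite (_ : (fun J : nat => _) = fun J =>
      \sum_(r | annihilates r (zmod_mx q U)) \prod_i
      bisum (fun j => gauss (t * d 0 i) (q.+2%:Z * j + (r i)%:Z)) J); last first.
      apply/funext => J; rewrite -(sum_box J (fun i => gauss (t * d 0 i)) UT).
      by apply: eq_bigr => z _.
    apply: cvgn_sum => r _; apply: cvgn_prod => i _.
    exact: (is_cvg_residue (gauss_itv (td i)) (fun k => gauss_bound k (td i))).
  have := finite_poisson WT WTd (fun i h => TR _ q h (td i)).
  rewrite -/Hs => FP; apply/esym.
  have Hs0 : (#|Hs|%:R : R) != 0.
    rewrite pnatr_eq0 -lt0n; apply/card_gt0P; exists [ffun=> 0].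
    rewrite inE; apply/forallP => j /=.
    by rewrite big1// => i _; rewrite ffunE mul0r.
  apply: (mulfI Hs0); rewrite -[LHS]FP /K -!mulrA mulVKf//.
  rewrite /S !mulr_sumr; apply: eq_bigr => h _.
  rewrite big_split /= mulrA; congr (_ * _).
  rewrite -[X in _ ^+ X](card_ord n) -prodr_const -prodfV -big_split /=.
  by apply: eq_bigr => i _; rewrite sqrtrM ?(ltW t0)// invfM; ring.
rewrite (_ : (fun J : nat => _) = fun J =>
  \sum_(r | annihilates r (zmod_mx q T^T)) \prod_i
  bisum (fun j => gauss (q.+2%:R ^+ 2 * (t * d 0 i))^-1
    (q.+2%:Z * j + (r i)%:Z)) J); last first.
  apply/funext => J.
  rewrite -(sum_box J (fun i => gauss (q.+2%:R ^+ 2 * (t * d 0 i))^-1) TUt).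
  by apply: eq_bigr => z _.
apply: cvgn_sum => r _; apply: cvgn_prod => i _.
have td' : 0 < (q.+2%:R ^+ 2 * (t * d 0 i))^-1.
  by rewrite invr_gt0 mulr_gt0// exprn_gt0// ltr0n.
exact: (is_cvg_residue (gauss_itv td') (fun k => gauss_bound k td')).
Qed.

Local Close Scope complex_scope.

(** * Spherical designs *)

Lemma dotE (R : realType) n (x y : 'rV[R]_n) : dot x y = \sum_i x 0 i * y 0 i.
Proof. by rewrite /dot mxE; apply: eq_bigr => i _; rewrite mxE. Qed.

Lemma dotC (R : realType) n (x y : 'rV[R]_n) : dot x y = dot y x.
Proof. by rewrite !dotE; apply: eq_bigr => i _; rewrite mulrC. Qed.

Lemma dotDl (R : realType) n (x y z : 'rV[R]_n) : dot (x + y) z = dot x z + dot y z.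
Proof. by rewrite /dot mulmxDl mxE. Qed.

Lemma dotNl (R : realType) n (x z : 'rV[R]_n) : dot (- x) z = - dot x z.
Proof. by rewrite /dot mulNmx mxE. Qed.

Lemma dotZl (R : realType) n c (x z : 'rV[R]_n) : dot (c *: x) z = c * dot x z.
Proof. by rewrite /dot -scalemxAl mxE. Qed.

Lemma dotBl (R : realType) n (x y z : 'rV[R]_n) : dot (x - y) z = dot x z - dot y z.
Proof. by rewrite dotDl dotNl. Qed.

Lemma dotDr (R : realType) n (x y z : 'rV[R]_n) : dot z (x + y) = dot z x + dot z y.
Proof. by rewrite dotC dotDl !(dotC z). Qed.

Lemma dotNr (R : realType) n (x z : 'rV[R]_n) : dot z (- x) = - dot z x.
Proof. by rewrite dotC dotNl dotC. Qed.

Lemma dotBr (R : realType) n (x y z : 'rV[R]_n) : dot z (x - y) = dot z x - dot z y.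
Proof. by rewrite dotDr dotNr. Qed.

Lemma dotZr (R : realType) n c (x z : 'rV[R]_n) : dot z (c *: x) = c * dot z x.
Proof. by rewrite dotC dotZl dotC. Qed.

Lemma dot_ge0 (R : realType) n (x : 'rV[R]_n) : 0 <= dot x x.
Proof. by rewrite dotE sumr_ge0// => i _; rewrite -expr2 sqr_ge0. Qed.

Lemma dot_eq0 (R : realType) n (x : 'rV[R]_n) : (dot x x == 0) = (x == 0).
Proof.
apply/idP/eqP => [|->]; last by rewrite /dot mul0mx mxE.
rewrite dotE psumr_eq0 => [|i _]; last by rewrite -expr2 sqr_ge0.
move/allP => H; apply/rowP => i; rewrite mxE.
by have := H i (mem_index_enum _); rewrite /= -expr2 sqrf_eq0 => /eqP.
Qed.

Lemma dot_gt0 (R : realType) n (x : 'rV[R]_n) : (0 < dot x x) = (x != 0).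
Proof. by rewrite lt_def dot_ge0 andbT dot_eq0. Qed.

(* By the reflection exchanging [a] and [b]. *)
Lemma orthogonal_transitive (R : realType) n (a b : 'rV[R]_n) :
  dot a a = dot b b -> exists2 Q : 'M[R]_n, Q *m Q^T = 1%:M & b *m Q^T = a.
Proof.
move=> ab; have [->|anb] := eqVneq a b.
  by exists 1%:M; rewrite trmx1 mulmx1.
pose v := a - b; have v0 : dot v v != 0 by rewrite dot_eq0 subr_eq0.
pose c := 2 / dot v v; pose Q := 1%:M - c *: (v^T *m v).
have QT : Q^T = Q by rewrite /Q linearB linearZ /= trmx1 trmx_mul trmxK.
have Qx (x : 'rV_n) : x *m Q = x - (c * dot x v) *: v.
  rewrite mulmxBr mulmx1 -scalemxAr mulmxA (mx11_scalar (x *m v^T)).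
  by rewrite mul_scalar_mx scalerA.
exists Q; rewrite QT.
  rewrite {2}/Q mulmxBr mulmx1 -scalemxAr mulmxA.
  have -> : Q *m v^T = - v^T.
    rewrite -[LHS]trmxK trmx_mul trmxK QT Qx /c divfK// linearB linearZ /=.
    by rewrite -{1}[v^T]scale1r -scalerBl (_ : 1 - 2 = -1) ?scaleN1r//; ring.
  by rewrite mulNmx scalerN opprK /Q subrK.
rewrite Qx; have -> : c * dot b v = -1.
  have E : dot v v = - (2 * dot b v).
    by rewrite /v dotBl !dotBr ab (dotC b a); ring.
  by rewrite /c; move: v0; rewrite E => v0; field; move: v0; rewrite oppr_eq0 mulf_eq0 pnatr_eq0.
by rewrite scaleN1r opprK /v addrC subrK.
Qed.

Lemma continuous_sumr (R : realType) (T : topologicalType) (I : Type) (r : seq I)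
    (f : I -> T -> R) :
  (forall i, continuous (f i)) -> continuous (fun x => \sum_(i <- r) f i x).
Proof.
move=> fc; elim: r => [|i r IH] x.
  by under eq_fun do rewrite big_nil; exact: cvg_cst.
under eq_fun do rewrite big_cons.
by apply: cvgD; [exact: fc|exact: IH].
Qed.

Lemma continuous_mulmx_coord (R : realType) m n p (Q : 'M[R]_(n, p)) i j :
  continuous (fun x : 'M[R]_(m, n) => (x *m Q) i j).
Proof.
rewrite (_ : (fun x => _) = fun x : 'M[R]_(m, n) => \sum_k x i k * Q k j).
  apply: continuous_sumr => k x; apply: (@continuousM _ _ (fun x : 'M[R]_(m, n) => x i k) (fun=> Q k j)); [exact: coord_continuous|exact: cst_continuous].
by apply/funext => x; rewrite mxE.
Qed.

Lemma continuous_mulmx (R : realType) m n p (Q : 'M[R]_(n, p)) :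
  continuous (fun x : 'M[R]_(m, n) => x *m Q).
Proof.
move=> x; have FF : Filter (nbhs x) := nbhs_filter x.
apply/(@cvg_ballP _ _ _ (nbhs x) FF) => e e0.
suff H : \forall y \near nbhs x, forall i j, ball ((x *m Q) i j) e ((y *m Q) i j).
  by apply: filterS H => y Hy; split.
apply: (@filter_forall _ _ (fun i y => forall j, ball ((x *m Q) i j) e ((y *m Q) i j)) _ FF) => i.
apply: (@filter_forall _ _ (fun j y => ball ((x *m Q) i j) e ((y *m Q) i j)) _ FF) => j.
exact: (cvg_ball (@continuous_mulmx_coord R m n p Q i j x) e0).
Qed.

Lemma measurable_mulmx (R : realType) n (Q : 'M[R]_n) :
  measurable_fun setT (fun x : borel_rV R n => (x : 'rV[R]_n) *m Q : borel_rV R n).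
Proof.
have mE : @measurable _ (borel_rV R n) = <<s @open 'rV[R]_n >> by [].
have H := @measurability _ _ (borel_rV R n) (borel_rV R n) setT
  (fun x : 'rV[R]_n => x *m Q) _ mE.
apply: H => _ [A oA <-].
rewrite setTI; apply: sub_sigma_algebra.
by move: oA; apply: open_comp => x _; exact: continuous_mulmx.
Qed.

Lemma measurable_dot (R : realType) n (a : 'rV[R]_n) :
  measurable_fun setT (fun x : borel_rV R n => dot (x : 'rV[R]_n) a).
Proof.
have mE := RGenOInfty.measurableE R.
have H := @measurability _ _ (borel_rV R n) _ setT
  (fun x : 'rV[R]_n => dot x a) _ mE.
apply: H => _ [A [c ->] <-].
rewrite setTI; apply: sub_sigma_algebra.
have : open `]c, +oo[%classic by exact: interval_open.
apply: open_comp => x _; exact: continuous_mulmx_coord.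
Qed.

(** For even [k] the integrand is nonnegative, so the change of variables for nonnegative measurable
    functions applies. *)
Lemma integral_dotX_rotation (R : realType) n (m : R) (sigma : probability (borel_rV R n) R)
    (k : nat) (a b : 'rV[R]_n) :
  is_uniform_on_sphere m sigma -> ~~ odd k -> dot a a = dot b b ->
  (\int[sigma]_x ((dot x a) ^+ k)%:E = \int[sigma]_x ((dot x b) ^+ k)%:E)%E.
Proof.
move=> [_ inv] k2 ab; have [Q QQ bQ] := orthogonal_transitive ab.
have mQ := measurable_mulmx Q.
have mf (c : 'rV[R]_n) : measurable_fun setT
    (EFin \o (fun x : borel_rV R n => (dot (x : 'rV[R]_n) c) ^+ k)).
  apply/measurable_EFinP; apply: measurable_funX; exact: measurable_dot.
have := @ge0_integral_pushforward _ _ (borel_rV R n) (borel_rV R n) R _ mQ sigma setT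
  (EFin \o (fun x : borel_rV R n => (dot (x : 'rV[R]_n) b) ^+ k)).
rewrite preimage_setT => H.
rewrite (_ : (\int[sigma]_x ((dot x a) ^+ k)%:E)%E =
   (\int[sigma]_x ((dot (x *m Q) b) ^+ k)%:E)%E); last first.
  apply: eq_integral => x _; congr (_ ^+ _)%:E.
  by rewrite /dot -bQ trmx_mul trmxK mulmxA.
pose mu := measure_function_pushforward__canonical__measure_function_Measure sigma mQ.
rewrite -[LHS]H//; last by move=> x _; rewrite lee_fin exprn_even_ge0.
exact: (@eq_measure_integral _ _ _ setT sigma mu (EFin \o _) (fun A mA _ => inv Q QQ A mA)).
Qed.

Definition linear_mpoly (R : realType) n (a : 'rV[R]_n) : mpoly.mpoly n R :=
  \sum_i a 0 i *: mpoly.mpolyX R (mpoly.mnm1 i).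

Lemma poly_eval_linear (R : realType) n (a x : 'rV[R]_n) k :
  poly_eval (linear_mpoly a ^+ k) x = dot x a ^+ k.
Proof.
rewrite /poly_eval rmorphXn /=; congr (_ ^+ _).
rewrite /linear_mpoly raddf_sum dotE; apply: eq_bigr => i _ /=.
by rewrite mpoly.mevalZ mpoly.mevalXU mulrC.
Qed.

Lemma msize_linear (R : realType) n (a : 'rV[R]_n) k :
  (mpoly.msize (linear_mpoly a ^+ k) <= k.+1)%N.
Proof.
have l2 : (mpoly.msize (linear_mpoly a) <= 2)%N.
  apply: (leq_trans (mpoly.msize_sum _ _ _)); apply/bigmax_leqP_seq => i _ _.
  by apply: (leq_trans (mpoly.msizeZ_le _ _)); rewrite mpoly.msizeX mpoly.mdeg1.
have [->|l0] := eqVneq (linear_mpoly a) 0.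
  by case: k => [|k]; rewrite ?expr0 ?mpoly.msize1// expr0n mpoly.msize0.
elim: k => [|k IH]; first by rewrite expr0 mpoly.msize1.
rewrite exprS mpoly.msizeM ?expf_neq0//.
by rewrite -subn1 leq_subLR; exact: leq_add l2 IH.
Qed.

Lemma design_moment_rotation (R : realType) n (m : R) (X : set 'rV[R]_n) k (a b : 'rV[R]_n) :
  spherical_design 4 m X -> (k <= 4)%N -> ~~ odd k -> dot a a = dot b b ->
  \sum_(x <- fset_set X) dot x a ^+ k = \sum_(x <- fset_set X) dot x b ^+ k.
Proof.
move=> [fX X0 _ [sigma us H]] k4 ko ab.
have E c : (\int[sigma]_x ((dot x c) ^+ k)%:E =
    (#|` fset_set X|%:R^-1 * \sum_(x <- fset_set X) dot x c ^+ k)%:E)%E.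
  have := H (linear_mpoly c ^+ k) (leq_trans (msize_linear c k) _).
  rewrite ltnS => /(_ k4); rewrite fsbig_finite//=.
  under eq_integral do rewrite poly_eval_linear.
  by move=> ->; under eq_bigr do rewrite poly_eval_linear.
have := integral_dotX_rotation us ko ab; rewrite !E => -[]; apply: mulfI.
rewrite invr_eq0 pnatr_eq0 cardfs_eq0; apply/eqP => F0.
have [x Xx] := X0; have : x \in fset_set X by rewrite in_fset_set//; exact: mem_set.
by rewrite F0 in_fset0.
Qed.

(** The moments of the sphere are not integrated: rotation invariance gives the dependence on [a],
    up to one constant for each degree, and the constants follow from [sum_i x_i^2 = m] on [X]. *)
Lemma design_seq (R : realType) n (m : R) (X : set 'rV[R]_n) :
  (0 < n)%N -> spherical_design 4 m X ->
  exists s : seq 'rV[R]_n, [/\ uniq s, s != [::], (forall x, x \in s <-> X x) &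
    forall a, \sum_(x <- s) dot x a ^+ 2 = (size s)%:R * m / n%:R * dot a a /\
      \sum_(x <- s) dot x a ^+ 4 =
        3 * (size s)%:R * m ^+ 2 / (n%:R * (n%:R + 2)) * dot a a ^+ 2].
Proof.
move=> n0 D; have [fX X0 sX _] := D.
exists (fset_set X); set s := (fset_set X : seq _).
have sE x : x \in s <-> X x.
  by rewrite /s in_fset_set//; split => [/set_mem|/mem_set].
have us : uniq s by exact: fset_uniq.
have s0 : s != [::].
  by have [x /sE] := X0; case: (s).
split=> // a.
have n0' : (n%:R : R) != 0 by rewrite pnatr_eq0; lia.
have nn : (n%:R + 2 : R) != 0 by rewrite -natrD pnatr_eq0; lia.
pose e (i : 'I_n) : 'rV[R]_n := delta_mx 0 i.
have de x i : dot x (e i) = x 0 i.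
  rewrite dotE (bigD1 i)//= big1 ?addr0 ?mxE ?eqxx ?mulr1// => j ji.
  by rewrite mxE (negPf ji) andbF mulr0.
have dee i j : dot (e i) (e j) = (i == j)%:R by rewrite de mxE eqxx eq_sym.
pose i0 : 'I_n := Ordinal n0.
have rot k b : (k <= 4)%N -> ~~ odd k ->
    \sum_(x <- s) dot x b ^+ k = Num.sqrt (dot b b) ^+ k * \sum_(x <- s) x 0 i0 ^+ k.
  move=> k4 ko; rewrite (design_moment_rotation (b := Num.sqrt (dot b b) *: e i0) D)//.
    by rewrite mulr_sumr; apply: eq_bigr => x _; rewrite dotZr de exprMn.
  by rewrite dotZl dotZr dee eqxx mulr1 -expr2 sqr_sqrtr ?dot_ge0.
have rotE k i : (k <= 4)%N -> ~~ odd k ->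
    \sum_(x <- s) x 0 i ^+ k = \sum_(x <- s) x 0 i0 ^+ k.
  move=> k4 ko; under eq_bigr do rewrite -de; under [RHS]eq_bigr do rewrite -de.
  by rewrite (design_moment_rotation (b := e i0) D)// !dee !eqxx.
have xx x : x \in s -> \sum_i x 0 i ^+ 2 = m.
  move/sE/sX; rewrite /sphere /= dotE => <-.
  by apply: eq_bigr => i _; rewrite expr2.
have sm (c : R) : \sum_(x <- s) c = (size s)%:R * c.
  by rewrite big_const_seq count_predT iter_addr addr0 mulr_natl.
split.
  rewrite rot// sqr_sqrtr ?dot_ge0// mulrC; congr (_ * _).
  apply: (mulfI n0'); rewrite [RHS]mulrC divfK//.
  transitivity (\sum_(i < n) \sum_(x <- s) x 0 i ^+ 2).
    rewrite [RHS](eq_bigr (fun=> \sum_(x <- s) x 0 i0 ^+ 2)); last by move=> i _; exact: rotE.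
    by rewrite sumr_const card_ord mulr_natl.
  by rewrite exchange_big /= (eq_big_seq _ xx) sm.
set kap := \sum_(x <- s) x 0 i0 ^+ 4.
(* Both [e i + e j] and [e i - e j] have norm 2, so each has fourth moment [4 kap]; adding the two
   gives [8 kap = 4 kap + 12 * (mixed moment)]. *)
have offd i j : i != j -> \sum_(x <- s) x 0 i ^+ 2 * x 0 j ^+ 2 = kap / 3.
  move=> ij.
  have dp (c : R) : c ^+ 2 = 1 -> dot (e i + c *: e j) (e i + c *: e j) = 2.
    move=> c2; rewrite !dotDl !dotDr !dotZl !dotZr !dee !eqxx (negPf ij) eq_sym (negPf ij).
    by rewrite !mulr0 addr0 add0r !mulr1 -expr2 c2.
  have s4 : Num.sqrt (2 : R) ^+ 4 = 4.
    by rewrite -[4%N]/(2 * 2)%N exprM sqr_sqrtr// expr2; ring.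
  have Ep (c : R) : c ^+ 2 = 1 -> \sum_(x <- s) (x 0 i + c * x 0 j) ^+ 4 = 4 * kap.
    move=> c2; have := rot 4%N (e i + c *: e j) isT isT; rewrite dp// s4 => <-.
    by apply: eq_bigr => x _; rewrite dotDr dotZr !de.
  have E1 := Ep 1 (expr1n _ _); have E2 := Ep (-1) (sqrr_sign _ 1).
  have : \sum_(x <- s) (x 0 i + 1 * x 0 j) ^+ 4 + \sum_(x <- s) (x 0 i + -1 * x 0 j) ^+ 4 =
     2 * \sum_(x <- s) x 0 i ^+ 4 + 2 * \sum_(x <- s) x 0 j ^+ 4 +
     12 * \sum_(x <- s) x 0 i ^+ 2 * x 0 j ^+ 2.
    rewrite !mulr_sumr -!big_split /=; apply: eq_bigr => x _; ring.
  rewrite E1 E2 !rotE// -/kap; lra.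
(* Sum the square of [sum_i x_i^2 = m] over the design. *)
have : (size s)%:R * m ^+ 2 = n%:R * (kap + (n%:R - 1) * (kap / 3)).
  transitivity (\sum_(i < n) \sum_(j < n) \sum_(x <- s) x 0 i ^+ 2 * x 0 j ^+ 2).
    under eq_bigr do rewrite exchange_big /=; rewrite exchange_big /= -sm.
    apply: eq_big_seq => x xs; rewrite expr2 -{1}(xx x xs) mulr_suml.
    by apply: eq_bigr => i _; rewrite -(xx x xs) mulr_sumr.
  rewrite (eq_bigr (fun=> kap + (n%:R - 1) * (kap / 3))).
    by rewrite sumr_const card_ord mulr_natl.
  move=> i _; rewrite (bigD1 i)//=; congr (_ + _).
    by rewrite /kap -(rotE 4%N i)//; apply: eq_bigr => x _; ring.
  rewrite (eq_bigr (fun=> kap / 3)); last by move=> j ji; rewrite offd// eq_sym.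
  rewrite sumr_const; rewrite (_ : #|_| = n.-1); last first.
    by rewrite cardC1 card_ord.
  by rewrite -[LHS]mulr_natl -subn1 natrB.
rewrite rot// -/kap.
have -> : Num.sqrt (dot a a) ^+ 4 = dot a a ^+ 2.
  by rewrite -[4%N]/(2 * 2)%N exprM sqr_sqrtr// dot_ge0.
move=> E; rewrite mulrC; congr (_ * _).
have -> : 3 * (size s)%:R * m ^+ 2 = 3 * ((size s)%:R * m ^+ 2) by ring.
by rewrite E; field; rewrite n0' nn.
Qed.

(** * The minimal vectors of a dual pair *)

(** The double sum is the squared norm of the sum of the third tensor powers of the vectors; the
    next lemma is the same with first powers. *)
Lemma sum_dot3_ge0 (R : realType) n (u : seq 'rV[R]_n) :
  0 <= \sum_(x <- u) \sum_(y <- u) dot x y ^+ 3.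
Proof.
rewrite (_ : \sum_(x <- u) _ =
    \sum_a \sum_b \sum_c (\sum_(x <- u) x 0 a * x 0 b * x 0 c) ^+ 2).
  by rewrite sumr_ge0// => a _; rewrite sumr_ge0// => b _; rewrite sumr_ge0// => c _; exact: sqr_ge0.
transitivity (\sum_(x <- u) \sum_(y <- u) \sum_a \sum_b \sum_c
   (x 0 a * x 0 b * x 0 c) * (y 0 a * y 0 b * y 0 c)).
  apply: eq_bigr => x _; apply: eq_bigr => y _.
  rewrite !exprS expr0 mulr1 dotE mulr_suml; apply: eq_bigr => a _.
  rewrite mulr_suml mulr_sumr; apply: eq_bigr => b _.
  rewrite !mulr_sumr; apply: eq_bigr => c _; ring.
under eq_bigr do rewrite exchange_big /=.
rewrite exchange_big /=; apply: eq_bigr => a _.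
under eq_bigr do rewrite exchange_big /=.
rewrite exchange_big /=; apply: eq_bigr => b _.
under eq_bigr do rewrite exchange_big /=.
rewrite exchange_big /=; apply: eq_bigr => c _.
rewrite expr2 mulr_suml; apply: eq_bigr => x _; by rewrite mulr_sumr.
Qed.

Lemma sum_dot_ge0 (R : realType) n (u : seq 'rV[R]_n) :
  0 <= \sum_(x <- u) \sum_(y <- u) dot x y.
Proof.
rewrite (_ : \sum_(x <- u) _ = \sum_a (\sum_(x <- u) x 0 a) ^+ 2).
  by rewrite sumr_ge0// => a _; exact: sqr_ge0.
under eq_bigr do under eq_bigr do rewrite dotE.
under eq_bigr do rewrite exchange_big /=.
rewrite exchange_big /=; apply: eq_bigr => a _.
by rewrite expr2 mulr_suml; apply: eq_bigr => x _; rewrite mulr_sumr.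
Qed.

(* Cauchy-Schwarz for the Frobenius product of [\sum_x x^T x] with the
   projection onto the hyperplane orthogonal to [al]. *)
Lemma sum_dot2_ge (R : realType) n (u : seq 'rV[R]_n.+2) (al : 'rV[R]_n.+2) :
  al != 0 -> (forall x, x \in u -> dot x x = 1) -> (forall x, x \in u -> dot x al = 0) ->
  (size u)%:R ^+ 2 / n.+1%:R <= \sum_(x <- u) \sum_(y <- u) dot x y ^+ 2.
Proof.
move=> al0 u1 ual.
pose N : R := (size u)%:R.
pose P (a b : 'I_n.+2) : R := (a == b)%:R - al 0 a * al 0 b / dot al al.
pose M a b := \sum_(x <- u) x 0 a * x 0 b.
have A0 : dot al al != 0 by rewrite dot_eq0.
have n0 : (n.+1%:R : R) != 0 by rewrite pnatr_eq0.
have sumM : \sum_(x <- u) \sum_(y <- u) dot x y ^+ 2 = \sum_a \sum_b M a b ^+ 2.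
  transitivity (\sum_(x <- u) \sum_(y <- u) \sum_a \sum_b
     (x 0 a * x 0 b) * (y 0 a * y 0 b)).
    apply: eq_bigr => x _; apply: eq_bigr => y _.
    rewrite expr2 dotE mulr_suml; apply: eq_bigr => a _.
    rewrite mulr_sumr; apply: eq_bigr => b _; ring.
  under eq_bigr do rewrite exchange_big /=.
  rewrite exchange_big /=; apply: eq_bigr => a _.
  under eq_bigr do rewrite exchange_big /=.
  rewrite exchange_big /=; apply: eq_bigr => b _.
  by rewrite expr2 mulr_suml; apply: eq_bigr => x _; rewrite mulr_sumr.
have dl (F : 'I_n.+2 -> 'I_n.+2 -> R) : \sum_a \sum_b F a b * (a == b)%:R = \sum_a F a a.
  apply: eq_bigr => a _; rewrite (bigD1 a)//= eqxx mulr1 big1 ?addr0// => b ba.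
  by rewrite eq_sym (negPf ba) mulr0.
have MP : \sum_a \sum_b M a b * P a b = N.
  transitivity (\sum_(x <- u) \sum_a \sum_b x 0 a * x 0 b * P a b).
    rewrite [RHS]exchange_big /=; apply: eq_bigr => a _.
    rewrite [RHS]exchange_big /=; apply: eq_bigr => b _.
    by rewrite mulr_suml.
  rewrite (eq_big_seq (fun=> 1)); last first.
    move=> x xu; transitivity (\sum_a \sum_b (x 0 a * x 0 b * (a == b)%:R) -
        (\sum_a \sum_b (x 0 a * al 0 a) * (x 0 b * al 0 b)) / dot al al).
      rewrite mulr_suml -sumrB; apply: eq_bigr => a _.
      rewrite mulr_suml -sumrB; apply: eq_bigr => b _; rewrite /P; field.
      exact: A0.
    rewrite (dl (fun a b => x 0 a * x 0 b)) -dotE u1//.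
    under eq_bigr do rewrite -mulr_sumr -dotE ual// mulr0.
    by rewrite big1_eq mul0r subr0.
  by rewrite big_const_seq count_predT iter_addr addr0.
have PP : \sum_a \sum_b P a b ^+ 2 = n.+1%:R.
  transitivity (\sum_(a < n.+2) \sum_(b < n.+2) (1 * (a == b)%:R) -
      2 / dot al al * (\sum_a \sum_b (al 0 a * al 0 b) * (a == b)%:R) +
      (dot al al ^+ 2)^-1 * (\sum_a \sum_b (al 0 a * al 0 a) * (al 0 b * al 0 b))).
    rewrite !mulr_sumr -sumrB -big_split /=; apply: eq_bigr => a _.
    rewrite !mulr_sumr -sumrB -big_split /=; apply: eq_bigr => b _.
    rewrite /P; case: (a == b); rewrite /=; field; exact: A0.
  rewrite (dl (fun=> fun=> 1)) (dl (fun a b => al 0 a * al 0 b)) sumr_const card_ord -dotE.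
  under [X in _ + _ * X]eq_bigr do rewrite -mulr_sumr -dotE.
  rewrite -mulr_suml -dotE -expr2 mulVf ?sqrf_eq0// divfK//.
  rewrite -[n.+2]addn2 -[n.+1]addn1 !natrD; ring.
rewrite sumM.
have : 0 <= \sum_a \sum_b (M a b - N / n.+1%:R * P a b) ^+ 2.
  by rewrite sumr_ge0// => a _; rewrite sumr_ge0// => b _; exact: sqr_ge0.
rewrite (_ : \sum_a _ = \sum_a \sum_b M a b ^+ 2 - 2 * (N / n.+1%:R) * (\sum_a \sum_b M a b * P a b)
   + (N / n.+1%:R) ^+ 2 * \sum_a \sum_b P a b ^+ 2).
  rewrite MP PP => H; rewrite -subr_ge0; apply: le_trans H _.
  rewrite le_eqVlt; apply/orP; left; apply/eqP; rewrite -/N.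
  by move: n0; move: (n.+1%:R : R) => q q0; field.
rewrite !mulr_sumr -sumrB -big_split /=; apply: eq_bigr => a _.
rewrite !mulr_sumr -sumrB -big_split /=; apply: eq_bigr => b _; ring.
Qed.

(* Delsarte's bound with the kernel [(t - 1/10) (t + 9/20) ^ 2]. *)
Lemma code_bound (R : realType) (u : seq 'rV[R]_16) (al : 'rV[R]_16) :
  al != 0 -> uniq u -> (forall x, x \in u -> dot x x = 1) ->
  (forall x, x \in u -> dot x al = 0) ->
  (forall x y, x \in u -> y \in u -> x != y -> dot x y <= 10^-1) ->
  (size u <= 57)%N.
Proof.
move=> al0 uu u1 ual uxy.
pose N : R := (size u)%:R.
pose f (t : R) := (t - 10^-1) * (t + 9 / 20) ^+ 2.
have f1 : f 1 = (7569 / 4000) by rewrite /f; field.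
have fle : \sum_(x <- u) \sum_(y <- u) f (dot x y) <= N * (7569 / 4000).
  rewrite (_ : N * _ = \sum_(x <- u) (7569 / 4000)); last first.
    by rewrite big_const_seq count_predT iter_addr addr0 -[RHS]mulr_natl.
  rewrite big_seq [leRHS]big_seq; apply: ler_sum => x xu.
  rewrite (bigD1_seq x)//= u1// f1 gerDl big_seq_cond sumr_le0// => y /andP[yu yx].
  rewrite /f mulr_le0_ge0 ?sqr_ge0// subr_le0 uxy// eq_sym//.
have := sum_dot3_ge0 u; have := sum_dot_ge0 u; have := sum_dot2_ge al0 u1 ual.
move: fle.
have -> : \sum_(x <- u) \sum_(y <- u) f (dot x y) =
   \sum_(x <- u) \sum_(y <- u) dot x y ^+ 3 + 4 / 5 * \sum_(x <- u) \sum_(y <- u) dot x y ^+ 2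
   + 9 / 80 * \sum_(x <- u) \sum_(y <- u) dot x y - 81 / 4000 * N ^+ 2.
  rewrite (_ : N ^+ 2 = \sum_(x <- u) \sum_(y <- u) 1); last first.
    by rewrite !big_const_seq !count_predT !iter_addr !addr0 expr2 mulr_natr.
  rewrite !mulr_sumr -!big_split /= -sumrB; apply: eq_bigr => x _.
  rewrite !mulr_sumr -!big_split /= -sumrB; apply: eq_bigr => y _; by rewrite /f; field.
rewrite -/N.
set s1 := \sum_(x <- u) \sum_(y <- u) dot x y.
set s2 := \sum_(x <- u) \sum_(y <- u) dot x y ^+ 2.
set s3 := \sum_(x <- u) \sum_(y <- u) dot x y ^+ 3.
move=> H1 H2 H3 H4.
(* The odd powers contribute nonnegatively, the square at least [N^2 / 15]. Hence
   [N <= 22707 / 397 < 58]. *)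
have H : N ^+ 2 * (4 / 5 / 15 - 81 / 4000) <= N * (7569 / 4000) by lra.
case: (leqP (size u) 57) => // H5.
have N58 : 58 <= N by rewrite /N ler_nat.
have N2 : 58 * N <= N ^+ 2 by rewrite expr2 ler_wpM2r ?ler0n.
exfalso; lra.
Qed.

Lemma antipodal_sum (R : zmodType) (V : zmodType) (s : seq V) (F : V -> R) :
  uniq s -> (forall x, x \in s -> - x \in s) ->
  \sum_(x <- s) F (- x) = \sum_(x <- s) F x.
Proof.
move=> us sN; rewrite -(big_map -%R xpredT F); apply: perm_big.
have uN : uniq (map -%R s) by rewrite map_inj_uniq//; exact: oppr_inj.
apply: uniq_perm => //  x; apply/idP/idP => [/mapP[y ys ->]|xs]; first exact: sN.
by apply/mapP; exists (- x); rewrite ?opprK// sN.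
Qed.

Lemma antipodal_even_sum (R : realType) n (s : seq 'rV[R]_n) (b : 'rV[R]_n) (h : R -> R) :
  uniq s -> (forall x, x \in s -> - x \in s) -> (forall t, h (- t) = h t) -> h 0 = 0 ->
  \sum_(x <- s) h (dot x b) = 2 * \sum_(x <- s | 0 < dot x b) h (dot x b).
Proof.
move=> us sN hN h0.
rewrite (bigID (fun x => 0 < dot x b)) /= mulr_natl mulr2n; congr (_ + _).
rewrite (bigID (fun x => dot x b < 0)) /= [X in _ + X]big1 ?addr0; last first.
  by move=> x; rewrite -!leNgt => /andP[a1 a2]; rewrite (_ : dot x b = 0)//; apply/le_anti/andP.
rewrite (eq_bigl (fun x => dot x b < 0)); last first.
  by move=> x /=; case: (ltgtP (dot x b) 0).
rewrite !(big_mkcond (fun x => _ < _)) /= -[LHS]antipodal_sum//.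
by apply: eq_bigr => x _; rewrite dotNl hN oppr_lt0.
Qed.

(* [s] is Min L, [m] its norm, and [al] a minimal vector of the dual lattice. *)
Lemma design_size (R : realType) (s : seq 'rV[R]_16) (m : R) (al : 'rV[R]_16) :
  0 < m -> uniq s -> s != [::] -> (forall x, x \in s -> - x \in s) ->
  (forall x, x \in s -> dot x x = m) ->
  (forall x y, x \in s -> y \in s -> x != y -> dot x y <= m / 2) ->
  (forall a, \sum_(x <- s) dot x a ^+ 2 = (size s)%:R * m / 16 * dot a a /\
      \sum_(x <- s) dot x a ^+ 4 = 3 * (size s)%:R * m ^+ 2 / (16 * (16 + 2)) * dot a a ^+ 2) ->
  (forall x, x \in s -> dot x al \is a Num.int) -> m * dot al al = 9 ->
  exists2 k, (0 < k <= 19)%N & size s = (256 * k)%N.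
Proof.
move=> m0 us s0 sN sm sxy des sal mal.
have al0 : dot al al != 0 by apply/eqP => e; move: mal; rewrite e mulr0; lra.
have mn : m != 0 by rewrite gt_eqF.
have alE : dot al al = 9 / m by apply: (mulfI mn); rewrite mal; field.
pose c (i : nat) := count (fun x => dot x al == i%:R) s.
(* Cauchy-Schwarz with [m * dot al al = 9], read off from the distance of [x] to its projection on
   [al]. So the inner products with [al] are the integers from -3 to 3. *)
have dle x : x \in s -> `|dot x al| <= 3.
  move=> xs; rewrite -(@ler_pXn2r _ 2)// ?nnegrE// real_normK ?num_real//.
  have := dot_ge0 (x - (dot x al * m / 9) *: al).
  rewrite !dotBl !dotBr !dotZl !dotZr sm// (dotC al x) alE.
  rewrite (_ : _ - _ = m / 9 * (9 - dot x al ^+ 2)); last by field.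
  rewrite pmulr_rge0 ?divr_gt0// subr_ge0 => /le_trans; apply; lra.
have split4 (h : R -> R) : h 0 = 0 ->
    \sum_(x <- s | 0 < dot x al) h (dot x al) = (c 1%N)%:R * h 1 + (c 2)%:R * h 2 + (c 3)%:R * h 3.
  move=> h0.
  have cE i : (c i)%:R * h i%:R = \sum_(x <- s) (dot x al == i%:R)%:R * h i%:R.
    rewrite -mulr_suml; congr (_ * _); rewrite /c -sum1_count natr_sum big_mkcond /=.
    by apply: eq_bigr => x _; case: ifP.
  rewrite (cE 1%N) (cE 2%N) (cE 3%N) -!big_split big_mkcond /=.
  apply: eq_big_seq => x xs; have := dle _ xs; have /intrP[z ->] := sal _ xs.
  case: z => [z|z]; last first.
    move=> _; rewrite ifF; last by rewrite ltr0z.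
    have F i : ((Negz z)%:~R == i%:R :> R) = false.
      by rewrite lt_eqF// (@lt_le_trans _ _ 0)// ltrz0.
    by rewrite !F !mul0r !addr0.
  rewrite -pmulrn normr_nat ler_nat !eqr_nat.
  by case: z => [|[|[|[|z]]]]//= _; rewrite ?ltr0n ?ltxx ?mul0r ?mul1r ?addr0 ?add0r.
have [] := des al; rewrite alE.
rewrite (@antipodal_even_sum _ _ s al (fun t => t ^+ 2))//; last 2 first.
- by move=> t; rewrite sqrrN.
- by rewrite expr0n.
rewrite (@antipodal_even_sum _ _ s al (fun t => t ^+ 4))//; last 2 first.
- by move=> t; ring.
- by rewrite expr0n.
rewrite (split4 (fun t => t ^+ 2)) ?expr0n// (split4 (fun t => t ^+ 4)) ?expr0n//.
move=> E2 E4.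
(* Subtracting the second moment from the fourth eliminates [c 1] and leaves
   [24 (c 2 + 6 c 3) = 9 / 32 * size s]. *)
have E : (256 * (c 2 + 6 * c 3) = 3 * size s)%N.
  apply/eqP; rewrite -(eqr_nat R) !natrM natrD natrM; apply/eqP.
  have E2' : 2 * ((c 1%N)%:R * 1 ^+ 2 + (c 2)%:R * 2 ^+ 2 + (c 3)%:R * 3 ^+ 2) = 9 / 16 * (size s)%:R :> R.
    by rewrite E2; field.
  have E4' : 2 * ((c 1%N)%:R * 1 ^+ 4 + (c 2)%:R * 2 ^+ 4 + (c 3)%:R * 3 ^+ 4) = 27 / 32 * (size s)%:R :> R.
    by rewrite E4; field.
  lra.
have ks : (size s = 256 * ((c 2 + 6 * c 3) %/ 3) /\ (c 2 + 6 * c 3) %/ 3 * 3 = c 2 + 6 * c 3)%N.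
  have : (256 * (c 2 + 6 * c 3) = 3 * size s)%N by [].
  have := divn_eq (c 2 + 6 * c 3) 3; have := ltn_pmod (c 2 + 6 * c 3) (isT : 0 < 3)%N.
  lia.
have sz : (0 < size s)%N by case: (s) s0.
have [k3 k3' ->] : exists2 k, (k * 3 = c 2 + 6 * c 3)%N & size s = (256 * k)%N.
  by exists ((c 2 + 6 * c 3) %/ 3)%N; case: ks.
exists k3 => //.
have k0 : (0 < k3)%N by lia.
rewrite k0 /=.
have x3 x : x \in s -> dot x al = 3 -> x = (m / 3) *: al.
  move=> xs x3; apply/eqP; rewrite -subr_eq0 -dot_eq0; apply/eqP.
  rewrite !dotBl !dotBr !dotZl !dotZr sm// (dotC al x) alE x3; by field.
have c3 : (c 3 <= 1)%N.
  rewrite /c -size_filter; set u := [seq x <- s | dot x al == 3].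
  have uu : uniq u by exact: filter_uniq.
  case Eu : u uu => [|x [|y t]]// /andP[+ _].
  have : x \in u by rewrite Eu mem_head.
  have : y \in u by rewrite Eu !inE eqxx orbT.
  rewrite !mem_filter => /andP[/eqP yal ys] /andP[/eqP xal xs].
  by rewrite (x3 x)// (x3 y)// mem_head.
(* If some [x] has inner product 3, then [x = (m / 3) al], and a [y] with inner product 2 would
   satisfy [dot x y = 2 m / 3 > m / 2]. So [c 2 = 0], which makes [k = 2]. *)
have [c30|c30] := posnP (c 3); last first.
  suff : (c 2 = 0)%N by lia.
  move: c30; rewrite /c -has_count => /hasP[x xs /eqP xal].
  apply/eqP; rewrite -leqn0 leqNgt -has_count; apply/hasP => -[y ys /eqP yal].
  have xy : x != y by apply/eqP => e; move: xal; rewrite e yal => /eqP; rewrite eqr_nat.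
  have := sxy _ _ xs ys xy; rewrite (x3 x)// dotZl dotC yal; lra.
(* Now [c 2 = 3 k], and [57 = 3 * 19]. Projecting orthogonally to [al] lowers norms and inner
   products by [4 m / 9], so the cosines are at most [(m / 2 - 4 m / 9) / (5 m / 9) = 1 / 10]. *)
suff h : (c 2 <= 57)%N by rewrite -(leq_pmul2r (isT : 0 < 3)%N) k3' c30 muln0 addn0.
pose q := Num.sqrt (5 * m / 9).
have q0 : 0 < 5 * m / 9 by rewrite divr_gt0// mulr_gt0.
have qq : q^-1 * q^-1 = (5 * m / 9)^-1 by rewrite -invfM -expr2 sqr_sqrtr// ltW.
pose v x : 'rV[R]_16 := q^-1 *: (x - (2 * m / 9) *: al).
have vv x y : dot x al = 2 -> dot y al = 2 -> dot (v x) (v y) = (dot x y - 4 * m / 9) / (5 * m / 9).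
  move=> xal yal; rewrite /v dotZl dotZr mulrA qq mulrC; congr (_ / _).
  rewrite !dotBl !dotBr !dotZl !dotZr (dotC al y) alE xal yal; by field.
have vi : injective v.
  move=> x y; rewrite /v => /scalerI; rewrite invr_eq0 sqrtr_eq0 -ltNge q0 => /(_ isT).
  exact: addIr.
rewrite /c -size_filter -(size_map v).
apply: (@code_bound _ _ al).
- by rewrite -dot_eq0.
- by rewrite map_inj_uniq// filter_uniq.
- move=> _ /mapP[x + ->]; rewrite mem_filter => /andP[/eqP xal xs].
  by rewrite vv// sm//; field.
- move=> _ /mapP[x + ->]; rewrite mem_filter => /andP[/eqP xal xs].
  by rewrite /v dotZl dotBl dotZl xal alE; apply/eqP; rewrite mulf_eq0; apply/orP; right; apply/eqP; field.
- move=> _ _ /mapP[x + ->] /mapP[y + ->]; rewrite !mem_filter => /andP[/eqP xal xs] /andP[/eqP yal ys] xy.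
  rewrite vv// ler_pdivrMr//.
  have xy' : x != y by apply: contra_neq xy => ->.
  have := sxy _ _ xs ys xy'; lra.
Qed.

Lemma expn4_sub_expn2 (n : nat) : exists w, (n ^ 4 = n ^ 2 + 12 * w)%N.
Proof.
have S6 k : exists v, (k * k.+1 * (2 * k + 1) = 6 * v)%N.
  elim: k => [|k [v IH]]; first by exists 0%N.
  by exists (v + k.+1 ^ 2)%N; rewrite [RHS]mulnDr -IH; ring.
elim: n => [|n [w IH]]; first by exists 0%N.
have [v vE] := S6 n; exists (w + v)%N.
have -> : (n.+1 ^ 4 = n ^ 4 + 2 * (n * n.+1 * (2 * n + 1)) + 2 * n + 1)%N by ring.
rewrite IH vE; ring.
Qed.

(** For [r = p / q] in lowest terms the hypothesis reads [k p (p - 2 q) = w q^2], and [q] is prime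
    to both [p] and [p - 2 q]. *)
Lemma sqr_denq_dvdn (r : rat) (k : nat) (w : int) :
  k%:R * r * (r - 2) = w%:~R -> (`|denq r|%N ^ 2 %| k)%N.
Proof.
move=> E; pose p := numq r; pose q := denq r.
have qn : q%:~R != 0 :> rat by rewrite intr_eq0 denq_neq0.
have E' : k%:Z * (p * (p - 2 * q)) = w * q ^+ 2.
  apply/eqP; rewrite -(eqr_int rat) expr2 !(intrM, rmorphB) /=; apply/eqP.
  rewrite -E -{1 2}(divq_num_den r) -/p -/q.
  by field.
have cp : coprimez (q ^+ 2) (p * (p - 2 * q)).
  have c1 : coprimez q p by rewrite coprimez_sym /coprimez /gcdz eqz_nat; exact: coprime_num_den.
  rewrite coprimezXl// coprimezMr c1 /=.
  by rewrite /coprimez (_ : p - _ = (- 2) * q + p) ?gcdzMDl//; ring.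
have : (q ^+ 2 %| k%:Z)%Z by rewrite -(Gauss_dvdzl _ cp) E' dvdz_mull.
by rewrite /dvdz abszX.
Qed.

Lemma dual_norm (R : realType) (s : seq 'rV[R]_16) (m : R) (b : 'rV[R]_16) (k : nat) :
  uniq s -> (forall x, x \in s -> - x \in s) ->
  (forall a, \sum_(x <- s) dot x a ^+ 2 = (size s)%:R * m / 16 * dot a a /\
      \sum_(x <- s) dot x a ^+ 4 = 3 * (size s)%:R * m ^+ 2 / (16 * (16 + 2)) * dot a a ^+ 2) ->
  (0 < k <= 19)%N -> size s = (256 * k)%N -> 0 <= m ->
  (forall x, x \in s -> dot x b \is a Num.int) ->
  exists r : rat, exists p : nat, m * dot b b / 3 = ratr r /\
    (ratr r = p%:R / 3 :> R \/ ratr r = p%:R / 4 :> R).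
Proof.
move=> us sN des /andP[k0 k19] sk m0 sb.
set c := m * dot b b / 3.
have c0 : 0 <= c by rewrite divr_ge0// mulr_ge0// dot_ge0.
have [E2 E4] := des b.
have E2' : \sum_(x <- s) dot x b ^+ 2 = 48 * k%:R * c by rewrite E2 sk natrM /c; field.
have E4' : \sum_(x <- s) dot x b ^+ 4 = 24 * k%:R * c ^+ 2 by rewrite E4 sk natrM /c; field.
have /intrP[N NE] : \sum_(x <- s) dot x b ^+ 2 \is a Num.int.
  by rewrite big_seq rpred_sum// => x xs; rewrite rpredX// sb.
have k0' : (k%:R : R) != 0 by rewrite pnatr_eq0 -lt0n.
pose r : rat := N%:~R / (48 * k%:R).
have rE : ratr r = c.
  rewrite /r fmorph_div rmorphM /= !ratr_nat ratr_int -NE E2'; by field.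
clearbody r.
(* Each [t^4 - t^2] is a multiple of 12 and antipodal vectors contribute equally, whence the 24. By
   the two moments the sum is also [24 k c (c - 2)]. *)
have [W WE] : exists W : int, \sum_(x <- s) (dot x b ^+ 4 - dot x b ^+ 2) = 24 * W%:~R.
  rewrite (@antipodal_even_sum _ _ s b (fun t => t ^+ 4 - t ^+ 2))//; last 2 first.
  - by move=> t; ring.
  - by rewrite !expr0n subr0.
  have : \sum_(x <- s | 0 < dot x b) (dot x b ^+ 4 - dot x b ^+ 2) / 12 \is a Num.int.
    rewrite big_seq_cond rpred_sum// => x /andP[xs x0].
    have /intrP[z zE] := sb _ xs; move: x0; rewrite zE ltr0z; case: z zE => // n zE _.
    have [w wE] := expn4_sub_expn2 n.
    by rewrite -pmulrn -!natrX wE natrD addrAC subrr add0r natrM mulrC mulKf ?pnatr_eq0// natr_int.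
  rewrite -mulr_suml => /intrP[W WE]; exists W; rewrite -WE; by field.
have kr : k%:R * r * (r - 2) = W%:~R.
  apply: (fmorph_inj (@ratr R)); rewrite !rmorphM rmorphB /= ratr_int !ratr_nat rE.
  move: WE; rewrite sumrB E2' E4' => WE.
  by apply: (mulfI (_ : 24 != 0 :> R)); rewrite ?pnatr_eq0// -WE; ring.
have dk := dvdn_leq k0 (sqr_denq_dvdn kr).
have r0 : 0 <= r by rewrite -(ler0q R) rE.
(* Because [k <= 19 < 25]. Denominators 1 and 3 then give thirds, 2 and 4 give quarters. *)
have d4 : (`|denq r| <= 4)%N by nia.
have [p pE] : exists p : nat, numq r = p%:Z.
  by exists `|numq r|%N; rewrite gez0_abs// numq_ge0.
have rE' : ratr r = p%:R / (`|denq r|%N)%:R :> R.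
  rewrite -{1}(divq_num_den r) pE fmorph_div /= !ratr_int -pmulrn; congr (_ / _).
  by rewrite [RHS]pmulrn gez0_abs// denq_ge0.
exists r; have := denq_neq0 r; rewrite -absz_eq0; move: d4 rE'.
case: `|denq r|%N => [|[|[|[|[|d]]]]]// _ E _.
- by exists (3 * p)%N; split; [rewrite rE | left; rewrite E natrM; field].
- by exists (2 * p)%N; split; [rewrite rE | right; rewrite E natrM; field].
- by exists p; split; [rewrite rE | left].
- by exists p; split; [rewrite rE | right].
Qed.

Lemma lattice_min_le (R : realType) n (L : set 'rV[R]_n) x :
  L x -> x != 0 -> lattice_min L <= dot x x.
Proof.
move=> Lx x0; apply: ge_inf; last by exists x => //; split => // /eqP; rewrite (negPf x0).
by exists 0 => _ [y _ <-]; exact: dot_ge0.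
Qed.

Lemma is_lattice_subgroup (R : realType) n (L : set 'rV[R]_n) :
  is_lattice L -> forall x y, L x -> L y -> L (x - y).
Proof.
move=> [B _ ->] _ _ [z _ <-] [w _ <-].
by exists (z - w) => //; rewrite map_mxB mulmxBl.
Qed.

Lemma dual_lattice_subgroup (R : realType) n (L : set 'rV[R]_n) x y :
  dual_lattice L x -> dual_lattice L y -> dual_lattice L (x - y).
Proof. by move=> Hx Hy z Lz; rewrite dotBr rpredB ?Hx ?Hy. Qed.

(** Stated for subgroups, so as to serve a lattice and its dual alike. A design is nonempty, hence
    the minimum is attained and positive; the bound [lattice_min L / 2] comes from the norm of
    [x - y] being at least the minimum. *)
Lemma strongly_perfect_seq (R : realType) (L : set 'rV[R]_16) :
  (forall x y, L x -> L y -> L (x - y)) -> strongly_perfect L ->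
  exists s : seq 'rV[R]_16, [/\ uniq s /\ s != [::], forall x, x \in s <-> min_vectors L x,
    0 < lattice_min L, (forall x, x \in s -> - x \in s) &
    (forall x y, x \in s -> y \in s -> x != y -> dot x y <= lattice_min L / 2) /\
    (forall a, \sum_(x <- s) dot x a ^+ 2 = (size s)%:R * lattice_min L / 16 * dot a a /\
      \sum_(x <- s) dot x a ^+ 4 =
        3 * (size s)%:R * lattice_min L ^+ 2 / (16 * (16 + 2)) * dot a a ^+ 2)].
Proof.
move=> LB /design_seq[//|s [us s0 sE des]]; exists s.
have [x /[dup] xs /sE[Lx x0 xm]] : exists x, x \in s.
  by case: (s) s0 => // x t _; exists x; rewrite mem_head.
have L0 : L 0 by rewrite -(subrr x); exact: LB.
split=> //.
- by rewrite -xm dot_gt0.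
- move=> y /sE[Ly y0 ym]; apply/sE; split.
  + by rewrite -sub0r; exact: LB.
  + by rewrite oppr_eq0.
  + by rewrite dotNl dotNr opprK.
split=> // y z /sE[Ly y0 ym] /sE[Lz z0 zm] yz.
have := lattice_min_le (LB _ _ Ly Lz); rewrite subr_eq0 => /(_ yz).
rewrite dotBl !dotBr ym zm (dotC z y); lra.
Qed.

(** * Reduction to a numerical certificate *)

(** Since the minima multiply to 9, the scale factor [3 / lattice_min L] is [lattice_min M / 3]. The
    statement is one-sided; exchanging [L] and [M] gives the other half. *)
Lemma dual_pair (R : realType) (L M : set 'rV[R]_16) :
  (forall x y, L x -> L y -> L (x - y)) -> (forall x y, M x -> M y -> M (x - y)) ->
  strongly_perfect L -> strongly_perfect M ->
  (forall x y, L x -> M y -> dot x y \is a Num.int) ->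
  lattice_min L * lattice_min M = 9 ->
  (exists s : seq 'rV[R]_16, (size s <= 256 * 19)%N /\ forall x, L x -> x != 0 ->
     3 <= lattice_min M * dot x x / 3 /\ (lattice_min M * dot x x / 3 = 3 -> x \in s)) /\
  forall y, M y -> exists r : rat, exists p : nat, lattice_min L * dot y y / 3 = ratr r /\
    (ratr r = p%:R / 3 :> R \/ ratr r = p%:R / 4 :> R).
Proof.
move=> LB MB sL sM LM LM9.
have [s [[us s0] sE m0 sN [sxy des]]] := strongly_perfect_seq LB sL.
have [s' [[us' s0'] sE' m0' _ _]] := strongly_perfect_seq MB sM.
have [a [Ma a0 am]] : exists a, min_vectors M a.
  by case: s' s0' sE' {us'} => // x t _ sE'; exists x; apply/sE'; rewrite mem_head.
have Ls x : x \in s -> L x by move=> /sE[].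
have [k k19 sk] : exists2 k, (0 < k <= 19)%N & size s = (256 * k)%N.
  apply: (@design_size _ s (lattice_min L) a) => //.
  - by move=> x /sE[].
  - by move=> x /Ls Lx; exact: LM.
  - by rewrite am.
split.
  exists s; split; first by rewrite sk leq_mul2l; case/andP: k19.
  move=> x Lx x0; have xm := lattice_min_le Lx x0; split.
    by rewrite ler_pdivlMr// -natrM -LM9 mulrC ler_pM2l.
  move=> e; apply/sE; split=> //; apply: (mulfI (lt0r_neq0 m0')).
  rewrite [RHS]mulrC LM9; lra.
move=> y My; apply: (@dual_norm _ s _ y k) => //; first exact: ltW.
by move=> x /Ls Lx; exact: LM.
Qed.

(** The minimum covers both signs of [g 3]: a negative value is worst with [N] vectors of norm 3, a
    nonnegative one with none. *)
Lemma sum_lower_bound (R : realType) n (V : seq 'rV[int]_n) (c : 'rV[int]_n -> R)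
    (N : nat) (g : R -> R) :
  uniq V -> 0 \in V -> c 0 = 0 ->
  (count (fun z : 'rV[int]_n => (z != 0) && (c z == 3))%R V <= N)%N ->
  (forall z, z != 0 -> c z != 3 -> 0 <= g (c z)) ->
  Num.min (g 0) (g 0 + N%:R * g 3) <= \sum_(z <- V) g (c z).
Proof.
move=> uV V0 c0 cN gc.
rewrite (bigD1_seq 0)//= c0 (bigID (fun z => c z == 3)) /=.
have -> : \sum_(z <- V | (z != 0) && (c z == 3)) g (c z) =
    (count (fun z : 'rV[int]_n => (z != 0) && (c z == 3)) V)%:R * g 3.
  rewrite (eq_bigr (fun=> g 3)); last by move=> z /andP[_ /eqP ->].
  by rewrite big_const_seq iter_addr addr0 [RHS]mulr_natl.
apply: (@le_trans _ _ (g 0 + (count (fun z : 'rV[int]_n => (z != 0) && (c z == 3)) V)%:R * g 3)); last first.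
  by rewrite lerD2l lerDl sumr_ge0// => z /andP[]; exact: gc.
rewrite ge_min; apply/orP; have [g3|g3] := leP 0 (g 3).
  by left; rewrite lerDl mulr_ge0.
by right; rewrite lerD2l ler_wnM2r ?ler_nat// ltW.
Qed.

(** Polarization, at sums of two basis vectors. *)
Lemma rational_gram (R : realType) n (A : 'M[R]_n) :
  A^T = A -> (forall z : 'rV[int]_n, exists r : rat, qform A z = ratr r) ->
  exists A0 : 'M[rat]_n, A = map_mx ratr A0.
Proof.
move=> Asym Aq.
have H (i j : 'I_n) : exists r : rat, A i j = ratr r.
  pose e (k : 'I_n) : 'rV[int]_n := delta_mx 0 k.
  have me k : map_mx intr (e k) = delta_mx 0 k :> 'rV[R]_n.
    by apply/rowP => h; rewrite !mxE; case: (_ && _).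
  have [r1 E1] := Aq (e i + e j); have [r2 E2] := Aq (e i); have [r3 E3] := Aq (e j).
  exists ((r1 - r2 - r3) / 2).
  rewrite fmorph_div !rmorphB /= ratr_nat -E1 -E2 -E3 /qform map_mxD !me.
  rewrite linearD /= !mulmxDl !mulmxDr !trmx_delta.
  have eE k l : (delta_mx 0 k *m A *m (delta_mx l 0 : 'cV_n)) = (A k l)%:M :> 'M[R]_1 .
    rewrite -rowE -colE; apply/matrixP => a b.
    by rewrite !ord1 !mxE.
  rewrite !eE !mxE /= !mulr1n.
  have -> : A j i = A i j by rewrite -[in LHS]Asym mxE.
  by field.
exists (\matrix_(i, j) projT1 (cid (H i j))).
by apply/matrixP => i j; rewrite !mxE -(projT2 (cid (H i j))).
Qed.

Lemma qform_gram (R : realType) n (B : 'M[R]_n) (c : R) (z : 'rV[int]_n) :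
  qform (c *: (B *m B^T)) z = c * dot (map_mx intr z *m B) (map_mx intr z *m B).
Proof. by rewrite /qform /dot -scalemxAr -scalemxAl mxE trmx_mul !mulmxA. Qed.

(** In dimension 16 the Fourier transform of [exp (- pi t |x|^2)] is [t^-8 exp (- pi |x|^2 / t)]. At
    [r = |x|^2] this is thus a combination of Gaussians minus its own transform, an eigenfunction
    for the eigenvalue -1. *)
Definition antisym_theta (R : realType) (l : seq (R * R)) (r : R) : R :=
  \sum_(q <- l) q.1 * (expR (- (pi * q.2 * r)) - q.2^-1 ^+ 8 * expR (- (pi * q.2^-1 * r))).

(** Poisson summation at [t] and at [1 / t] yields dual limits [S1] and [S2]; the combination
    [S2 - t^-8 S1] on the dual side becomes [- K] times itself on the other. The boxes [F J] and
    [G J] are common to all [t], so the contributions of the pairs in [l] add up. *)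
Lemma antisym_theta_limit (R : realType) (A Ai : 'M[R]_16) (A0 : 'M[rat]_16) (l : seq (R * R)) :
  A = map_mx ratr A0 -> A^T = A ->
  (forall z : 'rV[R]_16, z != 0 -> 0 < (z *m A *m z^T) 0 0) -> A *m Ai = 1%:M ->
  (forall q, q \in l -> 0 < q.2) ->
  exists2 K : R, 0 <= K & exists F G : nat -> seq 'rV[int]_16,
  (forall J, [/\ uniq (F J), 0 \in F J, uniq (G J) & 0 \in G J]) /\
  exists S : R,
    \sum_(z <- F J) antisym_theta l (qform A z) @[J --> \oo] --> - (K * S) /\
    \sum_(z <- G J) antisym_theta l (qform Ai z) @[J --> \oo] --> S.
Proof.
move=> AE Asym Apos AAi; have [K K0 [F [G [FG lim]]]] := poisson_lattice AE Asym Apos AAi.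
move=> l0; exists K => //; exists F, G; split=> //.
have sE (c : 'rV[int]_16 -> R) V : \sum_(z <- V) antisym_theta l (c z) =
    \sum_(q <- l) q.1 * (\sum_(z <- V) expR (- (pi * q.2 * c z)) -
      q.2^-1 ^+ 8 * \sum_(z <- V) expR (- (pi * q.2^-1 * c z))).
  rewrite /antisym_theta exchange_big /=; apply: eq_bigr => q _.
  by rewrite [_ * \sum_(z <- V) _]mulr_sumr -sumrB mulr_sumr.
rewrite (_ : (fun J => \sum_(z <- F J) _) = (fun J => \sum_(q <- l) q.1 * (\sum_(z <- F J) expR (- (pi * q.2 * qform A z)) -
      q.2^-1 ^+ 8 * \sum_(z <- F J) expR (- (pi * q.2^-1 * qform A z))))); last first.
  by apply/funext => J; rewrite sE.
rewrite (_ : (fun J => \sum_(z <- G J) _) = (fun J => \sum_(q <- l) q.1 * (\sum_(z <- G J) expR (- (pi * q.2 * qform Ai z)) -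
      q.2^-1 ^+ 8 * \sum_(z <- G J) expR (- (pi * q.2^-1 * qform Ai z))))); last first.
  by apply/funext => J; rewrite sE.
elim: l l0 {sE} => [|[c t] l IH] l0.
  exists 0; rewrite mulr0 oppr0; split.
    by under eq_fun do rewrite big_nil; exact: cvg_cst.
  by under eq_fun do rewrite big_nil; exact: cvg_cst.
have t0 : 0 < t by apply: (l0 (c, t)); rewrite mem_head.
have [S [SF SG]] := IH (fun q ql => l0 q (mem_behead (ql : q \in behead ((c, t) :: l)))).
have [S1 [F1 G1]] := lim t t0.
have tV0 : 0 < t^-1 by rewrite invr_gt0.
have [S2 [F2 G2]] := lim t^-1 tV0.
rewrite invrK in G2.
have q16 (x : R) : 0 < x -> Num.sqrt x ^+ 16 = x ^+ 8.
  by move=> x0; rewrite (exprM _ 2 8) sqr_sqrtr// ltW.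
rewrite q16// in F1; rewrite q16// in F2.
exists (c * (S2 - t^-1 ^+ 8 * S1) + S); split.
  rewrite (_ : - (K * _) = c * (K / t ^+ 8 * S1 - t^-1 ^+ 8 * (K / t^-1 ^+ 8 * S2)) + - (K * S)).
    rewrite (_ : (fun J => _) = (fun J => c * (\sum_(z <- F J) expR (- (pi * t * qform A z)) -
      t^-1 ^+ 8 * \sum_(z <- F J) expR (- (pi * t^-1 * qform A z))) + \sum_(q <- l) q.1 * (\sum_(z <- F J) expR (- (pi * q.2 * qform A z)) -
      q.2^-1 ^+ 8 * \sum_(z <- F J) expR (- (pi * q.2^-1 * qform A z))))).
      by apply: cvgD => //; apply: cvgMr; apply: cvgB => //; apply: cvgMr.
    by apply/funext => J; rewrite big_cons.
  by move: (S) => S'; field; rewrite gt_eqF.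
rewrite (_ : (fun J => _) = (fun J => c * (\sum_(z <- G J) expR (- (pi * t * qform Ai z)) -
      t^-1 ^+ 8 * \sum_(z <- G J) expR (- (pi * t^-1 * qform Ai z))) + \sum_(q <- l) q.1 * (\sum_(z <- G J) expR (- (pi * q.2 * qform Ai z)) -
      q.2^-1 ^+ 8 * \sum_(z <- G J) expR (- (pi * q.2^-1 * qform Ai z))))).
  by apply: cvgD => //; apply: cvgMr; apply: cvgB => //; apply: cvgMr.
by apply/funext => J; rewrite big_cons.
Qed.

Lemma no_dual_pair (R : realType) (l : seq (R * R)) :
  (forall q, q \in l -> 0 < q.2) ->
  0 < antisym_theta l 0 -> 0 < antisym_theta l 0 + 4864 * antisym_theta l 3 ->
  (forall p : nat, (9 < p)%N -> 0 <= antisym_theta l (p%:R / 3)) ->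
  (forall p : nat, (12 < p)%N -> 0 <= antisym_theta l (p%:R / 4)) ->
  ~ exists L : set 'rV[R]_16,
      [/\ is_lattice L,
          strongly_perfect L,
          strongly_perfect (dual_lattice L)
        & lattice_min L * lattice_min (dual_lattice L) = 9].
Proof.
move=> l0 g0 g03 gp3 gp4 [L [latL sL sL' mm]].
set M := dual_lattice L in sL' mm.
set g := antisym_theta l in g0 g03 gp3 gp4.
pose d := Num.min (g 0) (g 0 + 4864 * g 3).
have d0 : 0 < d by rewrite lt_min g0.
have LB := is_lattice_subgroup latL.
have MB : forall x y, M x -> M y -> M (x - y) by move=> x y; exact: dual_lattice_subgroup.
have [minL minM] := dual_pair LB MB sL sL' (fun x y Lx My => My x Lx) mm.
have mm' : lattice_min M * lattice_min L = 9 by rewrite mulrC.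
have [minM' minL'] := dual_pair MB LB sL' sL (fun x y (Mx : M x) Ly => eq_ind_r (fun t => t \is a Num.int) (Mx y Ly) (dotC x y)) mm'.
have [s [[us s0] sE m0 sN _]] := strongly_perfect_seq LB sL.
have [s' [[us' s0'] sE' m0' sN' _]] := strongly_perfect_seq MB sL'.
have [B Bu LE] := latL.
(* The basis dual to the rows of [B]. The rescaled Gram matrices [A] and [Ai] are then inverse to
   each other, as the scale factors multiply to 1. *)
pose C := (invmx B)^T.
have CM (z : 'rV[int]_16) : M (map_mx intr z *m C).
  move=> x; rewrite LE => -[w _ <-].
  rewrite /dot trmx_mul trmxK mulmxA mulmxK// mxE rpred_sum// => i _.
  by rewrite !mxE rpredM// intr_int.
have CL (z : 'rV[int]_16) : L (map_mx intr z *m B) by rewrite LE; exists z.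
have Cu : C \in unitmx by rewrite unitmx_tr unitmx_inv.
pose A := (lattice_min L / 3) *: (C *m C^T).
pose Ai := (lattice_min M / 3) *: (B *m B^T).
have AAi : A *m Ai = 1%:M.
  rewrite /A /Ai -scalemxAl -scalemxAr scalerA trmxK.
  rewrite mulmxA -(mulmxA C) mulVmx// mulmx1 -trmx_mul mulmxV// trmx1.
  rewrite (_ : _ / 3 * _ = lattice_min L * lattice_min M / 9); last by field.
  by rewrite mm divff ?pnatr_eq0// scale1r.
have Aq z : qform A z = lattice_min L * dot (map_mx intr z *m C) (map_mx intr z *m C) / 3.
  by rewrite qform_gram mulrAC.
have Aiq z : qform Ai z = lattice_min M * dot (map_mx intr z *m B) (map_mx intr z *m B) / 3.
  by rewrite qform_gram mulrAC.
have Asym : A^T = A by rewrite /A linearZ /= trmx_mul trmxK.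
have [A0 A0E] : exists A0 : 'M[rat]_16, A = map_mx ratr A0.
  apply: rational_gram => // z; rewrite Aq.
  by have [r [p [-> _]]] := minM _ (CM z); exists r.
have Apos (z : 'rV[R]_16) : z != 0 -> 0 < (z *m A *m z^T) 0 0.
  move=> z0; rewrite /A -scalemxAr -scalemxAl mxE mulr_gt0 ?divr_gt0//.
  have -> : z *m (C *m C^T) *m z^T = z *m C *m (z *m C)^T by rewrite trmx_mul !mulmxA.
  by rewrite dot_gt0 -(mul0mx _ C) (inj_eq (can_inj (mulmxK Cu))).
have bound (N : set 'rV[R]_16) (D : 'M[R]_16) (c : R) (V : seq 'rV[int]_16) :
    D \in unitmx -> (forall z, N (map_mx intr z *m D)) -> uniq V -> 0 \in V ->
    (exists s : seq 'rV[R]_16, (size s <= 256 * 19)%N /\ forall x, N x -> x != 0 ->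
     3 <= c * dot x x / 3 /\ (c * dot x x / 3 = 3 -> x \in s)) ->
    (forall y, N y -> exists r : rat, exists p : nat, c * dot y y / 3 = ratr r /\
    (ratr r = p%:R / 3 :> R \/ ratr r = p%:R / 4 :> R)) ->
    d <= \sum_(z <- V) g (c * dot (map_mx intr z *m D) (map_mx intr z *m D) / 3).
  move=> Du DN uV V0 [u [u19 uP]] Nq.
  have Dinj : injective (fun z : 'rV[int]_16 => map_mx intr z *m D : 'rV[R]_16).
    move=> z w /(can_inj (mulmxK Du)) /matrixP H; apply/matrixP => i j.
    by have := H i j; rewrite !mxE => /intr_inj.
  have D0 (z : 'rV[int]_16) : z != 0 -> map_mx intr z *m D != 0.
    by apply: contra_neq => zD; apply: (@Dinj z 0); rewrite /= zD map_mx0 mul0mx.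

  apply: (@sum_lower_bound _ _ V (fun z => c * dot (map_mx intr z *m D) (map_mx intr z *m D) / 3)) => //.
  - by rewrite map_mx0 mul0mx /dot mul0mx mxE mulr0 mul0r.
  - apply: leq_trans u19; rewrite -size_filter.
    rewrite -(size_map (fun z : 'rV[int]_16 => map_mx intr z *m D)).
    apply: uniq_leq_size; first by rewrite map_inj_uniq// filter_uniq.
    move=> _ /mapP[z + ->]; rewrite mem_filter => /andP[/andP[z0 /eqP z3] _].
    by have [_] := uP _ (DN z) (D0 _ z0); apply.
  - move=> z z0 z3.
    have [H _] := uP _ (DN z) (D0 _ z0).
    have H3 : 3 < c * dot (map_mx intr z *m D) (map_mx intr z *m D) / 3.
      by rewrite lt_def z3.
    have [r [p [E [rp|rp]]]] := Nq _ (DN z); move: H3; rewrite E rp => H3.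
      apply: gp3; move: H3; rewrite ltr_pdivlMr// -natrM ltr_nat; exact.
    apply: gp4; move: H3; rewrite ltr_pdivlMr// -natrM ltr_nat; exact.
have [K K0 [F [G [FG [S [SF SG]]]]]] := antisym_theta_limit A0E Asym Apos AAi l0.
have S0 : d <= S.
  apply: (cvgr_to_ge SG); apply: nearW => J; have [_ _ uG G0] := FG J.
  by under eq_bigr do rewrite Aiq; exact: (bound L).
have KS0 : d <= - (K * S).
  apply: (cvgr_to_ge SF); apply: nearW => J; have [uF F0 _ _] := FG J.
  by under eq_bigr do rewrite Aq; exact: (bound M).
have : 0 <= K * S by rewrite mulr_ge0// (le_trans (ltW d0)).
lra.
Qed.

(** * The numerical certificate *)

Definition exp_trunc (R : realType) (n : nat) (x : R) : R :=
  \sum_(k < n) (-1) ^+ k / k`!%:R * x ^+ k.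
Definition cos_trunc (R : realType) (n : nat) (x : R) : R :=
  \sum_(k < n) (-1) ^+ k / (k.*2)`!%:R * x ^+ k.*2.
Definition sin_trunc (R : realType) (n : nat) (x : R) : R :=
  \sum_(k < n) (-1) ^+ k / (k.*2.+1)`!%:R * x ^+ k.*2.+1.

Lemma is_derive_expn (R : realType) (a : R) n (x : R) :
  is_derive x 1 (fun x : R => a * x ^+ n.+1) (a * (n.+1%:R * x ^+ n)).
Proof.
rewrite (_ : (fun x => _) = a \*: (@id R) ^+ n.+1); last first.
  by apply/funext => y; rewrite /= exprfctE.
by apply: is_derive_eq; rewrite /GRing.scale /= mulr1.
Qed.

Lemma factS_neq0 (R : realType) n : (n.+1%:R : R) != 0 /\ (n`!%:R : R) != 0.
Proof. by rewrite !pnatr_eq0 -[n`! == _]leqn0 -ltnNge fact_gt0. Qed.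

Lemma exp_trunc_derive (R : realType) n (x : R) :
  is_derive x 1 (exp_trunc n.+1) (- exp_trunc n x).
Proof.
elim: n => [|n IH].
  rewrite (_ : exp_trunc 1 = cst 1).
    by rewrite /exp_trunc big_ord0 oppr0; exact: is_derive_cst.
  by apply/funext => y; rewrite /exp_trunc big_ord1 !expr0 fact0 divr1 mulr1.
rewrite (_ : exp_trunc n.+2 = exp_trunc n.+1 + (fun x => ((-1) ^+ n.+1 / (n.+1)`!%:R) * x ^+ n.+1)); last first.
  by apply/funext => y; rewrite /exp_trunc big_ord_recr /= fctE.
apply: is_derive_eq; first exact: (is_deriveD IH (is_derive_expn _ _ _)).
rewrite /exp_trunc big_ord_recr /= opprD; congr (_ + _).
rewrite factS natrM [in LHS]exprS; have [H H0] := factS_neq0 R n.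
move: H H0; move: (n.+1%:R : R) (n`!%:R : R) ((-1) ^+ n : R) => a b c H H0.
by field; rewrite H H0.
Qed.

Lemma cos_trunc_derive (R : realType) n (x : R) :
  is_derive x 1 (cos_trunc n.+1) (- sin_trunc n x).
Proof.
elim: n => [|n IH].
  rewrite (_ : cos_trunc 1 = cst 1).
    by rewrite /sin_trunc big_ord0 oppr0; exact: is_derive_cst.
  by apply/funext => y; rewrite /cos_trunc big_ord1 !expr0 fact0 divr1 mulr1.
rewrite (_ : cos_trunc n.+2 = cos_trunc n.+1 +
    (fun x => ((-1) ^+ n.+1 / (n.*2.+2)`!%:R) * x ^+ n.*2.+2)); last first.
  by apply/funext => y; rewrite /cos_trunc big_ord_recr /= fctE.
apply: is_derive_eq; first exact: (is_deriveD IH (is_derive_expn _ _ _)).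
rewrite /sin_trunc big_ord_recr /= opprD; congr (_ + _).
rewrite factS natrM [in LHS]exprS; have [H H0] := factS_neq0 R n.*2.+1.
move: H H0; move: (n.*2.+2%:R : R) ((n.*2.+1)`!%:R : R) ((-1) ^+ n : R) => a b c H H0.
by field; rewrite H H0.
Qed.

Lemma sin_trunc_derive (R : realType) n (x : R) :
  is_derive x 1 (sin_trunc n) (cos_trunc n x).
Proof.
elim: n => [|n IH].
  rewrite (_ : sin_trunc 0 = cst 0).
    by rewrite /cos_trunc big_ord0; exact: is_derive_cst.
  by apply/funext => y; rewrite /sin_trunc big_ord0.
rewrite (_ : sin_trunc n.+1 = sin_trunc n +
    (fun x => ((-1) ^+ n / (n.*2.+1)`!%:R) * x ^+ n.*2.+1)); last first.
  by apply/funext => y; rewrite /sin_trunc big_ord_recr /= fctE.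
apply: is_derive_eq; first exact: (is_deriveD IH (is_derive_expn _ _ _)).
rewrite /cos_trunc big_ord_recr /=; congr (_ + _).
rewrite factS natrM; have [H H0] := factS_neq0 R n.*2.
move: H H0; move: (n.*2.+1%:R : R) ((n.*2)`!%:R : R) ((-1) ^+ n : R) => a b c H H0.
by field; rewrite H H0.
Qed.

(** The function for [n.+1] vanishes at 0 and its derivative is the function for [n]. *)
Lemma exp_trunc_bound (R : realType) n (x : R) :
  0 <= x -> 0 <= (-1) ^+ n * (expR (- x) - exp_trunc n x).
Proof.
elim: n x => [|n IH] x x0.
  by rewrite /exp_trunc big_ord0 expr0 mul1r subr0 expR_ge0.
have d (y : R) : is_derive y 1 (fun x : R => (-1) ^+ n.+1 * (expR (- x) - exp_trunc n.+1 x))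
    ((-1) ^+ n * (expR (- y) - exp_trunc n y)).
  have := exp_trunc_derive n y => ?.
  by apply: trigger_derive; rewrite /GRing.scale /= exprS; ring.
have := ge0_derive_ndecr d IH x0; apply: le_trans.
rewrite oppr0 expR0 /exp_trunc big_ord_recl /= big1 ?addr0; last first.
  by move=> i _; rewrite expr0n mulr0.
by rewrite !expr0 fact0 divr1 mulr1 subrr mulr0.
Qed.

(** Two integrations per step, from cosine to sine and back. *)
Lemma cos_trunc_bound (R : realType) n (x : R) :
  0 <= x -> 0 <= (-1) ^+ n.+1 * (cos x - cos_trunc n.+1 x).
Proof.
elim: n x => [|n IH] x x0.
  rewrite /cos_trunc big_ord1 !expr0 expr1 fact0 divr1 mulr1.
  by rewrite mulN1r opprB subr_ge0 cos_le1.
have sb (y : R) : 0 <= y -> 0 <= (-1) ^+ n.+1 * (sin y - sin_trunc n.+1 y).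
  move=> y0.
  have d (z : R) : is_derive z 1 (fun x : R => (-1) ^+ n.+1 * (sin x - sin_trunc n.+1 x))
      ((-1) ^+ n.+1 * (cos z - cos_trunc n.+1 z)).
    have := sin_trunc_derive n.+1 z => ?.
    by apply: trigger_derive; rewrite /GRing.scale /=; ring.
  have := ge0_derive_ndecr d IH y0; apply: le_trans.
  rewrite sin0 /sin_trunc big1 ?subrr ?mulr0// => i _.
  by rewrite expr0n mulr0.
have d (z : R) : is_derive z 1 (fun x : R => (-1) ^+ n.+2 * (cos x - cos_trunc n.+2 x))
    ((-1) ^+ n.+1 * (sin z - sin_trunc n.+1 z)).
  have := cos_trunc_derive n.+1 z => ?.
  by apply: trigger_derive; rewrite /GRing.scale /= [in LHS]exprS; ring.
have := ge0_derive_ndecr d sb x0; apply: le_trans.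
rewrite cos0 /cos_trunc big_ord_recl /= big1 ?addr0; last first.
  by move=> i _; rewrite expr0n mulr0.
by rewrite !expr0 fact0 divr1 mulr1 subrr mulr0.
Qed.

(** * Certified bounds for [pi] and exponentials in binary integer arithmetic *)

Import BinInt.
(* [BinInt] binds the key [N] to another scope. *)
Delimit Scope nat_scope with N.

(* Locked so that no conversion test evaluates [int_of_Z], which is unary. *)
Fact zr_key : unit. Proof. exact: tt. Qed.
Definition zr (R : realType) : Z -> R :=
  locked_with zr_key (fun z => (int_of_Z z)%:~R).

Lemma zrE (R : realType) z : zr R z = (int_of_Z z)%:~R.
Proof. by rewrite /zr unlock. Qed.

Lemma zrD (R : realType) x y : zr R (Z.add x y) = zr R x + zr R y.
Proof. by rewrite !zrE -intrD -rmorphD. Qed.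

Lemma zrM (R : realType) x y : zr R (Z.mul x y) = zr R x * zr R y.
Proof. by rewrite !zrE -intrM -rmorphM. Qed.

Lemma zrN (R : realType) x : zr R (Z.opp x) = - zr R x.
Proof. by rewrite !zrE -mulrNz -rmorphN. Qed.

Lemma zrX (R : realType) x n : zr R (Z.pow x (Z.of_nat n)) = zr R x ^+ n.
Proof.
elim: n => [|n IH]; first by rewrite zrE.
by rewrite Znat.Nat2Z.inj_succ Z.pow_succ_r ?zrM ?IH ?exprS//; exact: Znat.Nat2Z.is_nonneg.
Qed.

Lemma zr_nat (R : realType) n : zr R (Z.of_nat n) = n%:R.
Proof. by rewrite zrE (_ : int_of_Z _ = n%:Z)//; lia. Qed.

Lemma zr_le (R : realType) x y : Z.leb x y -> zr R x <= zr R y.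
Proof. by rewrite !zrE ler_int; lia. Qed.

Lemma zr_lt (R : realType) x y : Z.ltb x y -> zr R x < zr R y.
Proof. by rewrite !zrE ltr_int; lia. Qed.

Lemma zr0 (R : realType) : zr R Z0 = 0.
Proof. exact: (zr_nat R 0). Qed.

Lemma zr_ge0 (R : realType) x : Z.leb Z0 x -> 0 <= zr R x.
Proof. by move/(zr_le R); rewrite zr0. Qed.

Lemma zr_gt0 (R : realType) x : Z.ltb Z0 x -> 0 < zr R x.
Proof. by move/(zr_lt R); rewrite zr0. Qed.

Lemma zr_lt0 (R : realType) x : Z.ltb x Z0 -> zr R x < 0.
Proof. by move/(zr_lt R); rewrite zr0. Qed.

(* Partial sums of [\sum_k (-1)^k (p/q)^k / (f 0 * ... * f (k-1))]: the state
   [(t, s, d)] holds the next term [t / d] and the sum [s / d] so far. *)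
Fixpoint alt_sum (f : nat -> nat) (p q : Z) (n : nat) : Z * Z * Z :=
  if n is m.+1 then
    let: (t, s, d) := alt_sum f p q m in
    let c := Z.mul q (Z.of_nat (f m)) in
    (Z.opp (Z.mul t p), Z.mul (Z.add s t) c, Z.mul d c)
  else (Zpos xH, Z0, Zpos xH).

Lemma alt_sumP (R : realType) (f g : nat -> nat) (p q : Z) n :
  g 0 = 1%N -> (forall k, g k.+1 = f k * g k)%N -> (forall k, 0 < f k)%N -> Z.ltb Z0 q ->
  let: (t, s, d) := alt_sum f p q n in
  [/\ 0 < zr R d, zr R t = zr R d * ((-1) ^+ n / (g n)%:R * (zr R p / zr R q) ^+ n) &
      zr R s = zr R d * \sum_(k < n) (-1) ^+ k / (g k)%:R * (zr R p / zr R q) ^+ k].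
Proof.
move=> g0 gS f0 q0; have q0' : 0 < zr R q by exact: zr_gt0.
elim: n => [|n] /=.
  by rewrite g0 big_ord0 !expr0 (zr_nat R 1) (zr_nat R 0) mulr0 divr1 !mulr1.
case: (alt_sum f p q n) => [[t s] d] [d0 tE sE]; split.
- by rewrite !zrM zr_nat !mulr_gt0// ltr0n.
- rewrite zrN !zrM zr_nat tE gS natrM !exprS.
  have fn : (f n)%:R != 0 :> R by rewrite pnatr_eq0 -lt0n.
  rewrite invfM; have qn : zr R q != 0 by rewrite gt_eqF.
  move: ((g n)%:R^-1 : R) fn => G; move: ((f n)%:R : R) => F fn.
  move: ((_ / _) ^+ n : R) => X.
  by field; rewrite fn qn.
- by rewrite !zrM zrD zr_nat tE sE big_ord_recr /=; ring.
Qed.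

Definition cos_sum (p q : Z) (n : nat) : Z * Z * Z :=
  alt_sum (fun k => k.*2.+1 * k.*2.+2)%N (Z.mul p p) (Z.mul q q) n.
Definition exp_sum (p q : Z) (n : nat) : Z * Z * Z := alt_sum succn p q n.

Lemma cos_sumP (R : realType) (p q : Z) n : Z.ltb Z0 q ->
  let: (_, s, d) := cos_sum p q n in
  0 < zr R d /\ zr R s = zr R d * cos_trunc n (zr R p / zr R q).
Proof.
move=> q0; have qn : zr R q != 0 by rewrite gt_eqF ?zr_gt0.
have qq0 : Z.ltb Z0 (Z.mul q q) by lia.
have := @alt_sumP R (fun k => k.*2.+1 * k.*2.+2)%N (fun k => (k.*2)`!) (Z.mul p p) _ n
  (fact0) (fun k => _) (fun k => isT) qq0.
rewrite -/(cos_sum p q n); case: (cos_sum p q n) => [[t s] d] H.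
have {H}[|d0 _ sE] := H; first by move=> k; rewrite doubleS !factS; ring.
split=> //; rewrite sE; congr (_ * _); apply: eq_bigr => k _; congr (_ * _).
by rewrite !zrM -muln2 mulnC exprM; congr (_ ^+ _); field.
Qed.

Lemma exp_sumP (R : realType) (p q : Z) n : Z.ltb Z0 q ->
  let: (_, s, d) := exp_sum p q n in
  0 < zr R d /\ zr R s = zr R d * exp_trunc n (zr R p / zr R q).
Proof.
move=> q0.
have := @alt_sumP R succn factorial p _ n fact0 factS (fun k => isT) q0.
by rewrite -/(exp_sum p q n); case: (exp_sum p q n) => [[t s] d] [].
Qed.

Lemma cos_trunc_gt0 (R : realType) (p q : Z) n : Z.ltb Z0 q ->
  (let: (_, s, _) := cos_sum p q n in Z.ltb Z0 s) -> 0 < cos_trunc n (zr R p / zr R q).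
Proof.
move=> q0; have := @cos_sumP R p q n q0; case: (cos_sum p q n) => [[t s] d] [d0 sE] s0.
by rewrite -(pmulr_rgt0 _ d0) -sE zr_gt0.
Qed.

Lemma cos_trunc_lt0 (R : realType) (p q : Z) n : Z.ltb Z0 q ->
  (let: (_, s, _) := cos_sum p q n in Z.ltb s Z0) -> cos_trunc n (zr R p / zr R q) < 0.
Proof.
move=> q0; have := @cos_sumP R p q n q0; case: (cos_sum p q n) => [[t s] d] [d0 sE] s0.
by rewrite -(pmulr_rlt0 _ d0) -sE zr_lt0.
Qed.

Lemma exp_trunc_ge (R : realType) (p q a b : Z) n : Z.ltb Z0 q ->
  (let: (_, s, d) := exp_sum p q n in Z.leb (Z.mul d a) (Z.mul b s)) ->
  zr R a <= zr R b * exp_trunc n (zr R p / zr R q).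
Proof.
move=> q0; have := @exp_sumP R p q n q0; case: (exp_sum p q n) => [[t s] d] [d0 sE] s0.
by rewrite -(ler_pM2l d0) [leRHS]mulrCA -sE -!zrM zr_le.
Qed.

Lemma exp_trunc_le (R : realType) (p q a b : Z) n : Z.ltb Z0 q ->
  (let: (_, s, d) := exp_sum p q n in Z.leb (Z.mul b s) (Z.mul d a)) ->
  zr R b * exp_trunc n (zr R p / zr R q) <= zr R a.
Proof.
move=> q0; have := @exp_sumP R p q n q0; case: (exp_sum p q n) => [[t s] d] [d0 sE] s0.
by rewrite -(ler_pM2l d0) [leLHS]mulrCA -sE -!zrM zr_le.
Qed.

Definition pihalf_lo : Z := 15707963267948966192.
Definition pihalf_hi : Z := 15707963267948966193.
Definition pihalf_den : Z := 10000000000000000000.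

(** The cosine decreases on [[0, pi]] and vanishes at [pi / 2], so the signs of two Taylor
    polynomials decide: 16 terms bound it from below, 17 from above. Both fractions are below 2,
    hence in [[0, pi]]. *)
Lemma pihalf_bounds (R : realType) :
  zr R pihalf_lo / zr R pihalf_den < pi / 2 < zr R pihalf_hi / zr R pihalf_den.
Proof.
have den0 : 0 < zr R pihalf_den by exact: zr_gt0.
have in0pi (p : Z) : Z.leb Z0 p -> Z.leb p (Z.mul 2 pihalf_den) ->
    zr R p / zr R pihalf_den \in `[0, pi].
  move=> p0 p2; rewrite in_itv /= divr_ge0 ?(ltW den0) ?zr_ge0//=.
  apply: (@le_trans _ _ 2); last exact: pi_ge2.
  by rewrite ler_pdivrMr// -(zr_nat R 2) -zrM; exact: zr_le.
have pi2 : pi / 2 \in `[0, pi :> R].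
  rewrite in_itv /= divr_ge0 ?pi_ge0//= ler_pdivrMr// ler_peMr ?pi_ge0// ler1n//.
apply/andP; split.
  rewrite -ltr_cos// ?in0pi//; [|by vm_compute..].
  rewrite cos_pihalf.
  have lo0 : 0 <= zr R pihalf_lo / zr R pihalf_den.
    by rewrite divr_ge0 ?(ltW den0) ?zr_ge0.
  have := @cos_trunc_bound R 15 _ lo0; rewrite -signr_odd expr0 mul1r subr_ge0.
  apply: lt_le_trans.
  by apply: cos_trunc_gt0; vm_compute.
rewrite -ltr_cos// ?in0pi//; [|by vm_compute..].
rewrite cos_pihalf.
have hi0 : 0 <= zr R pihalf_hi / zr R pihalf_den.
  by rewrite divr_ge0 ?(ltW den0) ?zr_ge0.
have := @cos_trunc_bound R 16 _ hi0; rewrite -signr_odd expr1 mulN1r opprB subr_ge0.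
move=> /le_lt_trans; apply.
by apply: cos_trunc_lt0; vm_compute.
Qed.

(** The power [2^43], unit of a fixed-point arithmetic. As norms are multiples of 1/12, every
    exponential is a power of some [exp (- pi t / 12)], which is itself enclosed by means of
    [exp (- pi / 12)]. *)
Definition scale : Z := 8796093022208.
Definition exp_lo : Z := 6770048564265.
Definition exp_hi : Z := 6770048564268.

Lemma exp_pi12_bounds (R : realType) :
  zr R exp_lo <= zr R scale * expR (- (pi / 12)) <= zr R exp_hi.
Proof.
have /andP[lo hi] := pihalf_bounds R.
have den0 : 0 < zr R pihalf_den by exact: zr_gt0.
have scale0 : 0 < zr R scale by exact: zr_gt0.
have z6 : zr R 6 = 6 by rewrite (zr_nat R 6).
pose q := Z.mul pihalf_den 6.
have qE (p : Z) : zr R p / zr R q = zr R p / zr R pihalf_den / 6.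
  by rewrite /q zrM z6 invfM mulrA.
have x0 (p : Z) : Z.leb Z0 p -> 0 <= zr R p / zr R q.
  by move=> p0; rewrite qE !divr_ge0 ?(ltW den0) ?zr_ge0.
apply/andP; split.
  apply: (@le_trans _ _ (zr R scale * expR (- (zr R pihalf_hi / zr R q)))); last first.
    by rewrite ler_pM2l// ler_expR lerN2 qE; lra.
  have := @exp_trunc_bound R 16 _ (x0 pihalf_hi isT); rewrite -signr_odd expr0 mul1r subr_ge0.
  rewrite -(ler_pM2l scale0); apply: le_trans.
  by apply: exp_trunc_ge; vm_compute.
apply: (@le_trans _ _ (zr R scale * expR (- (zr R pihalf_lo / zr R q)))).
  by rewrite ler_pM2l// ler_expR lerN2 qE; lra.
have := @exp_trunc_bound R 17 _ (x0 pihalf_lo isT); rewrite -signr_odd expr1 mulN1r opprB subr_ge0.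
rewrite -(ler_pM2l scale0) => /le_trans; apply.
by apply: exp_trunc_le; vm_compute.
Qed.

Definition powZ (x : Z) (n : nat) : Z := Z.pow x (Z.of_nat n).

Arguments powZ : simpl never.

Lemma zr_pow (R : realType) x n : zr R (powZ x n) = zr R x ^+ n.
Proof. exact: zrX. Qed.

(* The summand [weight * exp (- pi / 12 * num / den) ^ p] of a theta sum, with
   [lower <= scale * exp (- pi / 12 * num / den) <= upper]. *)
Record term := Term {
  weight : Z; num : nat; den : nat; lower : Z; upper : Z }.

HB.instance Definition _ := gen_eqMixin term.

Definition term_exp (R : realType) (t : term) : R :=
  expR (- (pi / 12 * ((num t)%:R / (den t)%:R))).

(** The enclosure is tested after raising it to the power [den t], which replaces a root of
    [exp (- pi / 12)] by integer powers: [(lower / scale)^den <= (exp_lo / scale)^num], and dually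
    for [upper]. *)
Definition term_ok (t : term) : bool :=
  [&& (0 < num t)%N, (0 < den t)%N, Z.leb Z0 (lower t), Z.leb Z0 (upper t),
      Z.leb (Z.mul (powZ (lower t) (den t)) (powZ scale (num t)))
            (Z.mul (powZ exp_lo (num t)) (powZ scale (den t))) &
      Z.leb (Z.mul (powZ exp_hi (num t)) (powZ scale (den t)))
            (Z.mul (powZ (upper t) (den t)) (powZ scale (num t)))].

Lemma term_bounds (R : realType) t : term_ok t ->
  zr R (lower t) <= zr R scale * term_exp R t <= zr R (upper t).
Proof.
case/and5P => a0 b0 /(zr_ge0 R) lo0 /(zr_ge0 R) hi0 /andP[lob hib].
have scale0 : 0 < zr R scale by exact: zr_gt0.
set w := _ * _; have w0 : 0 <= w by rewrite mulr_ge0 ?expR_ge0// ltW.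
have bn : ((den t)%:R : R) != 0 by rewrite pnatr_eq0 -lt0n.
have wE : w ^+ den t * zr R scale ^+ num t =
    (zr R scale * expR (- (pi / 12))) ^+ num t * zr R scale ^+ den t.
  rewrite !exprMn -!expRM_natl (_ : (den t)%:R * _ = (num t)%:R * - (pi / 12)).
    by ring.
  by move: (pi : R) => P; field.
have /andP[e1 e2] := exp_pi12_bounds R.
have u0 : 0 <= zr R scale * expR (- (pi / 12)) by rewrite mulr_ge0 ?expR_ge0// ltW.
have l0 : 0 <= zr R exp_lo by exact: zr_ge0.
have h0 : 0 <= zr R exp_hi by exact: zr_ge0.
apply/andP; split.
  rewrite -(ler_pXn2r b0)// -(ler_pM2r (exprn_gt0 (num t) scale0)) wE.
  apply: le_trans (_ : zr R exp_lo ^+ num t * zr R scale ^+ den t <= _).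
    by have := zr_le R lob; rewrite !zrM !zr_pow.
  by rewrite ler_pM2r ?exprn_gt0// lerXn2r.
rewrite -(ler_pXn2r b0)// -(ler_pM2r (exprn_gt0 (num t) scale0)) wE.
apply: le_trans (_ : zr R exp_hi ^+ num t * zr R scale ^+ den t <= _).
  by rewrite ler_pM2r ?exprn_gt0// lerXn2r.
by have := zr_le R hib; rewrite !zrM !zr_pow.
Qed.

(* A lower bound of [weight * exp (- pi / 12 * num / den) ^ p], rounded down to
   an integer at each step. *)
Definition lower_step (t : term) (v : Z) : Z :=
  Z.div (Z.mul v (if Z.leb Z0 v then lower t else upper t)) scale.

Fixpoint term_lower (t : term) (p : nat) : Z :=
  if p is p'.+1 then lower_step t (term_lower t p') else weight t.

Lemma term_lowerP (R : realType) t p : term_ok t ->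
  zr R (term_lower t p) <= zr R (weight t) * term_exp R t ^+ p.
Proof.
move=> tok; have /andP[lo hi] := term_bounds R tok.
have scale0 : 0 < zr R scale by exact: zr_gt0.
elim: p => [|p IH] /=; first by rewrite expr0 mulr1.
rewrite exprSr mulrA; set w := _ * _ ^+ p in IH *; move: (term_lower t p) IH => v vw.
rewrite -(ler_pM2l scale0) -zrM /lower_step.
apply: le_trans (_ : zr R v * (zr R scale * term_exp R t) <= _); last first.
  by rewrite [leLHS]mulrCA ler_pM2l// ler_wpM2r// expR_ge0.
set x := if _ then _ else _.
apply: (@le_trans _ _ (zr R (Z.mul v x))).
  by apply: zr_le; apply/Z.leb_spec0; exact: Z.mul_div_le.
rewrite zrM /x; case: ifPn => [/(zr_ge0 R) v0|v0]; first by rewrite ler_wpM2l.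
by rewrite ler_wnM2l// -(zr0 R); apply: zr_le; lia.
Qed.

Definition sum_lower (ts : seq term) (p : nat) : Z :=
  foldr (fun t => Z.add (term_lower t p)) Z0 ts.

Lemma sum_lowerP (R : realType) ts p : all term_ok ts ->
  zr R (sum_lower ts p) <= \sum_(t <- ts) zr R (weight t) * term_exp R t ^+ p.
Proof.
elim: ts => [|t ts IH] /=; first by rewrite big_nil zr0.
move=> /andP[tok tsok]; rewrite big_cons zrD lerD ?IH//; exact: term_lowerP.
Qed.

Fixpoint pairs_ge0 (s : seq Z) : bool :=
  match s with
  | x :: y :: s' => Z.leb Z0 (Z.add x y) && pairs_ge0 s'
  | x :: [::] => false
  | [::] => true
  end.

Fixpoint alternating (ts : seq term) : bool :=
  match ts with
  | t :: t' :: ts' =>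
      [&& Z.leb Z0 (weight t), Z.leb (weight t') Z0, Z.leb (upper t') (lower t) &
          alternating ts']
  | t :: [::] => false
  | [::] => true
  end.

(* From [p0] on, each term of even rank outweighs the next one, which decays
   faster. *)
Lemma alternating_tail (R : realType) p0 ts p : all term_ok ts -> alternating ts ->
  pairs_ge0 [seq term_lower t p0 | t <- ts] -> (p0 <= p)%N ->
  0 <= \sum_(t <- ts) zr R (weight t) * term_exp R t ^+ p.
Proof.
move=> + + + p0p; have [n] := ubnP (size ts); elim: n ts => // n IH [|t [|t' ts]]//=.
  by rewrite big_nil.
rewrite !ltnS => sn /and3P[tok tok' tsok] /and4P[c0 c0' ul tsa] /andP[tl tsp].
rewrite !big_cons addrA addr_ge0 ?IH//; last exact: ltnW.
have scale0 : 0 < zr R scale by exact: zr_gt0.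
have /andP[lo _] := term_bounds R tok; have /andP[_ hi'] := term_bounds R tok'.
have := zr_ge0 R tl; rewrite zrD => H.
have {H} := le_trans H (lerD (term_lowerP R p0 tok) (term_lowerP R p0 tok')).
have c1' : zr R (weight t') <= 0 by rewrite -(zr0 R); exact: zr_le.
have : term_exp R t' <= term_exp R t.
  by rewrite -(ler_pM2l scale0) (le_trans hi')// (le_trans (zr_le R ul)).
have : 0 <= term_exp R t' by exact: expR_ge0.
move: (term_exp R t) (term_exp R t') => w w' w0' ww'; have w0 := le_trans w0' ww'.
rewrite -(subnK p0p) !exprD mulrCA [X in _ -> _ <= _ + X]mulrCA => E0.
apply: le_trans (_ : 0 <= w ^+ (p - p0) * (zr R (weight t) * w ^+ p0 + zr R (weight t') * w' ^+ p0)) _.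
  by rewrite mulr_ge0 ?exprn_ge0.
rewrite mulrDr lerD2l ler_wnM2r ?mulr_le0_ge0 ?exprn_ge0//.
by rewrite lerXn2r.
Qed.

(* [s] lists the terms with their lower bounds at [p]. *)
Fixpoint sweep (p n : nat) (s : seq (term * Z)) : bool :=
  if n is n'.+1 then
    [&& (36 < p)%N && ((3 %| p)%N || (4 %| p)%N) ==>
        Z.leb Z0 (foldr (fun x => Z.add x.2) Z0 s) &
        sweep p.+1 n' [seq (x.1, lower_step x.1 x.2) | x <- s]]
  else pairs_ge0 [seq x.2 | x <- s].

Lemma sweepP ts p n : sweep p n [seq (t, term_lower t p) | t <- ts] ->
  (forall q, (p <= q < p + n)%N -> (36 < q)%N -> (3 %| q)%N || (4 %| q)%N ->
     Z.leb Z0 (sum_lower ts q)) /\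
  pairs_ge0 [seq term_lower t (p + n) | t <- ts].
Proof.
elim: n p => [|n IH] p /=.
  rewrite addn0 -map_comp => H; split; last exact: H.
  by move=> q; rewrite ltnNge andbN.
move=> /andP[Hp]; rewrite -map_comp => /IH[Hq Ht].
rewrite addnS -addSn; split=> // q /andP[].
rewrite leq_eqVlt => /predU1P[<- _ q36 q34|pq qn]; last by apply: Hq; rewrite pq.
by move: Hp; rewrite q36 q34 /sum_lower foldr_map.
Qed.

(* A pair [(c, t)] with [t = tnum / tden] and enclosures of
   [scale * exp (- pi / 12 * t)] and [scale * exp (- pi / 12 / t)]. *)
Record entry := Entry {
  coef : Z; tnum : nat; tden : nat; direct_lo : Z; direct_hi : Z; dual_lo : Z; dual_hi : Z }.

HB.instance Definition _ := gen_eqMixin entry.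

(** A common multiple of the eighth powers of the numerators 11, 23, 6, 13, 7 and 3; it clears the
    factors [t^-8]. *)
Definition denom : Z := powZ (Z.of_nat (11 * 23 * 6 * 13 * 7)) 8.

Definition direct (e : entry) : term :=
  Term (Z.mul (coef e) denom) (tnum e) (tden e) (direct_lo e) (direct_hi e).
Definition dual (e : entry) : term :=
  Term (Z.opp (Z.mul (coef e) (Z.mul (powZ (Z.of_nat (tden e)) 8)
         (Z.div denom (powZ (Z.of_nat (tnum e)) 8)))))
       (tden e) (tnum e) (dual_lo e) (dual_hi e).

(** The solution of the linear program, normalized so that its largest coefficient is [- 10^12]. The
    signs alternate as [t] grows. *)
Definition entries : seq entry :=
  [:: Entry 487087500251 11 10 6595109051867 6595109051872 6933108049808 6933108049811;
      Entry (-1000000000000) 23 20 6509341845966 6509341845971 7005222950249 7005222950253;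
      Entry 696111434532 6 5 6424690014133 6424690014137 7071987032186 7071987032189;
      Entry (-180429643889) 13 10 6258674641022 6258674641026 7191670660823 7191670660826;
      Entry 46347466798 7 5 6096949140893 6096949140898 7295867452314 7295867452318;
      Entry (-6111236126) 3 2 5939402662504 5939402662509 7387391701649 7387391701652].

(** Sorted by increasing decay rate, from 2/3 to 3/2. A dual term has the opposite sign and the
    inverse rate, so after the reversal the signs alternate throughout, starting with a positive
    one. *)
Definition terms : seq term := rev (map dual entries) ++ map direct entries.

Definition entry_pairs (R : realType) : seq (R * R) :=
  [seq (zr R (coef e), (tnum e)%:R / (tden e)%:R) | e <- entries].

Definition entry_ok (e : entry) : bool :=
  [&& (0 < tnum e)%N, (0 < tden e)%N &
      Z.eqb (Z.mul (Z.div denom (powZ (Z.of_nat (tnum e)) 8)) (powZ (Z.of_nat (tnum e)) 8)) denom].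

Lemma entries_ok : all entry_ok entries. Proof. by vm_compute. Qed.

Lemma terms_ok : all term_ok terms. Proof. by vm_compute. Qed.

Lemma terms_alternating : alternating terms. Proof. by vm_compute. Qed.

(** Norms up to [206 / 12] are checked one by one; at 207 consecutive pairs have nonnegative sums,
    and [alternating_tail] takes over. *)
Lemma terms_sweep : sweep 0 207 [seq (t, weight t) | t <- terms].
Proof. by vm_compute. Qed.

Lemma terms_initial :
  Z.ltb Z0 (sum_lower terms 0) &&
  Z.ltb Z0 (Z.add (sum_lower terms 0) (Z.mul 4864 (sum_lower terms 36))).
Proof. by vm_compute. Qed.

Lemma antisym_theta_terms (R : realType) p :
  \sum_(t <- terms) zr R (weight t) * term_exp R t ^+ p =
  zr R denom * antisym_theta (entry_pairs R) (p%:R / 12).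
Proof.
have -> (F : term -> R) : \sum_(t <- terms) F t = \sum_(e <- entries) (F (dual e) + F (direct e)).
  rewrite /terms; move: entries => es.
  by rewrite big_cat (perm_big (map dual es)) ?perm_rev//= !big_map -big_split.
rewrite /antisym_theta /entry_pairs big_map mulr_sumr.
apply: eq_big_seq => e /(allP entries_ok) /and3P[].
rewrite /dual /direct /term_exp; move: denom => D.
case: e => c a b lo hi lo' hi' /= a0 b0 /Z.eqb_eq /(congr1 (zr R)).
rewrite !(zr_pow, zr_nat, zrM, zrN) => dE.
have an : (a%:R : R) != 0 by rewrite pnatr_eq0 -lt0n.
have bn : (b%:R : R) != 0 by rewrite pnatr_eq0 -lt0n.
have E (x y : R) : expR (- (pi / 12 * (x / y))) ^+ p = expR (- (pi * (x / y) * (p%:R / 12))).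
  by rewrite -expRM_natl; congr expR; move: (pi : R) (x / y) => P z; field.
rewrite !E invf_div exprMn exprVn -dE.
move: (expR _) (expR _) (zr R (Z.div _ _)) (zr R c) => x y w v.
by move: (a%:R : R) (b%:R : R) an bn => A B an bn; field.
Qed.

(** The index [p] stands for the norm [p / 12]: 36 is norm 3, multiples of 3 are the quarters and
    multiples of 4 the thirds. *)
Lemma antisym_theta_ge0 (R : realType) p : (36 < p)%N -> (3 %| p)%N || (4 %| p)%N ->
  0 <= antisym_theta (entry_pairs R) (p%:R / 12).
Proof.
move=> p36 p34; have D0 : 0 < zr R denom by exact: zr_gt0.
rewrite -(pmulr_rge0 _ D0) -antisym_theta_terms.
have [small tail] := sweepP terms_sweep.
have [p207|p207] := leqP 207 p; first exact: (alternating_tail R terms_ok terms_alternating tail).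
by apply: le_trans (sum_lowerP R p terms_ok); apply: zr_ge0; exact: small.
Qed.

Lemma antisym_theta_gt0 (R : realType) :
  0 < antisym_theta (entry_pairs R) 0 /\
  0 < antisym_theta (entry_pairs R) 0 + 4864 * antisym_theta (entry_pairs R) 3.
Proof.
have D0 : 0 < zr R denom by exact: zr_gt0.
have L0 := sum_lowerP R 0 terms_ok; have L36 := sum_lowerP R 36 terms_ok.
rewrite antisym_theta_terms mul0r in L0.
rewrite antisym_theta_terms (_ : 36%:R / 12 = 3) in L36; last by field.
have := terms_initial; move: (sum_lower terms 0) (sum_lower terms 36) L0 L36 => a b L0 L36.
move=> /andP[/(zr_gt0 R) z0 /(zr_gt0 R)].
rewrite zrD zrM (zr_nat R 4864) => z36.
split; first by rewrite -(pmulr_rgt0 _ D0); exact: lt_le_trans L0.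
rewrite -(pmulr_rgt0 _ D0); apply: lt_le_trans z36 _.
have := ler0n R 4864; move: (4864%:R : R) => K K0.
by rewrite mulrDr mulrCA; apply: lerD L0 _; exact: ler_wpM2l.
Qed.

Theorem theorem9p6 (R : realType) :
  ~ exists L : set 'rV[R]_16,
      [/\ is_lattice L,
          strongly_perfect L,
          strongly_perfect (dual_lattice L)
        & lattice_min L * lattice_min (dual_lattice L) = 9].
Proof.
have [g0 g03] := antisym_theta_gt0 R.
apply: (@no_dual_pair R (entry_pairs R)) => //.
- move=> _ /mapP[e /(allP entries_ok) /and3P[a0 b0 _] ->] /=.
  by rewrite divr_gt0// ltr0n.
- move=> p p9; rewrite (_ : p%:R / 3 = (4 * p)%:R / 12); last by rewrite natrM; field.
  by apply: antisym_theta_ge0; [lia | rewrite [(4 %| _)%N]dvdn_mulr ?orbT].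
- move=> p p12; rewrite (_ : p%:R / 4 = (3 * p)%:R / 12); last by rewrite natrM; field.
  by apply: antisym_theta_ge0; [lia | rewrite [(3 %| _)%N]dvdn_mulr].
Qed.
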